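(* Let $\mathfrak g=\mathfrak g_0\oplus\mathfrak g_1$ be a finite-dimensional Lie superalgebra over a field of characteristic $0$, let $q=\dim\mathfrak g_1$, and let $d$ be a basis of the one-dimensional space $S^q(\mathfrak g_1)$. Assume that $\operatorname{str}_{\mathfrak g_1}(\operatorname{ad}a)=0$ for all $a\in\mathfrak g_0$. Let $J_2\in S(\mathfrak g_1)^*$ be $$J_2=\operatorname{Ber}_{\mathfrak g_1}\left(\frac{\sinh(\operatorname{ad}\frac y2)}{\operatorname{ad}\frac y2}\right),$$ where $y$ is the generic point of $\mathfrak g_1$. Then $\beta(J_2d)$ is a Gorelik element of $U(\mathfrak g)$.
   Context: Everything is $\mathbb Z/2\mathbb Z$-graded; $p(\cdot)$ is the parity and signs follow the rule of signs. $S(\cdot)$ denotes the symmetric algebra in the super sense; since $\mathfrak g_1$ is purely odd, $S(\mathfrak g_1)$ is the exterior algebra of $\mathfrak g_1$, and it is a Hopf superalgebra with coproduct $\Delta(w)=\sum w_i\otimes w_i'$ (elements of $\mathfrak g_1$ primitive). The dual $S(\mathfrak g_1)^*$ is a supercommutative algebra (dual of the coalgebra), and it acts on $S(\mathfrak g_1)$ by $fw=\sum f(w_i)w'_i$ (interior product). $\beta:S(\mathfrak g)\to U(\mathfrak g)$ is the symmetrization map, $\beta(a_1\cdots a_n)=\frac1{n!}\sum_{s\in S_n}\pm a_{s(1)}\cdots a_{s(n)}$. Generic point: let $(e_i)_{1\le i\le q}$ be a basis of $\mathfrak g_1$ and $(x^i)$ the dual basis of $\mathfrak g_1^*$. The generic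 point is the even element $y=\sum_i e_ix^i$ of the Lie $S(\mathfrak g_1)^*$-superalgebra $\mathfrak g\otimes S(\mathfrak g_1)^*$. One has $\operatorname{ad}^ky=0$ for $k>q$, and $\operatorname{ad}^ky$ preserves $\mathfrak g_1\otimes S(\mathfrak g_1)^*$ for $k$ even. Thus $\frac{\sinh(\operatorname{ad}(y/2))}{\operatorname{ad}(y/2)}=1+\frac{\operatorname{ad}^2y}{24}+\frac{\operatorname{ad}^4y}{1920}+\cdots$ is a finite sum, and $\operatorname{Ber}_{\mathfrak g_1}$ denotes the Berezinian, over $S(\mathfrak g_1)^*$, of the even invertible endomorphism it induces on $\mathfrak g_1\otimes S(\mathfrak g_1)^*$ (here the inverse of the determinant, as $\mathfrak g_1$ is odd). $\operatorname{str}_{\mathfrak g_1}$ is the supertrace of an endomorphism of $\mathfrak g_1$. Twisted adjoint action: let $\sigma$ be the automorphism of $\mathfrak g$ equal to $1$ on $\mathfrak g_0$ and $-1$ on $\mathfrak g_1$; for $a\in\mathfrak g$, $u\in U(\mathfrak g)$ put $\operatorname{ad}'(a)(u)=au-(-1)^{p(a)p(u)}u\,\sigma(a)$. The subspace $\beta(S(\mathfrak g_1))$ is stable under this action. A Gorelik element of $U(\mathfrak g)$ is a nonzero element $T\in\beta(S(\mathfrak g_1))$ with $\operatorname{ad}'(a)(T)=0$ for all $a\in\mathfrak g$. *)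

(* Defs.v *)
From HB Require Import structures.
From mathcomp Require Import all_boot all_order all_algebra all_fingroup all_field.
From mathcomp Require Import ring.

Set Implicit Arguments.
Unset Strict Implicit.
Unset Printing Implicit Defensive.

Import GRing.Theory.
Local Open Scope ring_scope.

(* Parities are booleans: [false] is even, [true] is odd, and the rule of     *)
(* signs reads (-1) ^+ (b && c) for parities b and c.                         *)

(* A Z/2-grading of V, given by the projections gr false, gr true onto the    *)
(* even and odd components.                                                   *)
Record grading (K : fieldType) (V : lmodType K) := Grading {
  gr :> bool -> {linear V -> V};
  gr_orth : forall b c v, gr b (gr c v) = if b == c then gr c v else 0;
  gr_sum : forall v, gr false v + gr true v = v
}.

Definition homog (K : fieldType) (V : lmodType K) (G : grading V)
  (b : bool) (v : V) : Prop := G b v = v.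

Record lieSuperalgebra (K : fieldType) := LieSuperalgebra {
  lie_sort :> vectType K;
  lie_gr : grading lie_sort;
  lie : lie_sort -> lie_sort -> lie_sort;
  lieDl : forall k x y z, lie (k *: x + y) z = k *: lie x z + lie y z;
  lieDr : forall k x y z, lie z (k *: x + y) = k *: lie z x + lie z y;
  lie_homog : forall b c x y, homog lie_gr b x -> homog lie_gr c y ->
    homog lie_gr (b (+) c) (lie x y);
  lie_antisym : forall b c x y, homog lie_gr b x -> homog lie_gr c y ->
    lie x y = - ((-1) ^+ (b && c) *: lie y x);
  lie_jacobi : forall b c x y z, homog lie_gr b x -> homog lie_gr c y ->
    lie x (lie y z) = lie (lie x y) z + (-1) ^+ (b && c) *: lie y (lie x z)
}.

Record superalgebra (K : fieldType) := Superalgebra {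
  salg_sort :> algType K;
  salg_gr : grading salg_sort;
  salg_homog1 : homog salg_gr false 1;
  salg_homogM : forall b c u v, homog salg_gr b u -> homog salg_gr c v ->
    homog salg_gr (b (+) c) (u * v)
}.

Definition even_map (K : fieldType) (V W : lmodType K)
  (GV : grading V) (GW : grading W) (f : V -> W) : Prop :=
  forall b v, homog GV b v -> homog GW b (f v).

(* f is a morphism of Lie superalgebras from g to A with the supercommutator. *)
Definition lie_morphism (K : fieldType) (g : lieSuperalgebra K)
  (A : superalgebra K) (f : {linear g -> A}) : Prop :=
  even_map (lie_gr g) (salg_gr A) f /\
  forall b c x y, homog (lie_gr g) b x -> homog (lie_gr g) c y ->
    f (lie x y) = f x * f y - (-1) ^+ (b && c) *: (f y * f x).

(* U(g), specified up to unique isomorphism by its universal property. *)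
Record envelopingAlgebra (K : fieldType) (g : lieSuperalgebra K) :=
  EnvelopingAlgebra {
  uea_sort :> superalgebra K;
  uea_in : {linear g -> uea_sort};
  uea_morph : lie_morphism uea_in;
  uea_univ : forall (A : superalgebra K) (f : {linear g -> A}),
    lie_morphism f ->
    exists phi : {lrmorphism uea_sort -> A},
      [/\ even_map (salg_gr uea_sort) (salg_gr A) phi,
          forall x, phi (uea_in x) = f x
        & forall psi : {lrmorphism uea_sort -> A},
            even_map (salg_gr uea_sort) (salg_gr A) psi ->
            (forall x, psi (uea_in x) = f x) -> psi =1 phi]
}.

Section LieSuper.
Variables (K : fieldType) (g : lieSuperalgebra K).

Definition odd_part : {vspace g} := limg (linfun (lie_gr g true)).

Definition sigma (x : g) : g := lie_gr g false x - lie_gr g true x.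

(* The part is purely odd, whence the sign of the supertrace. *)
Definition str_odd (q : nat) (e : q.-tuple g) (phi : g -> g) : K :=
  - \sum_(i < q) coord e i (phi e`_i).

End LieSuper.

(* For a space with basis e_0, ..., e_(q-1), purely odd, the monomials        *)
(* e_A = e_(a_1) ... e_(a_n), where A = {a_1 < ... < a_n}, form a basis of    *)
(* the (super)symmetric algebra; w A is the coefficient of e_A in w.          *)
Definition sym (K : fieldType) (q : nat) : Type := {ffun {set 'I_q} -> K}.

HB.instance Definition _ (K : fieldType) (q : nat) :=
  Vector.copy (sym K q) {ffun {set 'I_q} -> K^o}.

Section Sym.
Variables (K : fieldType) (q : nat).
Implicit Types (A B C : {set 'I_q}) (w : sym K q).

Definition sym_mon A : sym K q := [ffun B => (B == A)%:R].

Definition sym_deg (n : nat) : {vspace sym K q} :=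
  <<[seq sym_mon A | A in [set A : {set 'I_q} | #|A| == n]]>>%VS.

(* e_A e_B = mon_sign A B *: e_(A :|: B). *)
Definition mon_sign A B : K :=
  \prod_(a in A) \prod_(b in B) (if a == b then 0 else (-1) ^+ (b < a)%N).

(* The coefficient of e_A (x) e_B in Delta(w), for (A, B) = p. The product of *)
(* the Delta(e_c) = e_c (x) 1 + 1 (x) e_c over c in C, in increasing order,   *)
(* is the sum of the mon_sign A B *: e_A (x) e_B over the partitions of C     *)
(* into A and B: there is a factor -1 for each e_a (x) 1 that passes a        *)
(* 1 (x) e_b with b < a.                                                      *)
Definition sym_cop w : {ffun {set 'I_q} * {set 'I_q} -> K} :=
  [ffun p => mon_sign p.1 p.2 * w (p.1 :|: p.2)].

End Sym.

(* The dual of sym K q: f A is the value of the linear form f at e_A. *)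
Definition dsym (K : fieldType) (q : nat) : Type := {ffun {set 'I_q} -> K}.

HB.instance Definition _ (K : fieldType) (q : nat) :=
  Vector.copy (dsym K q) {ffun {set 'I_q} -> K^o}.

Section DualAlgebra.
Variables (K : fieldType) (q : nat).
Implicit Types (A B C : {set 'I_q}) (f g h : dsym K q).

(* The dual basis of the basis of monomials. *)
Definition dsym_mon A : dsym K q := [ffun B => (B == A)%:R].

Definition dsym_one : dsym K q := dsym_mon set0.

(* (fg)(w) = \sum (-1)^(p(g)p(w_i)) f(w_i) g(w'_i). *)
Definition dsym_mul f g : dsym K q :=
  [ffun C => \sum_(p : {set 'I_q} * {set 'I_q})
     (-1) ^+ (#|p.1| * #|p.2|) * f p.1 * g p.2 * sym_cop (sym_mon K C) p].

Let m A B : K := (-1) ^+ (#|A| * #|B|) * mon_sign K A B.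

Let mE A B :
  m A B = \prod_(a in A) \prod_(b in B)
            (- (if a == b then 0 else (-1) ^+ (b < a)%N)).
Proof.
rewrite /m /mon_sign mulnC exprM -prodr_const -big_split /=.
by apply: eq_bigr => a _; rewrite prodrN.
Qed.

Let m0 A B : ~~ [disjoint A & B] -> m A B = 0.
Proof.
case/pred0Pn=> x /andP[xA xB].
by rewrite mE (bigD1 x) //= (bigD1 x) //= eqxx oppr0 !mul0r.
Qed.

Let mUr A B C : [disjoint B & C] -> m A (B :|: C) = m A B * m A C.
Proof.
move=> dBC; rewrite !mE -big_split /=; apply: eq_bigr => a _.
by rewrite -bigU //=; apply: eq_bigl => b; rewrite inE.
Qed.

Let mUl A B C : [disjoint A & B] -> m (A :|: B) C = m A C * m B C.
Proof.
move=> dAB; rewrite !mE -bigU //=.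
by apply: eq_bigl => b; rewrite inE.
Qed.

Let mA A B C : m B C * m A (B :|: C) = m A B * m (A :|: B) C.
Proof.
have [dBC|nBC] := boolP [disjoint B & C]; last first.
  rewrite m0 // mul0r [m (A :|: B) C]m0 ?mulr0 //.
  by apply: contra nBC; apply: disjointWl; apply: subsetUr.
have [dAB|nAB] := boolP [disjoint A & B]; last first.
  rewrite [m A B]m0 // mul0r [m A _]m0 ?mulr0 //.
  by apply: contra nAB; apply: disjointWr; apply: subsetUl.
by rewrite mUr // mUl //; ring.
Qed.

Let dsym_mulE f g C :
  dsym_mul f g C = \sum_A \sum_B m A B * f A * g B * (A :|: B == C)%:R.
Proof.
rewrite ffunE pair_bigA /=; apply: eq_bigr => -[A B] _ /=.
rewrite !ffunE /= /m !mulrA; congr (_ * _).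
by rewrite -!mulrA; congr (_ * _); rewrite mulrA mulrC.
Qed.

Let sum_pick (F : {set 'I_q} -> K) D :
  \sum_C F C * (D == C)%:R = F D.
Proof.
rewrite (bigD1 D) //= eqxx mulr1 big1 ?addr0 // => C nCD.
by rewrite eq_sym (negbTE nCD) mulr0.
Qed.

Fact dsym_mulA : associative dsym_mul.
Proof.
move=> f g h; apply/ffunP=> E; rewrite !dsym_mulE.
transitivity (\sum_A \sum_B \sum_C m A B * m (A :|: B) C * f A * g B * h C
                * (A :|: B :|: C == E)%:R).
  apply: eq_bigr => A _.
  under eq_bigr => D _.
    rewrite dsym_mulE mulrAC mulr_sumr.
    under eq_bigr => B _.
      rewrite mulr_sumr.
      under eq_bigr => C _ do rewrite mulrA.
      over.
    over.
  rewrite exchange_big /=; apply: eq_bigr => B _.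
  rewrite exchange_big /=; apply: eq_bigr => C _.
  pose F D := m A D * f A * (A :|: D == E)%:R * (m B C * g B * h C).
  rewrite -[LHS]/(\sum_D F D * (B :|: C == D)%:R) sum_pick /F -mA -setUA; ring.
symmetry; rewrite exchange_big /=.
under eq_bigr => C _.
  under eq_bigr => D _.
    rewrite dsym_mulE (mulrC (m D C)) !mulr_suml.
    under eq_bigr => A _ do rewrite !mulr_suml.
    over.
  rewrite exchange_big /=.
  under eq_bigr => A _.
    rewrite exchange_big /=.
    under eq_bigr => B _.
      pose F D := m D C * h C * (D :|: C == E)%:R * (m A B * f A * g B).
      rewrite (eq_bigr (fun D => F D * (A :|: B == D)%:R)); last first.
        by move=> D _; rewrite /F; ring.
      rewrite sum_pick /F.
      over.
    over.
  over.
rewrite exchange_big /=; apply: eq_bigr => A _.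
rewrite exchange_big /=; apply: eq_bigr => B _.
by apply: eq_bigr => C _; ring.
Qed.

Let m1l B : m set0 B = 1.
Proof. by rewrite mE big_set0. Qed.

Let m1r A : m A set0 = 1.
Proof. by rewrite mE big1 // => a _; rewrite big_set0. Qed.

Fact dsym_mul1l : left_id dsym_one dsym_mul.
Proof.
move=> f; apply/ffunP=> C; rewrite dsym_mulE (bigD1 set0) //=.
rewrite [X in _ + X]big1 ?addr0 => [|A nA]; last first.
  by rewrite big1 // => B _; rewrite ffunE (negbTE nA) mulr0 !mul0r.
under eq_bigr => B _ do rewrite m1l ffunE eqxx !mul1r set0U eq_sym.
rewrite (bigD1 C) //= eqxx mulr1 big1 ?addr0 // => B nB.
by rewrite eq_sym (negbTE nB) mulr0.
Qed.

Fact dsym_mul1r : right_id dsym_one dsym_mul.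
Proof.
move=> f; apply/ffunP=> C; rewrite dsym_mulE exchange_big /= (bigD1 set0) //=.
rewrite [X in _ + X]big1 ?addr0 => [|B nB]; last first.
  by rewrite big1 // => A _; rewrite ffunE (negbTE nB) mulr0 mul0r.
under eq_bigr => A _ do rewrite m1r ffunE eqxx mul1r mulr1 setU0 eq_sym.
rewrite (bigD1 C) //= eqxx mulr1 big1 ?addr0 // => A nA.
by rewrite eq_sym (negbTE nA) mulr0.
Qed.

Fact dsym_mulDl : left_distributive dsym_mul +%R.
Proof.
move=> f g h; apply/ffunP=> C; rewrite !ffunE -big_split.
by apply: eq_bigr => p _; rewrite ffunE /=; ring.
Qed.

Fact dsym_mulDr : right_distributive dsym_mul +%R.
Proof.
move=> f g h; apply/ffunP=> C; rewrite !ffunE -big_split.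
by apply: eq_bigr => p _; rewrite ffunE /=; ring.
Qed.

Fact dsym_one_neq0 : dsym_one != 0.
Proof.
by apply/eqP => /ffunP/(_ set0)/eqP; rewrite !ffunE eqxx oner_eq0.
Qed.

HB.instance Definition _ := GRing.Zmodule_isNzRing.Build (dsym K q)
  dsym_mulA dsym_mul1l dsym_mul1r dsym_mulDl dsym_mulDr dsym_one_neq0.

Fact dsym_scaleAl k f g : k *: (f * g) = (k *: f) * g.
Proof.
apply/ffunP=> C; rewrite !ffunE scaler_sumr.
apply: eq_bigr => p _; rewrite -[LHS]/(k * _).
have -> : (k *: f) p.1 = k * f p.1 by rewrite ffunE.
by ring.
Qed.

HB.instance Definition _ :=
  GRing.Lmodule_isLalgebra.Build K (dsym K q) dsym_scaleAl.

Fact dsym_scaleAr k f g : k *: (f * g) = f * (k *: g).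
Proof.
apply/ffunP=> C; rewrite !ffunE scaler_sumr.
apply: eq_bigr => p _; rewrite -[LHS]/(k * _).
have -> : (k *: g) p.2 = k * g p.2 by rewrite ffunE.
by ring.
Qed.

HB.instance Definition _ :=
  GRing.Lalgebra_isAlgebra.Build K (dsym K q) dsym_scaleAr.

HB.instance Definition _ := Algebra_isFalgebra.Build K (dsym K q).

(* The interior product fw = \sum f(w_i) w'_i. *)
Definition interior f (w : sym K q) : sym K q :=
  \sum_(p : {set 'I_q} * {set 'I_q}) (f p.1 * sym_cop w p) *: sym_mon K p.2.

End DualAlgebra.

Section GenericPoint.
Variables (K : fieldType) (g : lieSuperalgebra K) (q : nat) (e : q.-tuple g).

(* g (x) S(g_1)^*: v stands for the sum over A of v A (x) dsym_mon A. *)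
Definition gdsym : Type := {ffun {set 'I_q} -> g}.
Implicit Types (u v : gdsym).

Definition gtens (x : g) (f : dsym K q) : gdsym := [ffun A => f A *: x].

(* [a (x) f, b (x) h] = (-1)^(p(f)p(b)) [a, b] (x) fh, where the sign is the  *)
(* action of sigma ^ p(f) on b.                                               *)
Definition glie u v : gdsym :=
  \sum_(A : {set 'I_q}) \sum_(B : {set 'I_q})
    gtens (lie (u A) (iter #|A| (@sigma K g) (v B)))
          (dsym_mon K A * dsym_mon K B).

Definition generic_point : gdsym :=
  \sum_(i < q) gtens e`_i (dsym_mon K [set i]).

(* sinh(ad(y/2)) / ad(y/2), with terms up to ad^(2q) y; as ad^k y = 0 for     *)
(* k > q, the other terms of the series vanish.                               *)
Definition sinhc_ad v : gdsym :=
  \sum_(k < q.+1) ((2 * k).+1`!%:R : K)^-1 *: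
    iter (2 * k) (glie ((2%:R : K)^-1 *: generic_point)) v.

(* The matrix over S(g_1)^* of the endomorphism that phi induces on           *)
(* g_1 (x) S(g_1)^*, in the basis e_j (x) 1.                                  *)
Definition odd_matrix (phi : gdsym -> gdsym) : 'M[dsym K q]_q :=
  \matrix_(i, j) ([ffun A => coord e i (phi (gtens e`_j 1) A)] : dsym K q).

(* The Berezinian on a purely odd module is the inverse of the determinant;   *)
(* the matrix of an even endomorphism has its entries in the (commutative)    *)
(* even part of S(g_1)^*.                                                     *)
Definition Ber_odd (phi : gdsym -> gdsym) : dsym K q :=
  (\det (odd_matrix phi))^-1.

Definition J2 : dsym K q := Ber_odd sinhc_ad.

End GenericPoint.

Section Gorelik.
Variables (K : fieldType) (g : lieSuperalgebra K) (U : envelopingAlgebra g).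
Variables (q : nat) (e : q.-tuple g).

(* The restriction to S(g_1) of the symmetrization map; enum_val lists A in   *)
(* increasing order.                                                          *)
Definition beta_mon (A : {set 'I_q}) : U :=
  (#|A|`!%:R : K)^-1 *:
    \sum_(s : 'S_#|A|) (-1) ^+ s * \prod_(i < #|A|) uea_in U e`_(enum_val (s i)).

Definition beta (w : sym K q) : U := \sum_(A : {set 'I_q}) w A *: beta_mon A.

Definition ad' (a : g) (u : U) : U :=
  \sum_(b : bool) \sum_(c : bool)
    let a_ := lie_gr g b a in let u_ := salg_gr U c u in
    uea_in U a_ * u_ - (-1) ^+ (b && c) *: (u_ * uea_in U (sigma a_)).

Definition Gorelik_element (T : U) : Prop :=
  [/\ T != 0, exists w : sym K q, T = beta w & forall a : g, ad' a T = 0].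

End Gorelik.

(* Main.v *)
Require Import Defs.
From HB Require Import structures.
From mathcomp Require Import all_boot all_order all_algebra all_fingroup all_field.
From mathcomp Require Import ring.

Set Implicit Arguments.
Unset Strict Implicit.
Unset Printing Implicit Defensive.

Import GRing.Theory.
Local Open Scope ring_scope.

(* The odd part g_1 is regarded as the symmetric superspace G/G_0, with generic
   point e^y. Each a in g acts on S(g_1)^* by a vector field X_a such that
   X_a (e^y) = a e^y - e^y sigma(a) in U(g) (x) S(g_1)^*, where
   e^y = \sum_A beta(e_A) (x) x_A. Hence the twisted adjoint invariance of
   beta(J d) means that the density J is annihilated by all X_a. The matrix of
   sinh(ad(y/2)) / ad(y/2) trivializes the tangent bundle up to an even
   compensator kappa in g_0 (x) S(g_1)^*; as str(ad kappa) = 0 on g_1, Liouville's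
   formula shows that the inverse of its determinant is an invariant density.
   Finally a |-> - X_a is a representation of g by differential operators, whose
   leading terms on g_1 are the 2 d/dx_i; the image of beta(J d) sends the top
   monomial to a function with nonzero constant term, so that beta(J d) <> 0,
   without any appeal to the Poincare-Birkhoff-Witt theorem. *)

(** * Truncated power series in two variables *)

(** For odd [a] the field X_a is ad z coth(ad z) at z = y/2. The half comes from e^y = e^(2z): a e^y
    + e^y a is (1 + e^(2 ad z))(a) e^y, to be matched with (e^(2 ad z) - 1)/ad z. The obstacle is
    that this is a quotient and that X_a does not commute with ad z. Every fact needed is therefore
    turned into an identity of hyperbolic functions in two commuting variables: Y is ad z on the
    left argument of a bracket, X is ad z on the right argument, and X+Y acts on the bracket itself
    since ad z is a derivation. Commutators with p(ad z) are governed by the divided difference of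
    p. Quotients are avoided by differentiating S(ad z) V = cosh(ad z) a, where S(x) = sinh(x)/x.
    The Jacobian, the commutators of the fields and their action on e^y then come down to
    sinh((X+Y)-Y) = sinh X, to the addition formulas, and to tanh Y = (e^(2Y)-1)/(e^(2Y)+1).
    Truncated series suffice, as ad z raises the Grassmann degree and only total degrees up to q
    matter. *)

Section Truncated.
Variable K : fieldType.
Implicit Types (p : {poly K}) (P Q : {poly {poly K}}).

(** Vanishing to total order [n]; the outer variable 'X has exponent [j], the inner variable 'Y
    exponent [i]. Thus [p%:P] reads p(Y), [p^:P] reads p(X), and [poly_XaY p] reads p(X+Y). *)
Definition low n P := forall i j, (i + j < n)%N -> P`_j`_i = 0.

Lemma lowW m n P : (m <= n)%N -> low n P -> low m P.
Proof. by move=> le_mn lP i j lt_ij; apply: lP; apply: leq_trans le_mn. Qed.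

Lemma lowD n P Q : low n P -> low n Q -> low n (P + Q).
Proof. by move=> lP lQ i j ltij; rewrite !coefD lP // lQ // addr0. Qed.

Lemma low_eq n P Q : low n P -> P = Q -> low n Q.
Proof. by move=> lP <-. Qed.

Lemma lowB n P Q : low n P -> low n Q -> low n (P - Q).
Proof. by move=> lP lQ i j ltij; rewrite !coefB lP // lQ // subr0. Qed.

Lemma lowMl n P Q : low n P -> low n (Q * P).
Proof.
move=> lP i j ltij; rewrite coefM coef_sum big1 // => k _.
rewrite coefM big1 // => l _; rewrite lP ?mulr0 //.
by apply: leq_ltn_trans ltij; rewrite leq_add // leq_subr.
Qed.

(** Divided differences are known only after multiplication by X or Y; cancelling a variable costs
    one order. *)
Lemma lowMX n P : low n.+1 ('X * P) -> low n P.
Proof. by move=> lP i j ltij; have := lP i j.+1; rewrite coefXM /= addnS; apply. Qed.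

Lemma lowMY n P : low n.+1 ('Y * P) -> low n P.
Proof. by move=> lP i j ltij; have := lP i.+1 j; rewrite coefCM coefXM /=; apply. Qed.

(** The binomial theorem, by Pascal's rule along Horner's scheme. *)
Lemma coef_poly_XaY p i j : (poly_XaY p)`_j`_i = p`_(i + j) *+ 'C(i + j, i).
Proof.
elim/poly_ind: p i j => [|p c IHp] i j; first by rewrite poly_XaY0 !coef0 mul0rn.
have -> : poly_XaY (p * 'X + c%:P) = poly_XaY p * 'X + poly_XaY p * 'Y + c%:P%:P.
  rewrite /poly_XaY rmorphD rmorphM /= map_polyX map_polyC /=.
  by rewrite comp_polyD comp_polyM comp_polyX comp_polyC mulrDr.
rewrite !coefD coefMX coefMC coefMX !coefC coefMX.
case: i j => [|i] [|j] /=; rewrite ?IHp ?coef0 ?add0r ?addr0 ?coefC ?eqxx ?addn0 ?add0n ?bin0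
  ?binn //=.
  by rewrite addr0.
by rewrite addSnnS -mulrnDr addSn binS addnS.
Qed.

Definition expo n (l : K) p := forall k, (k < n)%N -> p`_k = l ^+ k / k`!%:R.

Hypothesis charK0 : [pchar K] =i pred0.

Lemma natK_neq0 n : (n.+1)%:R != 0 :> K.
Proof. by rewrite ((pcharf0P K).1 charK0). Qed.

Lemma factK_neq0 n : n`!%:R != 0 :> K.
Proof. by rewrite ((pcharf0P K).1 charK0) -lt0n fact_gt0. Qed.

Lemma bin_factK i j : ('C(i + j, i))%:R / (i + j)`!%:R = (i`!%:R)^-1 / j`!%:R :> K.
Proof.
have := bin_fact (leq_addr j i); rewrite addKn => <-.
rewrite !natrM; have := (factK_neq0 i, factK_neq0 j).
have : 'C(i + j, i)%:R != 0 :> K by rewrite ((pcharf0P K).1 charK0) -lt0n bin_gt0 leq_addr.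
by move=> nz [nz1 nz2]; field; rewrite nz nz1 nz2.
Qed.

(** The functional equation of the exponential, coefficient by coefficient. *)
Lemma expo_XaY n l p : expo n l p -> low n (poly_XaY p - p%:P * p^:P).
Proof.
move=> ep i j ltij; rewrite coefB coefB coef_poly_XaY coefCM coef_map /= coefMC.
rewrite !ep //; try by apply: leq_ltn_trans ltij; rewrite ?leq_addr ?leq_addl.
rewrite -[X in X - _]mulr_natr -mulrA [_^-1 * _]mulrC bin_factK exprD.
by rewrite mulrACA subrr.
Qed.

Lemma expoM n l m p q : expo n l p -> expo n m q -> expo n (l + m) (p * q).
Proof.
move=> ep eq k ltk; rewrite coefMr exprDn mulr_suml; apply: eq_bigr => i _.
have lik : (i <= k)%N by rewrite -ltnS.
rewrite ep ?eq //; try by apply: leq_ltn_trans ltk; rewrite ?leq_subr.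
rewrite -[in RHS]mulr_natr -[RHS]mulrA.
suff -> : 'C(k, i)%:R / k`!%:R = ((k - i)`!%:R)^-1 / i`!%:R :> K by rewrite mulrACA.
by rewrite mulrC [RHS]mulrC -{1 2}(subnKC lik) mulrC bin_factK.
Qed.

Lemma expo_lowC n l p q : expo n l p -> expo n l q -> low n (p - q)%:P.
Proof.
move=> ep eq i j ltij; rewrite coefC; case: j ltij => [|j] /=; last by rewrite coef0.
by rewrite addn0 => lti; rewrite coefB ep // eq // subrr.
Qed.

Lemma expo0 n : expo n 0 1.
Proof. by move=> [|k] _; rewrite coef1 ?expr0 ?divr1 // expr0n mul0r. Qed.

Lemma half2 : 2%:R != 0 :> K. Proof. exact: natK_neq0 1. Qed.

(** Even series are kept as polynomials in the square of the variable; later this shows at once that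
    they preserve the components in g_0 and g_1. [sinhc_poly] stands for sinh(x)/x. *)
Definition cosh_poly n : {poly K} := \poly_(k < n) ((2 * k)`!%:R)^-1.
Definition sinhc_poly n : {poly K} := \poly_(k < n) ((2 * k).+1`!%:R)^-1.
Definition coshm_poly n : {poly K} := \poly_(k < n) - ((2 * k.+1)`!%:R)^-1.
Definition expp n l : {poly K} := \poly_(k < n) (l ^+ k / k`!%:R).

Lemma expp_expo n l : expo n l (expp n l).
Proof. by move=> k ltk; rewrite coef_poly ltk. Qed.

Lemma coef_compX2 p i : (p \Po 'X^2)`_i = if odd i then 0 else p`_(i./2).
Proof. by rewrite coef_comp_poly_Xn // dvdn2 divn2; case: odd. Qed.

Definition ch n := cosh_poly n \Po 'X^2.
Definition shc n := sinhc_poly n \Po 'X^2.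
(* (1 - cosh x) / x *)
Definition chm n := 'X * (coshm_poly n \Po 'X^2).

Lemma coef_ch n k : (k < 2 * n)%N -> (ch n)`_k = (~~ odd k)%:R / k`!%:R.
Proof.
move=> ltk; rewrite coef_compX2 coef_poly.
have := odd_double_half k; case: (odd k) => /= e; first by rewrite mul0r.
have -> : (k./2 < n)%N by rewrite -(ltn_pmul2l (isT : (0 < 2)%N)) mul2n -[k./2.*2]add0n e.
by rewrite mul1r mul2n -[k./2.*2]add0n e.
Qed.

Lemma coef_sh n k : (k < 2 * n)%N -> ('X * shc n)`_k = (odd k)%:R / k`!%:R.
Proof.
move=> ltk; rewrite coefXM; case: k ltk => [|k] ltk /=; first by rewrite mul0r.
rewrite coef_compX2 coef_poly.
have := odd_double_half k; case: (odd k) => /= e; first by rewrite mul0r.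
have -> : (k./2 < n)%N.
  by rewrite -(ltn_pmul2l (isT : (0 < 2)%N)) mul2n -[k./2.*2]add0n e ltnW.
by rewrite mul1r mul2n -[k./2.*2]add0n e.
Qed.

Lemma expo_chDsh n : expo (2 * n) 1 (ch n + 'X * shc n).
Proof.
move=> k ltk; rewrite coefD coef_ch // coef_sh // expr1n -mulrDl.
by case: odd; rewrite ?add0r ?addr0.
Qed.

Lemma expo_chBsh n : expo (2 * n) (-1) (ch n - 'X * shc n).
Proof.
move=> k ltk; rewrite coefB coef_ch // coef_sh // -mulrBl -signr_odd.
by case: odd; rewrite ?sub0r ?subr0.
Qed.

Lemma poly_XaYD p q : poly_XaY (p + q) = poly_XaY p + poly_XaY q.
Proof. by rewrite /poly_XaY rmorphD comp_polyD. Qed.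

Lemma poly_XaYB p q : poly_XaY (p - q) = poly_XaY p - poly_XaY q.
Proof. by rewrite /poly_XaY rmorphB comp_polyB. Qed.

Lemma poly_XaYM p q : poly_XaY (p * q) = poly_XaY p * poly_XaY q.
Proof. by rewrite /poly_XaY rmorphM comp_polyM. Qed.

Lemma poly_XaYX : poly_XaY 'X = 'X + 'Y :> {poly {poly K}}.
Proof. by rewrite /poly_XaY map_polyX comp_polyX. Qed.

Lemma XaY_chmE n : 'X * chm n = 1 - ch n.+1.
Proof.
apply/polyP=> i; rewrite /chm mulrA -expr2 -[X in X * _](comp_polyX 'X^2) -comp_polyM coefB coef1
  !coef_compX2.
rewrite coefXM !coef_poly; case: i => [|[|i]] /=.
- by rewrite muln0 invr1 subrr.
- by rewrite subrr.
rewrite negbK ltnS; case: odd; rewrite ?subrr // sub0r.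
by case: ifP => //; rewrite oppr0.
Qed.

Section Identities.
Variable n : nat.
Local Notation c := (ch n.+1).
Local Notation S := (shc n.+1).
Local Notation N := (2 * n.+1)%N.

Let lowDD P : low N (P + P) -> low N P.
Proof.
move=> lP i j ltij; apply/eqP; have /eqP := lP i j ltij.
by rewrite !coefD -mulr2n -mulr_natr mulf_eq0 (negPf half2) orbF.
Qed.

Let E := c + 'X * S.
Let E' := c - 'X * S.

Let lowE : low N (poly_XaY E - E%:P * E^:P).
Proof. exact/expo_XaY/expo_chDsh. Qed.

Let lowE' : low N (poly_XaY E' - E'%:P * E'^:P).
Proof. exact/expo_XaY/expo_chBsh. Qed.

Let lowEE' : low N (E * E' - 1)%:P.
Proof.
apply: expo_lowC; last exact: expo0.
by rewrite -(subrr 1); apply: expoM; [apply: expo_chDsh|apply: expo_chBsh].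
Qed.

Let XE (p : {poly K}) : ('X * p)%:P = 'Y * p%:P :> {poly {poly K}}.
Proof. by rewrite rmorphM. Qed.

Let XE' (p : {poly K}) : ('X * p)^:P = 'X * p^:P :> {poly {poly K}}.
Proof. by rewrite rmorphM /= map_polyX. Qed.

(** The functional equations of e^x and e^(-x) add up to twice the addition formula; characteristic
    0 removes the factor 2. *)
Lemma low_chD : low N (poly_XaY c - (c%:P * c^:P + ('X * S)%:P * ('X * S)^:P)).
Proof.
apply/lowDD/(low_eq (lowD lowE lowE')).
by rewrite !(poly_XaYD, poly_XaYB, rmorphD, rmorphB) /=; ring.
Qed.

Lemma low_shD :
  low N (poly_XaY ('X * S) - (('X * S)%:P * c^:P + c%:P * ('X * S)^:P)).
Proof.
apply/lowDD/(low_eq (lowB lowE lowE')).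
by rewrite !(poly_XaYD, poly_XaYB, rmorphD, rmorphB) /=; ring.
Qed.

Lemma low_chB : low N (c%:P * c%:P - ('X * S)%:P * ('X * S)%:P - 1).
Proof.
apply: (low_eq lowEE').
by rewrite /E /E' !(rmorph1, rmorphD, rmorphB, rmorphM) /=; ring.
Qed.

(** Divided differences (p(X+Y) - p(X))/Y; [swapXY] turns them into (p(X+Y) - p(Y))/X. *)
Variables DS Dc : {poly {poly K}}.
Hypothesis DSE : 'Y * DS = poly_XaY S - S^:P.
Hypothesis DcE : 'Y * Dc = poly_XaY c - c^:P.

Let DSE' : 'X * swapXY DS = poly_XaY S - S%:P.
Proof. by rewrite -swapXY_Y -rmorphM DSE rmorphB /= swapXY_poly_XaY swapXY_map_polyC. Qed.

Let DcE' : 'X * swapXY Dc = poly_XaY c - c%:P.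
Proof. by rewrite -swapXY_Y -rmorphM DcE rmorphB /= swapXY_poly_XaY swapXY_map_polyC. Qed.

Let XaY_shE : poly_XaY ('X * S) = ('X + 'Y) * poly_XaY S.
Proof. by rewrite poly_XaYM poly_XaYX. Qed.

(** Multiplied by XY, the expression collapses to sinh(X+Y) cosh Y - cosh(X+Y) sinh Y - sinh X. The
    two cancelled variables lower the order from 2n+2 to 2n. *)
Lemma jacobian_identity :
  low (2 * n) (DS * c%:P + swapXY DS * c%:P - swapXY Dc * S%:P
               - (chm n)%:P * S^:P).
Proof.
apply/lowMY/lowMX; have -> : (2 * n).+2 = N by rewrite mulnS.
have Ek : 'Y * (chm n)%:P = 1 - c%:P by rewrite -rmorphM /= XaY_chmE rmorphB.
have := lowD (lowB (lowMl c%:P low_shD) (lowMl ('X * S)%:P low_chD))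
             (lowMl ('X * S^:P) low_chB).
move=> /low_eq; apply.
transitivity ('X * ('Y * DS) * c%:P + 'Y * ('X * swapXY DS) * c%:P
  - 'Y * ('X * swapXY Dc) * S%:P - 'X * ('Y * (chm n)%:P) * S^:P); last by ring.
rewrite DSE DSE' DcE' Ek XaY_shE XE XE'; ring.
Qed.

(** Multiplication by XY leaves cosh(X+Y) (sinh X cosh Y + cosh X sinh Y) - sinh(X+Y) (cosh X cosh Y
    + sinh X sinh Y), a difference of equal products by the addition formulas. *)
Lemma bracket_identity :
  low (2 * n) (c%:P * (Dc * S^:P - DS * c^:P)
               + c^:P * (swapXY Dc * S%:P - swapXY DS * c%:P)
               - poly_XaY ('X * S) * (S%:P * S^:P)).
Proof.
apply/lowMY/lowMX; have -> : (2 * n).+2 = N by rewrite mulnS.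
have := lowB (lowMl (poly_XaY ('X * S)) low_chD) (lowMl (poly_XaY c) low_shD).
move=> /low_eq; apply.
transitivity ('X * (c%:P * ('Y * Dc * S^:P - 'Y * DS * c^:P))
  + 'Y * (c^:P * ('X * swapXY Dc * S%:P - 'X * swapXY DS * c%:P))
  - poly_XaY ('X * S) * ('Y * S%:P * ('X * S^:P))); last by ring.
rewrite DSE DSE' DcE DcE' XaY_shE XE XE'; ring.
Qed.

(** Multiplied by Y this is (e^(2Y) - 1) cosh Y = (e^(2Y) + 1) sinh Y, times e^(2X). In the proof
    e^(2Y) is traded for the square of cosh Y + sinh Y. *)
Lemma exp_identity De (e := expp N 2%:R) : 'Y * De = poly_XaY e - e^:P ->
  low (2 * n) (De * c%:P - (poly_XaY e + e^:P) * S%:P).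
Proof.
move=> DeE; apply: (@lowW _ (2 * n).+1) => //; apply: lowMY.
have -> : (2 * n).+2 = N by rewrite mulnS.
have lowe : low N (e - E * E)%:P.
  apply: expo_lowC; first exact: expp_expo.
  by rewrite -[2%:R]/(1 + 1)%R; apply: expoM; apply: expo_chDsh.
have := lowD (lowD (lowMl E'%:P (expo_XaY (@expp_expo N 2%:R)))
  (lowMl (e^:P * E'%:P) lowe)) (lowMl (e^:P * E%:P) lowEE').
move=> /low_eq; apply.
transitivity ('Y * De * c%:P - (poly_XaY e + e^:P) * ('Y * S%:P)); last by ring.
rewrite DeE -XE.
by rewrite /E /E' !(rmorph1, rmorphD, rmorphB, rmorphM) /=; ring.
Qed.

End Identities.

Lemma ex_divided_diff p : exists D, 'Y * D = poly_XaY p - p^:P :> {poly {poly K}}.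
Proof.
elim/poly_ind: p => [|p c [D DE]]; first by exists 0; rewrite poly_XaY0 rmorph0 mulr0 subrr.
exists (D * 'X + poly_XaY p).
rewrite mulrDr mulrA DE poly_XaYD poly_XaYM poly_XaYX rmorphD rmorphM /=.
by rewrite map_polyX map_polyC /= /poly_XaY map_polyC comp_polyC; ring.
Qed.

End Truncated.

Lemma swapXY_divided (K : fieldType) (p r : {poly K}) (Dp Dr : {poly {poly K}}) :
  swapXY (p%:P * (Dp * r^:P - Dr * p^:P)) = p^:P * (swapXY Dp * r%:P - swapXY Dr * p%:P).
Proof.
rewrite rmorphM rmorphB !rmorphM /= swapXY_polyC.
by rewrite !swapXY_map_polyC.
Qed.

(** * Polynomials in one operator *)

Section OperatorCalculus.
Variables (K : fieldType) (V : lmodType K) (L : {linear V -> V}).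
Implicit Types (p q : {poly K}) (v : V).

Definition pact p v := \sum_(i < size p) p`_i *: iter i L v.

Lemma pactE n p v : (size p <= n)%N -> pact p v = \sum_(i < n) p`_i *: iter i L v.
Proof.
move=> le_pn; rewrite /pact (big_ord_widen n (fun i => p`_i *: iter i L v)) //.
rewrite big_mkcond; apply: eq_bigr => i _.
by case: ltnP => // le_pi; rewrite nth_default ?scale0r.
Qed.

Lemma iter_linear i : linear (iter i L).
Proof. by move=> k u v; elim: i => //= i ->; rewrite linearP. Qed.

HB.instance Definition _ i := GRing.isLinear.Build K V V _ (iter i L) (iter_linear i).

Lemma pact_linear p : linear (pact p).
Proof.
move=> k u v; rewrite /pact scaler_sumr -big_split; apply: eq_bigr => i _.
by rewrite iter_linear scalerDr !scalerA mulrC.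
Qed.

HB.instance Definition _ p := GRing.isLinear.Build K V V _ (pact p) (pact_linear p).

Lemma pactDl p q v : pact (p + q) v = pact p v + pact q v.
Proof.
pose n := maxn (size p) (size q).
rewrite !(@pactE n) ?leq_maxl ?leq_maxr //; last exact: size_polyD.
by rewrite -big_split; apply: eq_bigr => i _; rewrite coefD scalerDl.
Qed.

Lemma pactC c v : pact c%:P v = c *: v.
Proof. by rewrite (@pactE 1) ?size_polyC_leq1 // big_ord1 coefC. Qed.

Lemma pact0 v : pact 0 v = 0. Proof. by rewrite -polyC0 pactC scale0r. Qed.

Lemma pact1 v : pact 1 v = v. Proof. by rewrite -polyC1 pactC scale1r. Qed.

Lemma pactN p v : pact (- p) v = - pact p v.
Proof. by apply/eqP; rewrite -addr_eq0 -pactDl addNr pact0. Qed.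

Lemma pactMX p v : pact (p * 'X) v = pact p (L v).
Proof.
have le_sz : (size (p * 'X)%R <= (size p).+1)%N.
  by rewrite (leq_trans (size_polyMleq _ _)) // size_polyX addn2.
rewrite (pactE _ le_sz) big_ord_recl coefMX scale0r add0r; apply: eq_bigr => i _.
by rewrite coefMX /= -iterSr.
Qed.

Lemma pact_iter p v : pact p (L v) = L (pact p v).
Proof.
rewrite /pact linear_sum; apply: eq_bigr => i _.
by rewrite linearZ -iterSr.
Qed.

Lemma pactM p q v : pact (p * q) v = pact p (pact q v).
Proof.
elim/poly_ind: p v => [|p c IHp] v; first by rewrite mul0r !pact0.
rewrite mulrDl mulrAC !pactDl !pactMX IHp !pact_iter; congr (_ + _).
elim/poly_ind: q v {p IHp} => [|q d IHq] v; first by rewrite mulr0 pact0 linear0.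
by rewrite mulrDr mulrA !pactDl !pactMX IHq -polyCM !pactC scalerDr scalerA.
Qed.

Lemma pact_truncate n p q v : (forall k, (n <= k)%N -> iter k L v = 0) ->
  (forall k, (k < n)%N -> p`_k = q`_k) -> pact p v = pact q v.
Proof.
move=> Lv0 epq; pose m := maxn (size p) (size q).
rewrite !(@pactE m) ?leq_maxl ?leq_maxr //; apply: eq_bigr => i _.
by case: (ltnP i n) => [/epq->//|/Lv0->]; rewrite !scaler0.
Qed.

Lemma pact_stable (P : V -> Prop) p v : P 0 -> (forall u w, P u -> P w -> P (u + w)) ->
  (forall k u, P u -> P (k *: u)) -> (forall k, P (iter k L v)) -> P (pact p v).
Proof. by move=> P0 PD PZ Pi; apply: (big_ind P) => // i _; apply: PZ. Qed.

End OperatorCalculus.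

Lemma pact_commute (K : fieldType) (V V' : lmodType K) (L : {linear V -> V})
    (L' : {linear V' -> V'}) (phi : {linear V -> V'}) p v :
  (forall v, phi (L v) = L' (phi v)) -> phi (pact L p v) = pact L' p (phi v).
Proof.
move=> phiL; rewrite /pact linear_sum; apply: eq_bigr => i _; rewrite linearZ /=.
by congr (_ *: _); elim: (nat_of_ord i) => //= k <-.
Qed.

(** * Two-variable symbols acting on a bilinear map *)

Section BilinearCalculus.
Variables (K : fieldType) (V W : lmodType K).
Variables (L : {linear V -> V}) (l : {linear W -> W}) (B : {bilinear V -> W -> W}).
Implicit Types (p q : {poly K}) (P Q : {poly {poly K}}).

(* The sum of the P_ij *: B (L^i u) (l^j w), where P = \sum P_ij s^i t^j, s is *)
(* the inner variable 'Y and t the outer variable 'X.                         *)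
Definition pact2 u w P := \sum_(j < size P) B (pact L P`_j u) (iter j l w).

Lemma pact2E n u w P : (size P <= n)%N ->
  pact2 u w P = \sum_(j < n) B (pact L P`_j u) (iter j l w).
Proof.
move=> le_pn; rewrite /pact2 (big_ord_widen n (fun j => B (pact L P`_j u) (iter j l w))) //.
rewrite big_mkcond; apply: eq_bigr => i _.
by case: ltnP => // le_pi; rewrite nth_default ?pact0 ?linear0l.
Qed.

Lemma pact2D u w P Q : pact2 u w (P + Q) = pact2 u w P + pact2 u w Q.
Proof.
pose n := maxn (size P) (size Q).
rewrite !(@pact2E n) ?leq_maxl ?leq_maxr //; last exact: size_polyD.
by rewrite -big_split; apply: eq_bigr => i _; rewrite coefD pactDl linearDl.
Qed.

Lemma pact2C u w p : pact2 u w p%:P = B (pact L p u) w.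
Proof. by rewrite (@pact2E 1) ?size_polyC_leq1 // big_ord1 coefC. Qed.

Lemma pact2_0 u w : pact2 u w 0 = 0.
Proof. by rewrite -polyC0 pact2C pact0 linear0l. Qed.

Lemma pact2N u w P : pact2 u w (- P) = - pact2 u w P.
Proof. by apply/eqP; rewrite -addr_eq0 -pact2D addNr pact2_0. Qed.

Lemma pact2B u w P Q : pact2 u w (P - Q) = pact2 u w P - pact2 u w Q.
Proof. by rewrite pact2D pact2N. Qed.

Lemma pact2MX u w P : pact2 u w (P * 'X) = pact2 u (l w) P.
Proof.
have le_sz : (size (P * 'X)%R <= (size P).+1)%N.
  by rewrite (leq_trans (size_polyMleq _ _)) // size_polyX addn2.
rewrite (pact2E _ _ le_sz) big_ord_recl coefMX pact0 linear0l add0r.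
by apply: eq_bigr => i _; rewrite coefMX /= -iterSr.
Qed.

Lemma pact2MC u w P p : pact2 u w (P * p%:P) = pact2 (pact L p u) w P.
Proof.
elim/poly_ind: P w => [|P q IHP] w; first by rewrite mul0r !pact2_0.
rewrite mulrDl mulrAC !pact2D !pact2MX IHP; congr (_ + _).
by rewrite -polyCM !pact2C pactM.
Qed.

Lemma pact2_linearl w P : linear (fun u => pact2 u w P).
Proof.
move=> k u v; rewrite /pact2 scaler_sumr -big_split; apply: eq_bigr => i _.
by rewrite linearP linearPl.
Qed.

Lemma pact2_linearr u P : linear (fun w => pact2 u w P).
Proof.
move=> k w w'; rewrite /pact2 scaler_sumr -big_split; apply: eq_bigr => i _.
by rewrite linearP linearPr.
Qed.

Lemma pact2Zl k u w P : pact2 (k *: u) w P = k *: pact2 u w P.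
Proof. by have /= := pact2_linearl w P k u 0; rewrite addr0 => ->;
  rewrite /pact2 [X in _ + X]big1 ?addr0 // => j _; rewrite linear0 linear0l. Qed.

Lemma pact2Zr k u w P : pact2 u (k *: w) P = k *: pact2 u w P.
Proof. by have /= := pact2_linearr u P k w 0; rewrite addr0 => ->;
  rewrite /pact2 [X in _ + X]big1 ?addr0 // => j _; rewrite linear0 linear0r. Qed.

Lemma pact2Dr u w w' P : pact2 u (w + w') P = pact2 u w P + pact2 u w' P.
Proof. by have := pact2_linearr u P 1 w w'; rewrite /= !scale1r. Qed.

Lemma pact2_0r u P : pact2 u 0 P = 0.
Proof. by have := pact2Zr 0 u 0 P; rewrite !scale0r. Qed.

Lemma pact2M u w P p : pact2 u w (P * p^:P) = pact2 u (pact l p w) P.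
Proof.
elim/poly_ind: p w => [|p c IHp] w; first by rewrite rmorph0 mulr0 pact0 pact2_0 pact2_0r.
rewrite rmorphD rmorphM /= map_polyX map_polyC /= mulrDr mulrA !pact2D pact2MX IHp pact2MC.
by rewrite pactDl pactMX !pactC pact2Dr pact2Zl pact2Zr.
Qed.

Lemma pact2_low n u w P :
  (forall i j, (n <= i + j)%N -> B (iter i L u) (iter j l w) = 0) ->
  low n P -> pact2 u w P = 0.
Proof.
move=> B0 lP; apply: big1 => j _; rewrite /pact linear_sumlz; apply: big1 => i _.
rewrite linearZl_LR; have [le_n|lt_n] := leqP n (i + j); first by rewrite B0 ?scaler0.
by rewrite lP ?scale0r.
Qed.

Hypothesis l_der : forall u w, l (B u w) = B (L u) w + B u (l w).

(** By the Leibniz rule [l] acts on the values of [B] as X+Y; the rest is induction on [p]. *)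
Lemma pact2MXaY u w P p : pact2 u w (P * poly_XaY p) = pact l p (pact2 u w P).
Proof.
have MXY Q w' : pact2 u w' (Q * ('X + 'Y)) = l (pact2 u w' Q).
  rewrite mulrDr pact2D pact2MX pact2MC -['X]mul1r pactMX pact1.
  rewrite /pact2 linear_sum -big_split; apply: eq_bigr => i _.
  by rewrite l_der pact_iter -iterSr addrC.
elim/poly_ind: p P => [|p c IHp] P; first by rewrite poly_XaY0 mulr0 pact0 pact2_0.
rewrite poly_XaYD poly_XaYM poly_XaYX mulrDr mulrA pact2D MXY IHp pactDl pactMX pact_iter.
by rewrite /poly_XaY map_polyC comp_polyC pact2MC !pactC pact2Zl.
Qed.

(** Duhamel's formula: commuting [delta] past l^n gives the sum of the l^i B(v, l^(n-1-i) w), whose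
    symbol is the sum of the (X+Y)^i X^(n-1-i), that is ((X+Y)^n - X^n)/Y. *)
Lemma pact_derivation (delta : {linear W -> W}) v p D w :
  (forall w, delta (l w) = B v w + l (delta w)) ->
  'Y * D = poly_XaY p - p^:P ->
  delta (pact l p w) = pact2 v w D + pact l p (delta w).
Proof.
move=> delta_l; have Y0 : 'Y != 0 :> {poly {poly K}} by rewrite polyC_eq0 polyX_eq0.
elim/poly_ind: p D w => [|p c IHp] D w.
  rewrite poly_XaY0 rmorph0 subrr => /eqP; rewrite mulf_eq0 (negPf Y0) => /eqP->.
  by rewrite !pact0 pact2_0 linear0 addr0.
have [D' D'E] := ex_divided_diff p.
(* From (X+Y) p(X+Y) - X p(X) = X (p(X+Y) - p(X)) + Y p(X+Y), after cancelling Y. *)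
move=> DE; have -> : D = D' * 'X + poly_XaY p.
  apply: (mulfI Y0); rewrite DE mulrDr mulrA D'E poly_XaYD poly_XaYM poly_XaYX rmorphD rmorphM /=.
  by rewrite map_polyX map_polyC /= /poly_XaY map_polyC comp_polyC; ring.
rewrite !pactDl !pactMX linearD (IHp _ _ D'E) delta_l pact2D pact2MX !pactC linearZ /=.
rewrite -[poly_XaY p]mul1r pact2MXaY -polyC1 pact2C pact1 linearD.
by rewrite !addrA [pact2 _ _ _ + _ + _]addrAC.
Qed.

End BilinearCalculus.

(** Symmetry is required on the iterates only, because the bracket of the envelope is symmetric just
    on odd elements. *)
Lemma pact2_swap (K : fieldType) (V : lmodType K) (L : {linear V -> V})
    (B : {bilinear V -> V -> V}) u w P :
  (forall i j, B (iter i L u) (iter j L w) = B (iter j L w) (iter i L u)) ->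
  pact2 L L B u w P = pact2 L L B w u (swapXY P).
Proof.
move=> Bsym; pose n := maxn (maxn (size P) (sizeY P)) (maxn (size (swapXY P)) (sizeY (swapXY P))).
have [le1 le2 le3 le4] : [/\ size P <= n, sizeY P <= n, size (swapXY P) <= n
    & sizeY (swapXY P) <= n]%N by rewrite /n !leq_max !leqnn !orbT.
rewrite !(@pact2E _ _ _ _ _ _ n) //.
under eq_bigr => j _.
  rewrite (pactE L _ (leq_trans (max_size_coefXY P j) le2)) linear_sumlz.
  under eq_bigr => i _ do rewrite linearZl_LR Bsym.
  over.
rewrite exchange_big /=; apply: eq_bigr => i _.
rewrite (pactE L _ (leq_trans (max_size_coefXY _ i) le4)) linear_sumlz.
by apply: eq_bigr => j _; rewrite linearZl_LR coef_swapXY.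
Qed.

(** * The Grassmann algebra and its derivations *)

Section Grassmann.
Variables (K : fieldType) (q : nat).
Local Notation Lam := (dsym K q).
Local Notation x_ A := (dsym_mon K A).
Implicit Types (A B C : {set 'I_q}) (f g h : Lam) (b p r : bool).

(** The structure constant of the dual algebra: the sign of the coproduct times the Koszul sign of
    the pairing. It is 0 when [A] and [B] meet. *)
Definition mul_sign A B : K := (-1) ^+ (#|A| * #|B|) * mon_sign K A B.
Local Notation ms := mul_sign.

Lemma mul_signE A B :
  ms A B = \prod_(a in A) \prod_(b in B) (- (if a == b then 0 else (-1) ^+ (b < a)%N)).
Proof.
rewrite /ms /mon_sign mulnC exprM -prodr_const -big_split /=.
by apply: eq_bigr => a _; rewrite prodrN.
Qed.

Lemma mul_sign_eq0 A B : ~~ [disjoint A & B] -> ms A B = 0.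
Proof.
case/pred0Pn=> x /andP[xA xB].
by rewrite mul_signE (bigD1 x) //= (bigD1 x) //= eqxx oppr0 !mul0r.
Qed.

Lemma mul_sign_sqr A B : [disjoint A & B] -> ms A B * ms A B = 1.
Proof.
move=> dAB; rewrite mul_signE -big_split big1 // => a aA.
rewrite -big_split big1 // => c cB /=.
have /negPf-> : a != c by apply: contraTneq aA => ->; rewrite (disjointFl dAB).
by rewrite mulrNN -expr2 sqrr_sign.
Qed.

Lemma mul_signUr A B C : [disjoint B & C] -> ms A (B :|: C) = ms A B * ms A C.
Proof.
move=> dBC; rewrite !mul_signE -big_split /=; apply: eq_bigr => a _.
by rewrite -bigU //=; apply: eq_bigl => b; rewrite inE.
Qed.

Lemma mul_sign0l B : ms set0 B = 1.
Proof. by rewrite mul_signE big_set0. Qed.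

Lemma mul_signC A B : ms B A = (-1) ^+ (odd #|A| && odd #|B|) * ms A B.
Proof.
have [dAB|nAB] := boolP [disjoint A & B]; last first.
  by rewrite !mul_sign_eq0 ?mulr0 // disjoint_sym.
rewrite -oddM signr_odd !mul_signE exchange_big mulnC exprM -prodr_const -big_split /=.
apply: eq_bigr => a aA; rewrite -prodr_const -big_split; apply: eq_bigr => c cB /=.
have nac : a != c by apply: contraTneq aA => ->; rewrite (disjointFl dAB).
rewrite [c == a]eq_sym (negPf nac) mulN1r opprK.
by have := nac; rewrite -val_eqE /=; case: ltngtP; rewrite // ?expr0 ?expr1 ?opprK.
Qed.

Lemma dsym_expand f : f = \sum_A f A *: x_ A.
Proof.
apply/ffunP=> B; rewrite sum_ffunE (bigD1 B) //= !ffunE eqxx big1 ?addr0 => [|A nAB].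
  by rewrite -[_ *: _]/(_ * _) mulr1.
by rewrite !ffunE eq_sym (negPf nAB) scaler0.
Qed.

Lemma dsym_monM A B : x_ A * x_ B = ms A B *: x_ (A :|: B).
Proof.
apply/ffunP=> C; rewrite [LHS]ffunE (bigD1 (A, B)) //= big1 ?addr0.
  by rewrite !ffunE !eqxx /= !mulr1 mulrA eq_sym.
case=> A' B'; rewrite xpair_eqE negb_and !ffunE /=.
by case/orP=> /negPf->; rewrite ?mulr0 ?mul0r.
Qed.

Lemma dsym_mon0 : x_ set0 = 1 :> Lam. Proof. by []. Qed.

Lemma dsym_mon_rec i A : i \notin A -> x_ (i |: A) = ms [set i] A *: (x_ [set i] * x_ A).
Proof.
by move=> iA; rewrite dsym_monM scalerA mul_sign_sqr ?scale1r // disjoints1.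
Qed.

Lemma dsym_ind (P : Lam -> Prop) : P 0 -> (forall f g, P f -> P g -> P (f + g)) ->
  (forall k f, P f -> P (k *: f)) -> P 1 -> (forall i f, P f -> P (x_ [set i] * f)) ->
  forall f, P f.
Proof.
move=> P0 PD PZ P1 PX f; rewrite [f]dsym_expand; apply: (big_ind P) => // A _; apply: (PZ).
elim: {A}_.+1 {-2}A (ltnSn #|A|) => // n IHn A.
have [->|[i iA]] := set_0Vmem A; first by rewrite dsym_mon0.
rewrite -(setD1K iA) cardsU1 !inE eqxx ltnS => ltAn.
by rewrite dsym_mon_rec ?inE ?eqxx //; apply/PZ/PX/IHn.
Qed.

Definition dhomog p f := forall A, odd #|A| != p -> f A = 0.

Lemma dhomog_mon A : dhomog (odd #|A|) (x_ A).
Proof. by move=> B nB; rewrite ffunE; case: (B =P A) nB => [->|//]; rewrite eqxx. Qed.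

Lemma dhomogD p f g : dhomog p f -> dhomog p g -> dhomog p (f + g).
Proof. by move=> hf hg A nA; rewrite ffunE hf ?hg ?addr0. Qed.

Lemma dhomogZ p k f : dhomog p f -> dhomog p (k *: f).
Proof. by move=> hf A nA; rewrite ffunE hf ?scaler0. Qed.

Lemma dhomog0 p : dhomog p 0. Proof. by move=> A _; rewrite ffunE. Qed.

Lemma dhomog_sum p I (s : seq I) (P : pred I) (F : I -> Lam) :
  (forall i, P i -> dhomog p (F i)) -> dhomog p (\sum_(i <- s | P i) F i).
Proof. by move=> hF; apply: big_ind => //; [apply: dhomog0 | apply: dhomogD]. Qed.

Lemma dhomog_ind p (P : Lam -> Prop) : P 0 -> (forall f g, P f -> P g -> P (f + g)) ->
  (forall k f, P f -> P (k *: f)) -> (forall A, odd #|A| = p -> P (x_ A)) ->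
  forall f, dhomog p f -> P f.
Proof.
move=> P0 PD PZ Pm f hf; rewrite [f]dsym_expand; apply: (big_ind P) => // A _.
have [oA|nA] := eqVneq (odd #|A|) p; first by apply/PZ/Pm.
by rewrite hf ?scale0r.
Qed.

Lemma dhomogM p r f g : dhomog p f -> dhomog r g -> dhomog (p (+) r) (f * g).
Proof.
move=> hf hg; elim/dhomog_ind: f / hf => [|f f' IH IH'|k f IH|A oA].
- by rewrite mul0r; apply: dhomog0.
- by rewrite mulrDl; apply: dhomogD.
- by rewrite -scalerAl; apply: dhomogZ.
elim/dhomog_ind: g / hg => [|g g' IH IH'|k g IH|B oB].
- by rewrite mulr0; apply: dhomog0.
- by rewrite mulrDr; apply: dhomogD.
- by rewrite -scalerAr; apply: dhomogZ.
rewrite dsym_monM; have [dAB|nAB] := boolP [disjoint A & B].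
  apply: dhomogZ; have -> : p (+) r = odd #|A :|: B|; last exact: dhomog_mon.
  by rewrite cardsU disjoint_setI0 // cards0 subn0 oddD oA oB.
by rewrite mul_sign_eq0 // scale0r; apply: dhomog0.
Qed.

Lemma dsym_supercomm p r f g : dhomog p f -> dhomog r g ->
  f * g = (-1) ^+ (p && r) *: (g * f).
Proof.
move=> hf hg; elim/dhomog_ind: f / hf => [|f f' IH IH'|k f IH|A oA].
- by rewrite mul0r mulr0 scaler0.
- by rewrite mulrDl mulrDr scalerDr IH IH'.
- by rewrite -scalerAl -scalerAr IH !scalerA mulrC.
elim/dhomog_ind: g / hg => [|g g' IH IH'|k g IH|B oB].
- by rewrite mul0r mulr0 scaler0.
- by rewrite mulrDl mulrDr scalerDr IH IH'.
- by rewrite -scalerAl -scalerAr IH !scalerA mulrC.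
by rewrite !dsym_monM [B :|: A]setUC (mul_signC A B) !scalerA -oA -oB mulrA -signr_addb addbb
  mul1r.
Qed.

(** The left derivative with respect to x_i: the sign is the cost of bringing x_i to the front, and
    it is 0 when [i] is already in [A]. *)
Definition pderiv i f : Lam := [ffun A => ms [set i] A * f (i |: A)].

Lemma pderiv_linear i : linear (pderiv i).
Proof.
move=> k f g; apply/ffunP=> A; rewrite !ffunE.
by rewrite -![_ *: _]/(_ * _) mulrDr mulrCA.
Qed.

HB.instance Definition _ i := GRing.isLinear.Build K Lam Lam _ (pderiv i) (pderiv_linear i).

Lemma pderiv_mon i A :
  pderiv i (x_ A) = if i \in A then ms [set i] (A :\ i) *: x_ (A :\ i) else 0.
Proof.
apply/ffunP=> B; rewrite !ffunE; have [iA|iA] := boolP (i \in A); rewrite !ffunE.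
  rewrite -[_ *: _]/(_ * _); have [iB|iB] := boolP (i \in B).
    rewrite mul_sign_eq0 ?disjoints1 ?iB // mul0r.
    by case: eqP => [e|_]; [rewrite e !inE eqxx in iB | rewrite mulr0].
  have -> : (i |: B == A) = (B == A :\ i).
    by apply/eqP/eqP=> [<-|->]; [rewrite setU1K | rewrite setD1K].
  by case: eqP => [->|]; rewrite ?mulr0.
by case: eqP => [e|_]; [rewrite -e !inE eqxx in iA | rewrite mulr0].
Qed.

(** The Clifford relation between d/dx_i and the multiplication by x_j; the Leibniz rule and the
    anticommutation of the derivatives are deduced from it by induction on monomials. *)
Lemma pderivX i j f :
  pderiv i (x_ [set j] * f) = (i == j)%:R *: f - x_ [set j] * pderiv i f.
Proof.
suff H A : pderiv i (x_ [set j] * x_ A) = (i == j)%:R *: x_ A - x_ [set j] * pderiv i (x_ A).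
  rewrite [f]dsym_expand mulr_sumr scaler_sumr !linear_sum /= mulr_sumr -sumrB.
  apply: eq_bigr => A _; rewrite -scalerAr !linearZ /= H -scalerAr scalerBr !scalerA.
  by congr (_ *: _ - _); rewrite mulrC.
rewrite dsym_monM linearZ /= !pderiv_mon !inE; have [<-{j}|nij] := eqVneq i j.
  rewrite scale1r /=; have [iA|iA] := boolP (i \in A).
    rewrite mul_sign_eq0 ?disjoints1 ?iA // scale0r -scalerAr dsym_monM scalerA.
    by rewrite mul_sign_sqr ?disjoints1 ?inE ?eqxx // scale1r setD1K ?subrr.
  by rewrite mulr0 subr0 setU1K // scalerA mul_sign_sqr ?disjoints1 // scale1r.
rewrite scale0r sub0r /=; case: ifP => [iA|]; last by rewrite scaler0 mulr0 oppr0.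
have -> : ([set j] :|: A) :\ i = j |: (A :\ i).
  by apply/setP=> k; rewrite !inE; case: eqVneq => // ->; rewrite (negPf nij).
rewrite -scalerAr dsym_monM !scalerA -scaleNr; congr (_ *: _).
(* If [j] lies in [A], both sides contain x_j twice; otherwise the minus sign comes from exchanging
   x_i and x_j. *)
have [jA|jA] := boolP (j \in A).
  by rewrite !(@mul_sign_eq0 [set j]) ?disjoints1 ?inE ?jA // ?(eq_sym j) ?nij // mul0r mulr0
    oppr0.
have e1 : ms [set j] A = ms [set j] [set i] * ms [set j] (A :\ i).
  by rewrite -{1}(setD1K iA) mul_signUr // disjoints1 !inE eqxx.
have e2 : ms [set i] (j |: A :\ i) = ms [set i] [set j] * ms [set i] (A :\ i).
  by rewrite mul_signUr // disjoints1 !inE (negPf jA) andbF.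
have e3 : ms [set j] [set i] = - ms [set i] [set j].
  by rewrite (mul_signC [set i]) !cards1 mulN1r.
have e4 : ms [set i] [set j] * ms [set i] [set j] = 1.
  by rewrite mul_sign_sqr // disjoints1 inE.
rewrite e1 e2 e3; set a := ms [set i] [set j] in e4 *.
by rewrite !mulNr mulrACA e4 mul1r mulrC.
Qed.

Lemma pderiv1 i : pderiv i 1 = 0.
Proof. by rewrite -dsym_mon0 pderiv_mon inE. Qed.

Lemma pderiv_gen i j : pderiv i (x_ [set j]) = (i == j)%:R%:A.
Proof. by rewrite -[x_ _]mulr1 pderivX pderiv1 mulr0 subr0. Qed.

Lemma dhomog_pderiv i p f : dhomog p f -> dhomog (~~ p) (pderiv i f).
Proof.
move=> hf A nA; rewrite ffunE; have [iA|iA] := boolP (i \in A).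
  by rewrite mul_sign_eq0 ?disjoints1 ?iA // mul0r.
by rewrite hf ?mulr0 // cardsU1 iA /=; move: nA; case: odd; case: (p).
Qed.

Lemma pderivM i p f g : dhomog p f ->
  pderiv i (f * g) = pderiv i f * g + (-1) ^+ p *: (f * pderiv i g).
Proof.
elim/dhomog_ind => {f} [|f f' IH IH'|k f IH|A <-].
- by rewrite !(mul0r, linear0, scaler0, addr0).
- by rewrite mulrDl linearD /= IH IH' linearD /= !mulrDl scalerDr addrACA.
- by rewrite -!scalerAl !linearZ /= IH -scalerAl scalerDr !scalerA mulrC.
elim: {A}_.+1 {-2}A (ltnSn #|A|) => // n IHn A.
have [->|[j jA]] := set_0Vmem A.
  by rewrite dsym_mon0 cards0 pderiv1 mul0r add0r !mul1r scale1r.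
rewrite -(setD1K jA); move: (A :\ j) (setD11 j A) => B jB.
rewrite cardsU1 jB ltnS => ltBn; rewrite dsym_mon_rec ?jB // -!scalerAl !linearZ /= -!scalerAl.
rewrite -scalerDr; congr (_ *: _).
rewrite -(mulrA (x_ [set j])) (pderivX i j (_ * g)) (pderivX i j (x_ B)) IHn //.
rewrite mulrDr mulrBl opprD addrA -scalerAl.
congr (_ + _); first by rewrite mulrA.
by rewrite /= signrN scaleNr -scalerAr mulrA.
Qed.

Definition superderivation b (D : Lam -> Lam) :=
  (forall p f, dhomog p f -> dhomog (b (+) p) (D f)) /\
  (forall p f g, dhomog p f -> D (f * g) = D f * g + (-1) ^+ (b && p) *: (f * D g)).

Lemma dhomog_gen i : dhomog true (x_ [set i]).
Proof. by rewrite -[true]/(odd 1) -(cards1 i); apply: dhomog_mon. Qed.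

Lemma dhomog1 : @dhomog false 1.
Proof. by rewrite -dsym_mon0 -[false]/(odd 0) -(cards0 'I_q); apply: dhomog_mon. Qed.

Lemma superderivation1 b (D : {linear Lam -> Lam}) : superderivation b D -> D 1 = 0.
Proof.
move=> [_ /(_ _ 1 1 dhomog1)]; rewrite andbF scale1r !mul1r mulr1 => /eqP.
by rewrite -subr_eq0 opprD addrA subrr sub0r oppr_eq0 => /eqP.
Qed.

Lemma superderivation_eq b (D D' : {linear Lam -> Lam}) :
  superderivation b D -> superderivation b D' ->
  (forall i, D (x_ [set i]) = D' (x_ [set i])) -> D =1 D'.
Proof.
move=> sD sD' DX; elim/dsym_ind => [|f g IH IH'|k f IH||i f IH].
- by rewrite !linear0.
- by rewrite !linearD /= IH IH'.
- by rewrite !linearZ /= IH.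
- by rewrite (superderivation1 sD) (superderivation1 sD').
by rewrite (sD.2 _ _ _ (dhomog_gen i)) (sD'.2 _ _ _ (dhomog_gen i)) DX IH.
Qed.

Lemma supercommutator_superderivation b c (D E : {linear Lam -> Lam}) :
  superderivation b D -> superderivation c E ->
  superderivation (b (+) c) (fun f => D (E f) - (-1) ^+ (b && c) *: E (D f)).
Proof.
move=> [hD DM] [hE EM]; split=> [p f hf|p f g hf].
  apply: dhomogD; first by rewrite -addbA; apply/hD/hE.
  rewrite -scaleNr; apply: dhomogZ; rewrite [b (+) c]addbC -addbA; exact/hE/hD.
have -> : D (E (f * g)) = D (E f) * g + (-1) ^+ (b && (c (+) p)) *: (E f * D g)
    + ((-1) ^+ (c && p) *: (D f * E g) + ((-1) ^+ (c && p) * (-1) ^+ (b && p)) *: (f * D (E g))).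
  by rewrite (EM _ _ _ hf) linearD linearZ /= (DM _ _ _ (hE _ _ hf)) (DM _ _ _ hf) scalerDr
    scalerA.
have -> : E (D (f * g)) = E (D f) * g + (-1) ^+ (c && (b (+) p)) *: (D f * E g)
    + ((-1) ^+ (b && p) *: (E f * D g) + ((-1) ^+ (b && p) * (-1) ^+ (c && p)) *: (f * E (D g))).
  by rewrite (DM _ _ _ hf) linearD linearZ /= (EM _ _ _ (hD _ _ hf)) (EM _ _ _ hf) scalerDr
    scalerA.
rewrite !scalerDr !scalerA mulrBl -scalerAl mulrBr -scalerAr scalerBr scalerA.
have -> : (-1) ^+ (b && c) * (-1) ^+ (c && (b (+) p)) = (-1) ^+ (c && p) :> K.
  by rewrite -signr_addb; case: (b) (c) (p) => [] [] [].
have -> : (-1) ^+ (b && (c (+) p)) = (-1) ^+ (b && c) * (-1) ^+ (b && p) :> K.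
  by rewrite -signr_addb; case: (b) (c) (p) => [] [] [].
have -> : (-1) ^+ ((b (+) c) && p) = (-1) ^+ (c && p) * (-1) ^+ (b && p) :> K.
  by rewrite -signr_addb; case: (b) (c) (p) => [] [] [].
have -> : (-1) ^+ (c && p) * (-1) ^+ (b && p) * (-1) ^+ (b && c)
    = (-1) ^+ (b && c) * ((-1) ^+ (b && p) * (-1) ^+ (c && p)) :> K by ring.
set t1 := D _ * g; set t2 := _ *: (E f * _); set t3 := _ *: (D f * _); set t4 := _ *: (f * D _).
set t5 := _ *: (_ * g); set t6 := _ *: _; rewrite !opprD.
(* The mixed terms, E f times D g (places 2 and 7) and D f times E g (places 3 and 6), cancel. *)
by rewrite (AC (2*2*(2*2)) ((1*5)*(4*8)*(2*7)*(3*6))) /= !subrr !addr0.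
Qed.

End Grassmann.

Section VectorFields.
Variables (K : fieldType) (q : nat).
Local Notation Lam := (dsym K q).
Local Notation x_ A := (dsym_mon K A).
Implicit Types (A B C : {set 'I_q}) (f g h : Lam) (b p r : bool).

Definition vecfield (xi : 'I_q -> Lam) f := \sum_i xi i * pderiv i f.

Lemma vecfield_linear xi : linear (vecfield xi).
Proof.
move=> k f g; rewrite /vecfield scaler_sumr -big_split; apply: eq_bigr => i _.
by rewrite linearP mulrDr scalerAr.
Qed.

HB.instance Definition _ xi := GRing.isLinear.Build K Lam Lam _ (vecfield xi) (vecfield_linear
  xi).

Lemma vecfield_gen xi j : vecfield xi (x_ [set j]) = xi j.
Proof.
rewrite /vecfield (bigD1 j) //= pderiv_gen eqxx scale1r mulr1 big1 ?addr0 // => i nij.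
by rewrite pderiv_gen (negPf nij) scale0r mulr0.
Qed.

Lemma vecfield_superderivation b xi : (forall i, dhomog (~~ b) (xi i)) ->
  superderivation b (vecfield xi).
Proof.
move=> hxi; split=> [p f hf|p f g hf].
  apply: dhomog_sum => i _; rewrite -[b (+) p]negbK -addNb -addbN.
  exact/dhomogM/dhomog_pderiv.
rewrite mulr_suml mulr_sumr scaler_sumr -big_split; apply: eq_bigr => i _ /=.
rewrite (pderivM _ _ hf) mulrDr -scalerAr !mulrA (dsym_supercomm (hxi i) hf) -scalerAl scalerA.
by rewrite -signr_addb; case: (b) (p) => [] [].
Qed.

(** The filtration by Grassmann degree. It measures both the nilpotency of ad z and the leading
    terms of differential operators. *)
Definition fil (W : zmodType) n (u : {set 'I_q} -> W) := forall A, (#|A| < n)%N -> u A = 0.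

Lemma dsym_mulE f g : f * g = \sum_A \sum_B (f A * g B) *: (x_ A * x_ B).
Proof.
rewrite {1}(dsym_expand f) {1}(dsym_expand g) mulr_suml; apply: eq_bigr => A _.
by rewrite mulr_sumr; apply: eq_bigr => B _; rewrite -scalerAl -scalerAr scalerA.
Qed.

Lemma dsym_monM_neq0 A B C : (x_ A * x_ B) C != 0 -> #|C| = (#|A| + #|B|)%N.
Proof.
rewrite dsym_monM ffunE ffunE; have [dAB|nAB] := boolP [disjoint A & B]; last first.
  by rewrite mul_sign_eq0 // scale0r eqxx.
case: (C =P A :|: B) => [->|_]; last by rewrite scaler0 eqxx.
by rewrite cardsU disjoint_setI0 // cards0 subn0.
Qed.

Lemma fil_mul m n f g : fil m f -> fil n g -> fil (m + n) (f * g).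
Proof.
move=> hf hg C ltC; rewrite dsym_mulE sum_ffunE big1 // => A _.
rewrite sum_ffunE big1 // => B _; rewrite ffunE.
have [->|/dsym_monM_neq0 cC] := eqVneq ((x_ A * x_ B) C) 0; first by rewrite scaler0.
have [/hf->|leA] := ltnP #|A| m; first by rewrite mul0r scale0r.
have [/hg->|leB] := ltnP #|B| n; first by rewrite mulr0 scale0r.
by move: ltC; rewrite cC ltnNge leq_add.
Qed.

Lemma dsym_mul_set0 f g : (f * g) set0 = f set0 * g set0.
Proof.
rewrite dsym_mulE sum_ffunE (bigD1 set0) //= [X in _ + X]big1 ?addr0 => [|A nA].
  rewrite sum_ffunE (bigD1 set0) //= [X in _ + X]big1 ?addr0 => [|B nB].
    by rewrite dsym_monM mul_sign0l setU0 scale1r !ffunE eqxx -[_ *: _]/(_ * _) mulr1.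
  by rewrite dsym_monM !ffunE eq_sym setU_eq0 (negPf nB) andbF /= !scaler0.
rewrite sum_ffunE big1 // => B _.
by rewrite dsym_monM !ffunE eq_sym setU_eq0 (negPf nA) /= !scaler0.
Qed.

End VectorFields.

(** * Grassmann envelopes *)

Section Tensor.
Variables (K : fieldType) (q : nat).
Local Notation Lam := (dsym K q).
Local Notation x_ A := (dsym_mon K A).
Local Notation T W := {ffun {set 'I_q} -> W}.

Section Basic.
Variables (W : lmodType K) (G : grading W).
Implicit Types (A : {set 'I_q}) (f : Lam) (w : W) (u : T W) (b p : bool).

Definition tens w f : T W := [ffun A => f A *: w].

Lemma tensDl w w' f : tens (w + w') f = tens w f + tens w' f.
Proof. by apply/ffunP=> A; rewrite !ffunE scalerDr. Qed.

Lemma tensDr w f f' : tens w (f + f') = tens w f + tens w f'.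
Proof. by apply/ffunP=> A; rewrite !ffunE scalerDl. Qed.

Lemma tensZl k w f : tens (k *: w) f = k *: tens w f.
Proof. by apply/ffunP=> A; rewrite !ffunE !scalerA mulrC. Qed.

Lemma tensZr k w f : tens w (k *: f) = k *: tens w f.
Proof. by apply/ffunP=> A; rewrite !ffunE scalerA. Qed.

Lemma tens0l f : tens 0 f = 0.
Proof. by apply/ffunP=> A; rewrite !ffunE scaler0. Qed.

Lemma tens0r w : tens w 0 = 0.
Proof. by apply/ffunP=> A; rewrite !ffunE scale0r. Qed.

Lemma tensNl w f : tens (- w) f = - tens w f.
Proof. by rewrite -scaleN1r tensZl scaleN1r. Qed.

Lemma tensNr w f : tens w (- f) = - tens w f.
Proof. by rewrite -scaleN1r tensZr scaleN1r. Qed.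

Lemma tens_sumr w I (s : seq I) (P : pred I) F :
  tens w (\sum_(i <- s | P i) F i) = \sum_(i <- s | P i) tens w (F i).
Proof. by apply: (big_morph _ (tensDr w) (tens0r w)). Qed.

Lemma tens_expand u : u = \sum_A tens (u A) (x_ A).
Proof.
apply/ffunP=> B; rewrite sum_ffunE (bigD1 B) //= !ffunE eqxx scale1r big1 ?addr0 // => A nAB.
by rewrite !ffunE eq_sym (negPf nAB) scale0r.
Qed.

Lemma tens_ind (P : T W -> Prop) : P 0 -> (forall u v, P u -> P v -> P (u + v)) ->
  (forall b w A, homog G b w -> P (tens w (x_ A))) -> forall u, P u.
Proof.
move=> P0 PD Pt u; rewrite [u]tens_expand; apply: (big_ind P) => // A _.
rewrite -(gr_sum G (u A)) tensDl.
by apply: (PD); [apply: (Pt false) | apply: (Pt true)]; rewrite /homog gr_orth eqxx.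
Qed.

(* u has parity p in W (x) Lam *)
Definition tpar p u := forall A, homog G (p (+) odd #|A|) (u A).

Lemma tpar_ind p (P : T W -> Prop) : P 0 -> (forall u v, P u -> P v -> P (u + v)) ->
  (forall w A, homog G (p (+) odd #|A|) w -> P (tens w (x_ A))) -> forall u, tpar p u -> P u.
Proof.
move=> P0 PD Pt u hu; rewrite [u]tens_expand; apply: (big_ind P) => // A _.
exact: Pt.
Qed.

Lemma homog0 b : homog G b 0. Proof. exact: linear0. Qed.

Lemma homogD b w w' : homog G b w -> homog G b w' -> homog G b (w + w').
Proof. by rewrite /homog linearD => -> ->. Qed.

Lemma homogZ b k w : homog G b w -> homog G b (k *: w).
Proof. by rewrite /homog linearZ /= => ->. Qed.

Lemma homog_gr b w : homog G b (G b w).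
Proof. by rewrite /homog gr_orth eqxx. Qed.

Lemma tparD p u v : tpar p u -> tpar p v -> tpar p (u + v).
Proof. by move=> hu hv A; rewrite ffunE; apply: homogD. Qed.

Lemma tparZ p k u : tpar p u -> tpar p (k *: u).
Proof. by move=> hu A; rewrite ffunE; apply: homogZ. Qed.

Lemma tpar0 p : tpar p 0. Proof. by move=> A; rewrite ffunE; apply: homog0. Qed.

Lemma tpar_tens b r w f : homog G b w -> dhomog r f -> tpar (b (+) r) (tens w f).
Proof.
move=> hw hf A; rewrite ffunE; have [<-|nr] := eqVneq (odd #|A|) r.
  by rewrite -addbA addbb addbF; apply: homogZ.
by rewrite hf // scale0r; apply: homog0.
Qed.

Definition grpar w := G false w - G true w.

Lemma grpar_linear : linear grpar.
Proof. by move=> k u v; rewrite /grpar !linearP /= scalerDr addrACA. Qed.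

HB.instance Definition _ := GRing.isLinear.Build K W W _ grpar grpar_linear.

Lemma grpar_homog b w : homog G b w -> grpar w = (-1) ^+ b *: w.
Proof.
rewrite /grpar /homog; case: b => hw; rewrite -[in LHS]hw !gr_orth /=.
  by rewrite sub0r hw scaleN1r.
by rewrite subr0 hw scale1r.
Qed.

Lemma iter_grpar_homog n b w : homog G b w -> iter n grpar w = (-1) ^+ (odd n && b) *: w.
Proof.
move=> hw; elim: n => [|n IHn] /=; first by rewrite scale1r.
by rewrite IHn linearZ /= (grpar_homog hw) scalerA -signr_addb; case: odd; case: (b).
Qed.

End Basic.

Section Bext.
Variables (V W X : lmodType K) (GV : grading V) (GW : grading W) (GX : grading X).
Variable B : {bilinear V -> W -> X}.

(** The extension of scalars of [B], with the sign of a Grassmann coefficient passing the second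
    argument. It unfolds to [glie] for the Lie bracket, and also covers the action of g on U(g) by
    left multiplication. *)
Definition bext (u : T V) (v : T W) : T X :=
  \sum_(A : {set 'I_q}) \sum_(C : {set 'I_q})
    tens (B (u A) (iter #|A| (grpar GW) (v C))) (x_ A * x_ C).

Lemma bext_bilinear : bilinear_for
  (GRing.Scale.Law.clone _ _ *:%R _) (GRing.Scale.Law.clone _ _ *:%R _) bext.
Proof.
split=> [w|w] k u v /=; rewrite /bext scaler_sumr -big_split; apply: eq_bigr => A _;
  rewrite scaler_sumr -big_split; apply: eq_bigr => C _; rewrite !ffunE.
  by rewrite linearPl tensDl tensZl.
by rewrite linearP linearPr tensDl tensZl.
Qed.

HB.instance Definition _ := bilinear_isBilinear.Build K (T V) (T W) (T X) _ _ bext bext_bilinear.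

Lemma bext_mon v w A f :
  bext (tens v (x_ A)) (tens w f) = tens (B v (iter #|A| (grpar GW) w)) (x_ A * f).
Proof.
rewrite /bext (bigD1 A) //= [X in _ + X]big1 ?addr0 => [|A' nA].
  rewrite {2}(dsym_expand f) mulr_sumr tens_sumr; apply: eq_bigr => C _.
  by rewrite !ffunE eqxx scale1r -scalerAr tensZr linearZ linearZr_LR tensZl.
by rewrite big1 // => C _; rewrite !ffunE (negPf nA) scale0r linear0l tens0l.
Qed.

Lemma bext_tens b p v w f h : homog GW b w -> dhomog p f ->
  bext (tens v f) (tens w h) = (-1) ^+ (p && b) *: tens (B v w) (f * h).
Proof.
move=> hw; elim/dhomog_ind => {f} [|f f' IH IH'|k f IH|A oA].
- by rewrite tens0r linear0l mul0r tens0r scaler0.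
- by rewrite tensDr linearDl /= IH IH' mulrDl tensDr scalerDr.
- by rewrite tensZr linearZl_LR /= IH -scalerAl tensZr !scalerA mulrC.
by rewrite bext_mon (iter_grpar_homog _ hw) oA linearZr_LR tensZl.
Qed.

Lemma fil_bext m n (u : T V) (v : T W) : fil m u -> fil n v -> fil (m + n) (bext u v).
Proof.
move=> hu hv D ltD; rewrite sum_ffunE big1 // => A _; rewrite sum_ffunE big1 // => C _.
rewrite ffunE; have [->|/dsym_monM_neq0 cD] := eqVneq ((x_ A * x_ C) D) 0.
  by rewrite scale0r.
have [/hu->|leA] := ltnP #|A| m; first by rewrite linear0l scaler0.
have [/hv->|leC] := ltnP #|C| n; first by rewrite !(linear0, linear0r, scaler0).
by move: ltD; rewrite cD ltnNge leq_add.
Qed.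

Definition parity_preserving := forall b c v w, homog GV b v -> homog GW c w ->
  homog GX (b (+) c) (B v w).

Lemma tpar_bext p r u v : parity_preserving -> tpar GV p u -> tpar GW r v ->
  tpar GX (p (+) r) (bext u v).
Proof.
move=> BP; elim/tpar_ind => {u} [|u u' IH IH'|x A hx] hv.
- by rewrite linear0l; apply: tpar0.
- by rewrite linearDl /=; apply: tparD; auto.
elim/tpar_ind: v / hv => [|v v' IH IH'|y C hy].
- by rewrite linear0r; apply: tpar0.
- by rewrite linearDr /=; apply: tparD.
rewrite (bext_tens _ _ hy (@dhomog_mon K q A)); apply: tparZ.
have -> : p (+) r = p (+) odd #|A| (+) (r (+) odd #|C|) (+) (odd #|A| (+) odd #|C|).
  by case: (p) (r) (odd _) (odd _) => [] [] [] [].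
exact: tpar_tens (BP _ _ _ _ hx hy) (dhomogM (@dhomog_mon K q A) (@dhomog_mon K q C)).
Qed.

End Bext.

End Tensor.

Arguments tens_ind {K} q {W} G P.

Section TensorMaps.
Variables (K : fieldType) (q : nat).
Local Notation Lam := (dsym K q).
Local Notation x_ A := (dsym_mon K A).
Local Notation T W := {ffun {set 'I_q} -> W}.
Implicit Types (b c p r : bool) (f h : Lam).

(** Grassmann coefficients stand on the right, so the envelope is a right module without signs; this
    is the linearity with respect to which matrices are taken. *)
Definition rmul (W : lmodType K) h (u : T W) : T W := \sum_A tens (u A) (x_ A * h).

Lemma rmul_linear (W : lmodType K) h : linear (@rmul W h).
Proof.
move=> k u v; rewrite /rmul scaler_sumr -big_split; apply: eq_bigr => A _.
by rewrite !ffunE tensDl tensZl.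
Qed.

HB.instance Definition _ (W : lmodType K) h :=
  GRing.isLinear.Build K (T W) (T W) _ (@rmul W h) (@rmul_linear W h).

Lemma rmul_tens (W : lmodType K) h (w : W) f : rmul h (tens w f) = tens w (f * h).
Proof.
rewrite {2}(dsym_expand f) mulr_suml tens_sumr; apply: eq_bigr => A _.
by rewrite ffunE -scalerAl tensZr tensZl.
Qed.

Lemma bext_rmul (V W X : lmodType K) (GW : grading W) (B : {bilinear V -> W -> X}) h u v :
  bext GW B u (rmul h v) = rmul h (bext GW B u v).
Proof.
rewrite (tens_expand u) !linear_sumlz linear_sum; apply: eq_bigr => A _ /=.
elim/(tens_ind q GW): v => [|v v' IH IH'|b w C hw].
- by rewrite !(linear0, linear0r).
- by rewrite !(linearD, linearDr) /= IH IH'.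
rewrite rmul_tens !(bext_tens _ _ _ hw (@dhomog_mon K q A)) linearZ /= rmul_tens mulrA //.
Qed.

Section Lift.
Variables (W : lmodType K) (GW : grading W).

(* The sign rule for D of parity b: w (x) f goes to (-1)^(b p(w)) w (x) D f. *)
Definition dlift b (D : Lam -> Lam) (u : T W) : T W :=
  \sum_A tens (iter b (grpar GW) (u A)) (D (x_ A)).

Lemma dlift_linear b D : linear (dlift b D).
Proof.
move=> k u v; rewrite /dlift scaler_sumr -big_split; apply: eq_bigr => A _.
by rewrite !ffunE linearP tensDl tensZl.
Qed.

HB.instance Definition _ b D :=
  GRing.isLinear.Build K (T W) (T W) _ (dlift b D) (dlift_linear b D).

Lemma dlift_tens b c (D : {linear Lam -> Lam}) w f : homog GW c w ->
  dlift b D (tens w f) = (-1) ^+ (b && c) *: tens w (D f).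
Proof.
move=> hw; rewrite {2}(dsym_expand f) linear_sum tens_sumr scaler_sumr.
apply: eq_bigr => A _; rewrite ffunE (iter_grpar_homog _ (homogZ _ hw)).
by rewrite [D (f A *: _)]linearZ /= tensZr !tensZl oddb.
Qed.

Lemma dlift_comp b c (D E : {linear Lam -> Lam}) u :
  dlift b D (dlift c E u) = dlift (b (+) c) (D \o E) u.
Proof.
elim/(tens_ind q GW): u => [|u v IH IH'|r w A hw]; first by rewrite !linear0.
  by rewrite !linearD /= IH IH'.
rewrite !(dlift_tens _ _ _ hw) linearZ /= (dlift_tens _ _ _ hw) scalerA -signr_addb.
by congr (_ ^+ _ *: _); case: (b) (c) (r) => [] [] [].
Qed.

Lemma dliftB b k (D E : Lam -> Lam) u :
  dlift b (fun f => D f - k *: E f) u = dlift b D u - k *: dlift b E u.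
Proof.
rewrite /dlift scaler_sumr -sumrB; apply: eq_bigr => A _.
by rewrite tensDr -scaleNr tensZr -scaleNr.
Qed.

End Lift.

Lemma dlift_bext (V W X : lmodType K) (GV : grading V) (GW : grading W) (GX : grading X)
    (B : {bilinear V -> W -> X}) b p (D : {linear Lam -> Lam}) u v :
  parity_preserving GV GW GX B -> superderivation b D -> tpar GV p u ->
  dlift GX b D (bext GW B u v) =
  bext GW B (dlift GV b D u) v + (-1) ^+ (b && p) *: bext GW B u (dlift GW b D v).
Proof.
move=> BP [hD DM]; elim/tpar_ind => {u} [|u u' IH IH'|x A hx].
- by rewrite !(linear0, linear0l, scaler0, addr0).
- by rewrite !(linearD, linearDl) /= IH IH' addrACA.
elim/(tens_ind q GW): v => [|v v' IH IH'|c y C hy].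
- by rewrite !(linear0, linear0r, scaler0, addr0).
- by rewrite !(linearD, linearDr) /= IH IH' addrACA.
have hA := @dhomog_mon K q A; rewrite (bext_tens _ _ _ hy hA) linearZ /=.
rewrite (dlift_tens _ _ _ (BP _ _ _ _ hx hy)) (dlift_tens _ _ _ hx) (dlift_tens _ _ _ hy).
rewrite linearZl_LR linearZr_LR /= (bext_tens _ _ _ hy hA) (bext_tens _ _ _ hy (hD _ _ hA)).
rewrite (DM _ _ _ hA) tensDr tensZr !scalerDr !scalerA -!signr_addb.
by congr (_ ^+ _ *: _ + _ ^+ _ *: _); case: (b) (p) (c) (odd _) => [] [] [] [].
Qed.

Lemma bext_antisym (V X : lmodType K) (GV : grading V) (B : {bilinear V -> V -> X}) p r
    (u v : T V) :
  (forall b c x y, homog GV b x -> homog GV c y -> B x y = - ((-1) ^+ (b && c) *: B y x)) ->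
  tpar GV p u -> tpar GV r v ->
  bext GV B u v = - ((-1) ^+ (p && r) *: bext GV B v u).
Proof.
move=> Bsym hu hv; elim/tpar_ind: u / hu => [|u u' IH IH'|x A hx].
- by rewrite linear0l linear0r scaler0 oppr0.
- by rewrite linearDl linearDr /= IH IH' scalerDr opprD.
elim/tpar_ind: v / hv => [|v v' IH IH'|y C hy].
- by rewrite linear0l linear0r scaler0 oppr0.
- by rewrite linearDl linearDr /= IH IH' scalerDr opprD.
have [hA hC] := (@dhomog_mon K q A, @dhomog_mon K q C).
rewrite (bext_tens _ _ _ hy hA) (bext_tens _ _ _ hx hC) (Bsym _ _ _ _ hx hy).
rewrite (dsym_supercomm hA hC) tensZr tensNl tensZl !scalerN !scalerA -!signr_addb.
by congr (- (_ ^+ _ *: _)); case: (p) (r) (odd _) (odd _) => [] [] [] [].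
Qed.

End TensorMaps.

Section LieModule.
Variables (K : fieldType) (g : lieSuperalgebra K) (q : nat).
Local Notation Lam := (dsym K q).
Local Notation x_ A := (dsym_mon K A).
Local Notation T W := {ffun {set 'I_q} -> W}.

Lemma lie_bilinear : bilinear_for
  (GRing.Scale.Law.clone _ _ *:%R _) (GRing.Scale.Law.clone _ _ *:%R _) (@lie K g).
Proof. by split=> [w|w] k u v /=; rewrite (lieDl, lieDr). Qed.

HB.instance Definition _ :=
  bilinear_isBilinear.Build K g g g _ _ (@lie K g) lie_bilinear.

Lemma glieE (u v : T g) : glie u v = bext (lie_gr g) (@lie K g) u v.
Proof. by []. Qed.

Lemma lie_parity_preserving : parity_preserving (lie_gr g) (lie_gr g) (lie_gr g) (@lie K g).
Proof. by move=> b c x y; apply: lie_homog. Qed.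

Variables (W : lmodType K) (GW : grading W) (M : {bilinear g -> W -> W}).
Hypothesis M_parity : parity_preserving (lie_gr g) GW GW M.
Hypothesis M_lie : forall b c x y w, homog (lie_gr g) b x -> homog (lie_gr g) c y ->
  M x (M y w) = M (lie x y) w + (-1) ^+ (b && c) *: M y (M x w).

(** As [z] is even in the envelope, the signs of the super Jacobi identity disappear. It serves with
    [W] equal to g, where ad z becomes a derivation, and with [W] equal to U(g). *)
Lemma bext_lie (z u : T g) (w : T W) : tpar (lie_gr g) false z ->
  bext GW M z (bext GW M u w) =
  bext GW M (glie z u) w + bext GW M u (bext GW M z w).
Proof.
elim/tpar_ind => {z} [|z z' IH IH'|x A hx].
- by rewrite glieE !(linear0, linear0l, linear0r, addr0).
- rewrite glieE; do 3! rewrite ?(linearDl, linearDr) /=; by rewrite IH IH' addrACA.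
elim/(tens_ind q (lie_gr g)): u => [|u u' IH IH'|b y B hy].
- by rewrite glieE !(linear0, linear0l, linear0r, addr0).
- rewrite glieE; do 3! rewrite ?(linearDl, linearDr) /=; by rewrite IH IH' addrACA.
elim/(tens_ind q GW): w => [|w w' IH IH'|c w C hw].
- by rewrite !(linear0, linear0r, addr0).
- do 3! rewrite ?(linearDl, linearDr) /=; by rewrite IH IH' addrACA.
have [hA hB] := (@dhomog_mon K q A, @dhomog_mon K q B).
rewrite glieE (bext_tens _ _ _ hy hA) (bext_tens _ _ _ hw hB) (bext_tens _ _ _ hw hA).
rewrite linearZl_LR !linearZr_LR /= (bext_tens _ _ _ (M_parity hy hw) hA).
rewrite (bext_tens _ _ _ hw (dhomogM hA hB)) (bext_tens _ _ _ (M_parity hx hw) hB).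
rewrite (M_lie _ hx hy) tensDl scalerDr scalerDr tensZl !mulrA (dsym_supercomm hB hA) -scalerAl
  tensZr !scalerA -!signr_addb.
by congr (_ ^+ _ *: _ + _ ^+ _ *: _); case: (c) (b) (odd _) (odd _) => [] [] [] [].
Qed.

End LieModule.

(** * The vector fields of the symmetric superspace *)

Section SymmetricSpace.
Variables (K : fieldType) (charK0 : [pchar K] =i pred0) (g : lieSuperalgebra K).
Variables (q : nat) (e : q.-tuple g) (e_basis : basis_of (odd_part g) e).
Local Notation Lam := (dsym K q).
Local Notation x_ A := (dsym_mon K A).
Local Notation T W := {ffun {set 'I_q} -> W}.
Local Notation G := (lie_gr g).
Implicit Types (a : g) (u v w : T g) (i j : 'I_q).

Definition br := bext (q := q) G (@lie K g).
HB.instance Definition _ := Bilinear.on br.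

Lemma mem_odd_part a : (a \in odd_part g) = (G true a == a).
Proof.
apply/memv_imgP/eqP => [[b _ ->]|<-]; first by rewrite lfunE /= gr_orth.
by exists a; rewrite ?memvf // lfunE.
Qed.

Lemma e_odd i : homog G true e`_i.
Proof.
apply/eqP; rewrite -mem_odd_part; apply: (basis_mem e_basis).
by rewrite mem_nth ?size_tuple.
Qed.

Lemma odd_coord a : homog G true a -> a = \sum_(i < q) coord e i a *: e`_i.
Proof. by move/eqP; rewrite -mem_odd_part => /(coord_basis e_basis). Qed.

(** The parity of the g-components alone, unlike the total parity [tpar]; coordinates and traces on
    g_1 depend on this one. *)
Definition tval b (u : T g) := forall A, homog G b (u A).

Lemma tvalD b u v : tval b u -> tval b v -> tval b (u + v).
Proof. by move=> hu hv A; rewrite ffunE; apply: homogD. Qed.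

Lemma tvalZ b k u : tval b u -> tval b (k *: u).
Proof. by move=> hu A; rewrite ffunE; apply: homogZ. Qed.

Lemma tval_tens b a (f : Lam) : homog G b a -> tval b (tens a f).
Proof. by move=> ha A; rewrite ffunE; apply: homogZ. Qed.

Lemma homog_sum b I (s : seq I) (P : pred I) (F : I -> g) :
  (forall k, P k -> homog G b (F k)) -> homog G b (\sum_(k <- s | P k) F k).
Proof. by move=> hF; apply: big_ind => //; [apply: homog0 | apply: homogD]. Qed.

Lemma tval_br b c u v : tval b u -> tval c v -> tval (b (+) c) (br u v).
Proof.
move=> hu hv D; rewrite sum_ffunE; apply: homog_sum => A _.
rewrite sum_ffunE; apply: homog_sum => C _; rewrite ffunE; apply/homogZ/lie_homog => //.
by rewrite (iter_grpar_homog _ (hv C)); apply: homogZ.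
Qed.

Definition cd i (u : T g) : Lam := [ffun A => coord e i (u A)].

Lemma cd_linear i : linear (cd i).
Proof. by move=> k u v; apply/ffunP=> A; rewrite !ffunE linearP. Qed.

HB.instance Definition _ i := GRing.isLinear.Build K (T g) Lam _ (cd i) (cd_linear i).

Lemma cd_expand u : tval true u -> u = \sum_(i < q) tens e`_i (cd i u).
Proof.
move=> hu; apply/ffunP=> A; rewrite sum_ffunE [LHS](odd_coord (hu A)).
by apply: eq_bigr => i _; rewrite !ffunE.
Qed.

Lemma cd_tens i a (f : Lam) : cd i (tens a f) = coord e i a *: f.
Proof. by apply/ffunP=> A; rewrite !ffunE linearZ /= mulrC. Qed.

Lemma cd_basis i j (f : Lam) : cd i (tens e`_j f) = (i == j)%:R *: f.
Proof. by rewrite cd_tens (coord_free _ _ (basis_free e_basis)) eq_sym. Qed.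

Definition zpt : T g := (2%:R : K)^-1 *: generic_point e.
Definition adz := br zpt.
Lemma adz_linear : linear adz.
Proof. by move=> k u v; rewrite /adz linearPr. Qed.

HB.instance Definition _ := GRing.isLinear.Build K (T g) (T g) _ adz adz_linear.

Lemma zptE : zpt = (2%:R : K)^-1 *: \sum_(i < q) tens e`_i (x_ [set i]).
Proof. by []. Qed.

Lemma tpar_zpt : tpar G false zpt.
Proof.
apply: tparZ; apply: (big_ind (tpar G false)) => [||i _]; first exact: tpar0.
  by move=> u v; apply: tparD.
exact: tpar_tens (e_odd i) (dhomog_gen K i).
Qed.

Lemma tval_zpt : tval true zpt.
Proof.
apply: tvalZ => A; rewrite sum_ffunE; apply: homog_sum => i _.
exact/tval_tens/e_odd.
Qed.

Lemma fil_zpt : fil 1 zpt.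
Proof.
move=> A; rewrite ltnS leqn0 cards_eq0 => /eqP->; rewrite ffunE sum_ffunE big1 ?scaler0 // => i _.
rewrite !ffunE eq_sym; case: eqP => [/setP/(_ i)|_]; last by rewrite scale0r.
by rewrite !inE eqxx.
Qed.

Lemma fil_adz n u : fil n u -> fil n.+1 (adz u).
Proof. by rewrite -add1n; apply/fil_bext/fil_zpt. Qed.

Lemma fil_iter_adz n k u : fil n u -> fil (k + n) (iter k adz u).
Proof. by move=> hu; elim: k => //= k IHk; apply: fil_adz. Qed.

Lemma fil_ge (W : zmodType) (u : T W) : fil q.+1 u -> u = 0.
Proof.
move=> hu; apply/ffunP=> A; rewrite hu ?ffunE //.
by rewrite ltnS -[X in (_ <= X)%N]card_ord max_card.
Qed.

Lemma fil0 (W : zmodType) (u : T W) : fil 0 u. Proof. by []. Qed.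

Lemma iter_adz_eq0 k u : (q < k)%N -> iter k adz u = 0.
Proof.
move=> lt_qk; apply: fil_ge => A ltA; apply: (fil_iter_adz (n := 0)) => //.
by rewrite addn0; apply: leq_trans ltA _.
Qed.

Lemma adz_br u v : adz (br u v) = br (adz u) v + br u (adz v).
Proof.
by apply: bext_lie tpar_zpt => [|b c x y w hx hy];
  [apply: lie_parity_preserving | apply: lie_jacobi].
Qed.

Lemma tpar_adz p u : tpar G p u -> tpar G p (adz u).
Proof. by apply: tpar_bext tpar_zpt; apply: lie_parity_preserving. Qed.

Lemma tpar_pact p (P : {poly K}) u : tpar G p u -> tpar G p (pact adz P u).
Proof.
move=> hu; apply: pact_stable => [||k v|k]; [exact: tpar0|exact: tparD|exact: tparZ|].
by elim: k => //= k; apply: tpar_adz.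
Qed.

Lemma tval_adz b u : tval b u -> tval (~~ b) (adz u).
Proof. by rewrite -addTb; apply/tval_br/tval_zpt. Qed.

Lemma tval_pact_even b (P : {poly K}) u : tval b u -> tval b (pact adz (P \Po 'X^2) u).
Proof.
elim/poly_ind: P u => [|P c IHP] u hu.
  by rewrite comp_poly0 pact0 => A; rewrite ffunE; apply: homog0.
rewrite comp_polyD comp_polyM comp_polyX comp_polyC pactDl pactC.
apply: tvalD; last exact: tvalZ.
rewrite expr2 mulrA !pactMX; apply: IHP.
by rewrite -[b]negbK; apply/tval_adz/tval_adz.
Qed.

Lemma fil_pact n m (P : {poly K}) u : fil n u -> (forall k, (k < m)%N -> P`_k = 0) ->
  fil (m + n) (pact adz P u).
Proof.
move=> hu P0 A ltA; rewrite sum_ffunE big1 // => k _; rewrite ffunE.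
have [/P0->|le_mk] := ltnP k m; first by rewrite scale0r.
by rewrite (fil_iter_adz (k := k) hu) ?scaler0 // (leq_trans ltA) // leq_add2r.
Qed.

Local Notation c := (ch K q.+2).
Local Notation S := (shc K q.+2).
(** The geometric series for x/sinh(x). It inverts S(ad z) exactly, as 1 - S has no constant term
    and ad z is nilpotent. *)
Definition shc_inv : {poly K} := \sum_(k < q.+1) (1 - S) ^+ k.
Local Notation Q := shc_inv.

Lemma shc_inv_even : Q = (\sum_(k < q.+1) (1 - sinhc_poly K q.+2) ^+ k) \Po 'X^2.
Proof.
rewrite rmorph_sum /=; apply: eq_bigr => k _.
by rewrite rmorphXn rmorphB rmorph1.
Qed.

Lemma coef0_1BS k : (k < 1)%N -> (1 - S)`_k = 0.
Proof.
by case: k => // _; rewrite coefB coef1 coef_compX2 coef_poly /= muln0 invr1 subrr.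
Qed.

Lemma pact_shcK u : pact adz (S * Q) u = u.
Proof.
have -> : S * Q = 1 - (1 - S) ^+ q.+1.
  by rewrite -[RHS]opprB subrX1 -mulNr opprB subKr.
rewrite pactDl pact1 pactN [X in _ - X]fil_ge ?subr0 //.
suff H k : fil k (pact adz ((1 - S) ^+ k) u) by apply: H.
elim: k => [|k IHk]; first exact: fil0.
rewrite exprS pactM -add1n; apply: fil_pact => // l; exact: coef0_1BS.
Qed.

Lemma pact_shc_inj u v : pact adz S u = pact adz S v -> u = v.
Proof. by move=> e_uv; rewrite -[u]pact_shcK -[v]pact_shcK mulrC !pactM e_uv. Qed.

Lemma gr_homog b c a : homog G b a -> G c a = if b == c then a else 0.
Proof. by move=> ha; rewrite -ha gr_orth eq_sym; case: eqP => // ->. Qed.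

Local Notation cst a := (tens (q := q) a 1).

Lemma tpar_cst b a : homog G b a -> tpar G b (cst a).
Proof. move=> ha; rewrite -[b]addbF; exact: (tpar_tens ha (@dhomog1 K q)). Qed.

(* The value at z = y / 2 of the vector field X_a on g_1 that is the action of a
   in the coordinates e^y of the symmetric superspace: [a, z] for a even, and
   (ad z) coth(ad z) (a) for a odd. *)
Definition Vf a : T g := br (cst (G false a)) zpt + pact adz (c * Q) (cst (G true a)).

Lemma Vf_even a : homog G false a -> Vf a = br (cst a) zpt.
Proof. by move=> ha; rewrite /Vf !(gr_homog _ ha) /= tens0l linear0 addr0. Qed.

Lemma Vf_odd a : homog G true a -> Vf a = pact adz c (pact adz Q (cst a)).
Proof. by move=> ha; rewrite /Vf !(gr_homog _ ha) /= tens0l linear0l add0r pactM. Qed.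

Lemma tval_Vf a : tval true (Vf a).
Proof.
apply: tvalD; first exact: (tval_br (tval_tens _ (homog_gr _ _ _)) tval_zpt).
rewrite pactM shc_inv_even; do 2! apply: tval_pact_even.
exact/tval_tens/homog_gr.
Qed.

Lemma tpar_Vf b a : homog G b a -> tpar G b (Vf a).
Proof.
case: b => ha; first by rewrite Vf_odd //; do 2! apply: tpar_pact; apply: tpar_cst.
rewrite Vf_even // -[false]/(false (+) false).
exact: tpar_bext (@lie_parity_preserving _ g) (tpar_cst ha) tpar_zpt.
Qed.

(* The components X_a (x_i); the factor 2 comes from z = y / 2. *)
Definition xif a i : Lam :=
  2%:R *: (cd i (br (cst (G false a)) zpt) - cd i (pact adz (c * Q) (cst (G true a)))).

Lemma xif_homog b a i : homog G b a -> xif a i = (-1) ^+ b *: (2%:R *: cd i (Vf a)).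
Proof.
rewrite /xif /Vf linearD; case: b => ha; rewrite !(gr_homog _ ha) /= !(tens0l, linear0l, linear0).
  by rewrite !add0r scalerN expr1 scaleN1r.
by rewrite !addr0 expr0 scale1r.
Qed.

Lemma dhomog_cd b i u : tpar G b u -> tval true u -> dhomog (~~ b) (cd i u).
Proof.
move=> hu vu A nA; rewrite ffunE; have := gr_homog true (hu A).
rewrite (vu A) => ->; have -> : b (+) odd #|A| = false by move: nA; case: odd; case: (b).
by rewrite linear0.
Qed.

Lemma dhomog_xif b a i : homog G b a -> dhomog (~~ b) (xif a i).
Proof.
move=> ha; rewrite (xif_homog _ ha); do 2! apply: dhomogZ.
exact: dhomog_cd (tpar_Vf ha) (tval_Vf a).
Qed.

Definition Xf a := vecfield (xif a).
HB.instance Definition _ a := GRing.Linear.on (Xf a).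

Lemma Xf_superderivation b a : homog G b a -> superderivation b (Xf a).
Proof. by move=> ha; apply: vecfield_superderivation => i; apply: dhomog_xif. Qed.

Lemma dlift_zpt b (D : {linear Lam -> Lam}) :
  dlift G b D zpt = (-1) ^+ b *: ((2%:R : K)^-1 *: \sum_(i < q) tens e`_i (D (x_ [set i]))).
Proof.
rewrite zptE linearZ linear_sum /= scalerA mulrC -scalerA; congr (_ *: _).
rewrite scaler_sumr; apply: eq_bigr => i _.
by rewrite (dlift_tens _ _ _ (e_odd i)) andbT.
Qed.

(** The purpose of the factor 2 and of the sign in [xif], the sign being that of an odd derivation
    passing the odd vector e_i. Commutators of X_a with ad z can now be computed without
    coordinates. *)
Lemma dlift_Xf_zpt b a : homog G b a -> dlift G b (Xf a) zpt = Vf a.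
Proof.
move=> ha; rewrite dlift_zpt [RHS](cd_expand (tval_Vf a)) !scaler_sumr; apply: eq_bigr => i _.
rewrite /= /Xf vecfield_gen (xif_homog _ ha) -!tensZr !scalerA; congr (tens _ _).
rewrite [X in X *: _](_ : _ = 1) ?scale1r //.
by have := half2 charK0; case: (b) => /= nz2; field.
Qed.

Lemma dlift_adz b (D : {linear Lam -> Lam}) u : superderivation b D ->
  dlift G b D (adz u) = br (dlift G b D zpt) u + adz (dlift G b D u).
Proof.
move=> sD; rewrite /adz /br (dlift_bext _ (@lie_parity_preserving _ g) sD tpar_zpt).
by rewrite andbF scale1r.
Qed.

Lemma dlift_cst b c0 (D : {linear Lam -> Lam}) a : superderivation b D -> homog G c0 a ->
  dlift G b D (cst a) = 0.
Proof. by move=> sD ha; rewrite (dlift_tens _ _ _ ha) (superderivation1 sD) tens0r scaler0. Qed.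

(** The number of applications of ad z bounds the Grassmann degree from below: here truncated
    identities become exact. *)
Lemma br_low m (P : {poly {poly K}}) u v : low m P -> (q < m)%N ->
  pact2 adz adz br u v P = 0.
Proof.
move=> lP lt_qm; apply: pact2_low lP => i j le_ij; apply: fil_ge => A ltA.
have hi : fil i (iter i adz u) by rewrite -[i in fil i]addn0; apply: fil_iter_adz.
have hj : fil j (iter j adz v) by rewrite -[j in fil j]addn0; apply: fil_iter_adz.
by apply: (fil_bext G _ hi hj); rewrite (leq_trans ltA) // (leq_trans lt_qm).
Qed.

Lemma br_oddC u v : tpar G true u -> tpar G true v -> br u v = br v u.
Proof.
move=> hu hv; rewrite /br (bext_antisym _ hu hv) ?scaleN1r ?opprK //.
by move=> b c0 x y; apply: lie_antisym.
Qed.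

Lemma pact2_br_swap u v P : tpar G true u -> tpar G true v ->
  pact2 adz adz br u v P = pact2 adz adz br v u (swapXY P).
Proof.
move=> hu hv; apply: pact2_swap => i j.
have tpar_iter k w : tpar G true w -> tpar G true (iter k adz w).
  by move=> hw; elim: k => //= k; apply: tpar_adz.
by apply: br_oddC; apply: tpar_iter.
Qed.

Lemma br_cst b a a' : homog G b a' -> br (cst a) (cst a') = cst (lie a a').
Proof. by move=> ha'; rewrite /br (bext_tens _ _ _ ha' (@dhomog1 K q)) scale1r mulr1. Qed.

(** [Vf a'] is characterized by S(ad z) V = cosh(ad z) a'. Differentiating this relation along X_a
    yields S(ad z) of the wanted derivative, and S(ad z) is injective. *)
Lemma dlift_Vf_odd a a' : homog G true a -> homog G true a' ->
  dlift G true (Xf a) (Vf a') + dlift G true (Xf a') (Vf a) = adz (cst (lie a a')).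
Proof.
have [DS DSE] := ex_divided_diff S; have [Dc DcE] := ex_divided_diff c.
pose P := c%:P * (Dc * S^:P - DS * c^:P).
have half b b' : homog G true b -> homog G true b' ->
    pact adz S (dlift G true (Xf b) (Vf b')) =
    pact2 adz adz br (pact adz Q (cst b)) (pact adz Q (cst b')) P.
  move=> hb hb'; pose d : {linear T g -> T g} := dlift G true (Xf b).
  have dadz w : d (adz w) = br (Vf b) w + adz (d w).
    by rewrite /d /= (dlift_adz _ (Xf_superderivation hb)) (dlift_Xf_zpt hb).
  have eV : pact adz S (Vf b') = pact adz c (cst b').
    by rewrite (Vf_odd hb') -!pactM [S * c]mulrC -mulrA pactM pact_shcK.
  have := pact_derivation adz_br (Vf b') dadz DSE.
  rewrite eV (pact_derivation adz_br _ dadz DcE).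
  have -> : d (cst b') = 0 by apply: dlift_cst (Xf_superderivation hb) hb'.
  rewrite linear0 addr0 => e1; rewrite -[LHS](addKr (pact2 adz adz br (Vf b) (Vf b') DS)) -e1.
  (* In terms of u and u' one has b = S(ad z) u and [Vf b] = cosh(ad z) u, and likewise for b';
     hence both Duhamel terms become symbols acting on the same pair. *)
  set u := pact adz Q (cst b); set u' := pact adz Q (cst b').
  have -> : pact2 adz adz br (Vf b) (cst b') Dc = pact2 adz adz br u u' (Dc * S^:P * c%:P).
    by rewrite pact2MC pact2M /u' -pactM pact_shcK -(Vf_odd hb).
  have -> : pact2 adz adz br (Vf b) (Vf b') DS = pact2 adz adz br u u' (DS * c^:P * c%:P).
    by rewrite pact2MC pact2M -(Vf_odd hb) -(Vf_odd hb').
  rewrite [LHS]addrC -pact2B; congr (pact2 _ _ _ _ _ _); rewrite /P; ring.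
move=> ha ha'; apply: pact_shc_inj.
have padD u v : pact adz S (u + v) = pact adz S u + pact adz S v by apply: linearD.
rewrite padD; apply: etrans (congr2 +%R (half _ _ ha ha') (half _ _ ha' ha)) _.
(* The term with the roles of a and a' exchanged becomes the second summand of
   [bracket_identity]. *)
rewrite [X in _ + X]pact2_br_swap; try exact/tpar_pact/tpar_cst.
rewrite -pact2D; apply/eqP; rewrite -subr_eq0.
have -> : pact adz S (adz (cst (lie a a'))) = pact2 adz adz br (pact adz Q (cst a))
    (pact adz Q (cst a')) (poly_XaY ('X * S) * (S%:P * S^:P)).
  rewrite [poly_XaY _ * _]mulrC (pact2MXaY adz_br) [S%:P * _]mulrC pact2MC.
  rewrite -[S^:P]mul1r pact2M -polyC1 pact2C pact1 -!pactM !pact_shcK /=.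
  by rewrite (br_cst a ha') mulrC pactMX.
rewrite -pact2B; apply/eqP; apply: br_low (_ : low (2 * q.+1) _) _; last first.
  by rewrite mul2n -addnn addSn ltnS leq_addr.
apply: low_eq (bracket_identity charK0 DSE DcE) _.
by rewrite (swapXY_divided c S Dc DS).
Qed.

Lemma pderiv_superderivation j : superderivation true (@pderiv K q j).
Proof. by split=> [p f|p f h]; [apply: dhomog_pderiv | apply: pderivM]. Qed.

Lemma dlift_pderiv_zpt j : dlift G true (pderiv j) zpt = - ((2%:R : K)^-1 *: cst e`_j).
Proof.
rewrite (dlift_zpt _ (pderiv j)) expr1 scaleN1r (bigD1 j) //= pderiv_gen eqxx scale1r big1 ?addr0
  //.
by move=> i nij; rewrite pderiv_gen eq_sym (negPf nij) scale0r tens0r.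
Qed.

Lemma dlift_pderiv_Vf j b a : homog G b a ->
  \sum_(i < q) tens e`_i (pderiv j (xif a i)) =
  - (((-1) ^+ b * 2%:R) *: dlift G true (pderiv j) (Vf a)).
Proof.
move=> ha; have -> : dlift G true (pderiv j) (Vf a) =
    \sum_(i < q) dlift G true (pderiv j) (tens e`_i (cd i (Vf a))).
  by rewrite -linear_sum -(cd_expand (tval_Vf a)).
rewrite scaler_sumr -sumrN; apply: eq_bigr => i _;
  rewrite (xif_homog _ ha) scalerA (dlift_tens _ (pderiv j) _ (e_odd i)).
by rewrite linearZ /= tensZr expr1 scaleN1r scalerN opprK.
Qed.

Lemma dlift_Xf_adz b a u : homog G b a ->
  dlift G b (Xf a) (adz u) = br (Vf a) u + adz (dlift G b (Xf a) u).
Proof. by move=> ha; rewrite (dlift_adz _ (Xf_superderivation ha)) (dlift_Xf_zpt ha). Qed.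

(** X_a and the bracket with [a] have the same commutator with ad z, namely the bracket with [Vf a];
    their difference therefore commutes with every p(ad z). *)
Lemma dlift_Xf_pact_even a (p : {poly K}) w : homog G false a ->
  dlift G false (Xf a) (pact adz p w) =
  br (cst a) (pact adz p w) - pact adz p (br (cst a) w) + pact adz p (dlift G false (Xf a) w).
Proof.
move=> ha; have [D DE] := ex_divided_diff p.
pose d : {linear T g -> T g} := dlift G false (Xf a).
have dadz u : d (adz u) = br (Vf a) u + adz (d u) by apply: dlift_Xf_adz.
pose B : {bilinear T g -> T g -> T g} := br.
pose d' : {linear T g -> T g} := B (cst a).
have d'adz u : d' (adz u) = br (Vf a) u + adz (d' u).
  rewrite (Vf_even ha) /d' /=.
  apply: (bext_lie (W := g)) (tpar_cst ha) => [|b c0 x y w' hx hy].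
    exact: lie_parity_preserving.
  exact: lie_jacobi hx hy.
have := pact_derivation adz_br w d'adz DE; rewrite -[br _ (pact _ _ _)]/(d' _) => ->.
by rewrite -[LHS]/(d _) (pact_derivation adz_br w dadz DE) addrK.
Qed.

(* X_a moves the frame S(ad z) e_j by ad kappa for some kappa in g_0 (x) Lam,
   which is a for a even, and (1 - cosh)/sinh (ad z) (a) for a odd. *)
Lemma jacobian_even a j : homog G false a ->
  dlift G false (Xf a) (pact adz S (cst e`_j)) +
    pact adz S (\sum_(i < q) tens e`_i (pderiv j (xif a i))) =
  br (cst a) (pact adz S (cst e`_j)).
Proof.
move=> ha; have -> : \sum_(i < q) tens e`_i (pderiv j (xif a i)) = br (cst a) (cst e`_j).
  rewrite (dlift_pderiv_Vf _ ha) (Vf_even ha) /br.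
  rewrite (dlift_bext _ (@lie_parity_preserving _ g) (pderiv_superderivation j) (tpar_cst ha)).
  rewrite (dlift_cst (pderiv_superderivation j) ha) linear0l add0r dlift_pderiv_zpt.
  rewrite linearNr linearZr_LR /= scale1r scalerN opprK scalerA mul1r.
  by rewrite mulfV ?scale1r //; apply: half2.
rewrite (dlift_Xf_pact_even _ _ ha) (dlift_cst (Xf_superderivation ha) (e_odd j)).
by rewrite linear0 addr0 subrK.
Qed.

Lemma jacobian_odd a j : homog G true a ->
  dlift G true (Xf a) (pact adz S (cst e`_j)) +
    pact adz S (\sum_(i < q) tens e`_i (pderiv j (xif a i))) =
  br (pact adz (chm K q.+1) (pact adz Q (cst a))) (pact adz S (cst e`_j)).
Proof.
move=> ha; have [DS DSE] := ex_divided_diff S; have [Dc DcE] := ex_divided_diff c.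
have sD := pderiv_superderivation j.
rewrite (dlift_pderiv_Vf _ ha) expr1 mulN1r scaleNr opprK.
set w := cst e`_j; set a' := pact adz Q (cst a).
have hw : tpar G true w by apply/tpar_cst/e_odd.
have ha' : tpar G true a' by apply/tpar_pact/tpar_cst.
pose d : {linear T g -> T g} := dlift G true (Xf a).
have dadz u : d (adz u) = br (Vf a) u + adz (d u) by apply: dlift_Xf_adz.
pose p : {linear T g -> T g} := dlift G true (pderiv j).
pose w2 := - ((2%:R : K)^-1 *: w).
have padz u : p (adz u) = br w2 u + adz (p u).
  by rewrite /p /= (dlift_adz (D := pderiv j) _ sD) dlift_pderiv_zpt.
rewrite -[dlift _ _ (Xf a) _]/(d _) -[dlift _ _ (pderiv j) _]/(p _).
rewrite (pact_derivation adz_br _ dadz DSE).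
have -> : d w = 0 by apply: dlift_cst (Xf_superderivation ha) (e_odd j).
rewrite linear0 addr0 linearZ /=.
(* Again S(ad z) V = cosh(ad z) a is differentiated, now along x_j. *)
have eV : pact adz S (Vf a) = pact adz c (cst a).
  by rewrite (Vf_odd ha) -!pactM [S * c]mulrC -mulrA pactM pact_shcK.
have := pact_derivation adz_br (Vf a) padz DSE.
rewrite eV (pact_derivation adz_br _ padz DcE).
have -> : p (cst a) = 0 by apply: dlift_cst sD ha.
rewrite linear0 addr0 => e1.
have -> : pact adz S (p (Vf a)) =
    pact2 adz adz br w2 (cst a) Dc - pact2 adz adz br w2 (Vf a) DS.
  by rewrite e1 addrC addKr.
have eS : cst a = pact adz S a' by rewrite /a' -pactM pact_shcK.
have w2E u (P : {poly {poly K}}) : pact2 adz adz br w2 u P = - 2%:R^-1 *: pact2 adz adz br w u P.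
  by rewrite -pact2Zl scaleNr.
have swap u (P : {poly {poly K}}) : tpar G true u ->
    pact2 adz adz br w u P = pact2 adz adz br u w (swapXY P).
  by move=> hu; apply: pact2_br_swap.
(* The 2 of [xif] cancels the 1/2 in the derivative of z. *)
rewrite !w2E -scalerBr scalerA mulrN mulfV ?half2 // scaleN1r opprB.
(* The Duhamel terms of d/dx_j have e_j on the left; the swap puts Q(ad z) a on the left everywhere,
   as [jacobian_identity] expects. *)
rewrite (swap _ _ (tpar_Vf ha)) (swap _ _ (tpar_cst ha)) eS (Vf_odd ha) -/a'.
clearbody a'; rewrite -!pact2MC addrA -pact2D -pact2B.
have -> : br (pact adz (chm K q.+1) a') (pact adz S w) =
    pact2 adz adz br a' w ((chm K q.+1)%:P * S^:P).
  by rewrite pact2M pact2C.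
apply: subr0_eq; rewrite -pact2B.
apply: br_low (jacobian_identity charK0 DSE DcE) _.
by rewrite mul2n -addnn addSn ltnS leq_addr.
Qed.

(** [chm] is an odd series, so it carries the odd [a] to components in g_0, where the hypothesis on
    supertraces applies. *)
Lemma tval_compensator a : homog G true a ->
  tval false (pact adz (chm K q.+1) (pact adz Q (cst a))).
Proof.
move=> ha; rewrite /chm mulrC pactMX shc_inv_even; apply: tval_pact_even.
by rewrite -[false]/(~~ true); apply/tval_adz/tval_pact_even/tval_tens.
Qed.

Hypothesis str0 : forall a : g, homog G false a -> str_odd e (lie a) = 0.

Lemma trace_br_even kappa : tval false kappa -> \sum_(i < q) cd i (br kappa (cst e`_i)) = 0.
Proof.
move=> hk; have trE i : cd i (br kappa (cst e`_i)) =
    \sum_(A : {set 'I_q}) ((-1) ^+ odd #|A| * coord e i (lie (kappa A) e`_i)) *: x_ A.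
  rewrite {1}[kappa]tens_expand /br linear_sumlz linear_sum; apply: eq_bigr => A _ /=.
  rewrite (bext_tens _ _ _ (e_odd i) (@dhomog_mon K q A)) linearZ /= cd_tens mulr1 scalerA.
  by rewrite andbT.
rewrite (eq_bigr _ (fun i _ => trE i)) exchange_big big1 // => A _ /=.
rewrite -scaler_suml -mulr_sumr; have /eqP := str0 (hk A); rewrite oppr_eq0 => /eqP ->.
by rewrite mulr0 scale0r.
Qed.

Definition Mx : 'M[Lam]_q := \matrix_(i, j) cd i (pact adz S (cst e`_j)).

(** The sum in the definition of J_2 has one term less than [S]; by nilpotency of ad z this makes no
    difference. *)
Lemma sinhc_adE u : sinhc_ad e u = pact adz S u.
Proof.
transitivity (pact adz (shc K q.+1) u); last first.
  apply: (@pact_truncate _ _ _ q.+1) => [k|k lt_k]; first exact: iter_adz_eq0.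
  rewrite !coef_compX2 !coef_poly; case: odd => //.
  have lt_k2 : (k./2 < q.+1)%N.
    by apply: leq_ltn_trans lt_k; rewrite -{2}(odd_double_half k) -addnn addnA leq_addl.
  by rewrite lt_k2 (leq_trans lt_k2).
have pact_Xn k v : pact adz 'X^k v = iter k adz v.
  by elim: k v => [|k IHk] v; [rewrite pact1 | rewrite exprSr pactMX IHk iterSr].
rewrite /shc /sinhc_poly poly_def rmorph_sum /=.
rewrite (big_morph (fun p => pact adz p u) (fun p r => pactDl adz p r u) (pact0 adz u)).
apply: eq_bigr => k _; rewrite comp_polyZ rmorphXn /= comp_polyX -exprM -mul_polyC pactM pactC.
by rewrite pact_Xn.
Qed.

Lemma odd_matrix_sinhc : odd_matrix e (sinhc_ad e) = Mx.
Proof. by apply/matrixP=> i j; rewrite !mxE sinhc_adE. Qed.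

Lemma dhomog_Mx i j : dhomog false (Mx i j).
Proof.
rewrite mxE -[false]/(~~ true); apply: dhomog_cd; first exact/tpar_pact/tpar_cst/e_odd.
exact/tval_pact_even/tval_tens/e_odd.
Qed.

Lemma fil_pact_sub (p : {poly K}) u : p`_0 = 1 -> fil 1 (pact adz p u - u).
Proof.
move=> p0; have -> : pact adz p u - u = pact adz (p - 1) u by rewrite pactDl pactN pact1.
apply: (@fil_pact 0 1) => [|[|k] //]; first exact: fil0.
by rewrite coefB coef1 p0 subrr.
Qed.

Lemma pact_set0 (p : {poly K}) u : p`_0 = 1 -> pact adz p u set0 = u set0.
Proof.
move=> p0; have := fil_pact_sub u p0 (A := set0); rewrite cards0 => /(_ isT).
by rewrite ffunE [X in _ + X]ffunE => /eqP; rewrite subr_eq0 => /eqP.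
Qed.

Lemma coef0_shc : S`_0 = 1.
Proof. by have := coef0_1BS (ltnSn 0); rewrite coefB coef1 => /eqP; rewrite subr_eq0 => /eqP. Qed.

Lemma coef0_chQ : (c * Q)`_0 = 1.
Proof.
rewrite coef0M coef_compX2 coef_poly /= muln0 invr1 mul1r coef_sum big_ord_recl expr0 coef1.
rewrite big1 ?addr0 // => k _; rewrite exprS coef0M coefB coef1 coef0_shc subrr mul0r //.
Qed.

(** Modulo nilpotents sinh(x)/x is 1; hence the determinant will have constant term 1. *)
Lemma Mx_set0 i j : Mx i j set0 = (i == j)%:R.
Proof.
rewrite mxE ffunE (pact_set0 _ coef0_shc).
transitivity (cd i (cst e`_j) set0); first by rewrite [RHS]ffunE.
by rewrite cd_basis ffunE -dsym_mon0 ffunE eqxx; apply: mulr1.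
Qed.

Lemma cd_rmul k f u : cd k (rmul f u) = cd k u * f.
Proof.
have -> : rmul f u = \sum_A rmul f (tens (u A) (x_ A)) by rewrite -linear_sum -tens_expand.
have -> : cd k u = \sum_A cd k (tens (u A) (x_ A)) by rewrite -linear_sum -tens_expand.
rewrite linear_sum mulr_suml; apply: eq_bigr => A _ /=.
by rewrite rmul_tens !cd_tens scalerAl.
Qed.

Lemma adz_rmul f u : adz (rmul f u) = rmul f (adz u).
Proof. exact: bext_rmul. Qed.

Lemma pact_rmul (p : {poly K}) f u : pact adz p (rmul f u) = rmul f (pact adz p u).
Proof. by rewrite (pact_commute (L' := adz) _ _ (fun v => esym (adz_rmul f v))). Qed.

Lemma cd_dlift k b (D : {linear Lam -> Lam}) u : tval true u ->
  cd k (dlift G b D u) = (-1) ^+ b *: D (cd k u).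
Proof.
move=> hu; rewrite (dsym_expand (cd k u)) (linear_sum D) scaler_sumr (linear_sum (cd k)).
apply: eq_bigr => A _; rewrite /= cd_tens (iter_grpar_homog _ (hu A)) oddb andbT.
by rewrite [coord e k _]linearZ [D (_ *: _)]linearZ ffunE scalerA.
Qed.

(** The frame equation in coordinates, in the shape that Liouville's formula requires: [N] is the
    matrix of ad kappa, and the second term contains the Jacobian matrix of X_a. *)
Lemma jacobian_matrix b a : homog G b a ->
  exists N : 'I_q -> 'I_q -> Lam, \sum_i N i i = 0 /\
    forall k j, (-1) ^+ b *: Xf a (Mx k j) + \sum_i Mx k i * pderiv j (xif a i) =
                \sum_i N k i * Mx i j.
Proof.
move=> ha; have [kappa vk jac] : exists2 kappa, tval false kappa & forall j,
    dlift G b (Xf a) (pact adz S (cst e`_j)) +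
    pact adz S (\sum_(i < q) tens e`_i (pderiv j (xif a i))) = br kappa (pact adz S (cst e`_j)).
  case: b ha => ha; last by exists (cst a); [apply: tval_tens | move=> j; apply: jacobian_even].
  by eexists; [apply: (tval_compensator ha) | move=> j; apply: jacobian_odd].
exists (fun k i => cd k (br kappa (cst e`_i))); split=> [|k j]; first exact: trace_br_even.
have vS i : tval true (pact adz S (cst e`_i)) by apply/tval_pact_even/tval_tens/e_odd.
have cstM i f : tens e`_i f = rmul f (cst e`_i) by rewrite rmul_tens mul1r.
have := congr1 (cd k) (jac j); rewrite linearD /= => jk.
transitivity (cd k (dlift G b (Xf a) (pact adz S (cst e`_j)))
    + cd k (pact adz S (\sum_(i < q) tens e`_i (pderiv j (xif a i))))).
  congr (_ + _).
    by rewrite (cd_dlift k b (Xf a) (vS j)) mxE.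
  rewrite (linear_sum (pact adz S)) (linear_sum (cd k)); apply: eq_bigr => i _.
  by rewrite cstM /= pact_rmul cd_rmul mxE.
rewrite jk {1}(cd_expand (vS j)) /br linear_sumr (linear_sum (cd k)); apply: eq_bigr => i _ /=.
by rewrite cstM bext_rmul cd_rmul mxE.
Qed.

Lemma Vf_linear : linear Vf.
Proof.
move=> k a a'; rewrite /Vf !linearP !tensDl !tensZl linearPl linearP scalerDr.
by rewrite addrACA.
Qed.

Lemma Vf_opp a : Vf (- a) = - Vf a.
Proof.
have := Vf_linear (-1) a 0; rewrite scaleN1r addr0 => ->.
by rewrite scaleN1r /Vf !linear0 tens0l linear0l linear0 addr0 addr0.
Qed.

(** Two odd elements are the case of [dlift_Vf_odd]. If just one is even, its field acts as the
    bracket with it; two even elements reduce to the Jacobi identity. *)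
Lemma dlift_Vf_commutator b b' a a' : homog G b a -> homog G b' a' ->
  dlift G b (Xf a) (Vf a') - (-1) ^+ (b && b') *: dlift G b' (Xf a') (Vf a) =
  - Vf (lie a a').
Proof.
have even_odd x y : homog G false x -> homog G true y ->
    dlift G false (Xf x) (Vf y) - dlift G true (Xf y) (Vf x) = - Vf (lie x y).
  move=> hx hy; have hxy := lie_homog hx hy.
  rewrite [in dlift G true (Xf y) _](Vf_even hx) /br.
  rewrite (dlift_bext _ (@lie_parity_preserving _ g) (Xf_superderivation hy) (tpar_cst hx)).
  rewrite (dlift_cst (Xf_superderivation hy) hx) linear0l add0r andbF scale1r (dlift_Xf_zpt hy).
  rewrite (Vf_odd hy) -pactM (dlift_Xf_pact_even _ _ hx) (dlift_cst (Xf_superderivation hx) hy).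
  by rewrite linear0 addr0 addrAC subrr add0r (Vf_odd hxy) -pactM (br_cst _ hy).
case: b b' => [] [] ha ha'.
- rewrite expr1 scaleN1r opprK (dlift_Vf_odd ha ha').
  have h := lie_homog ha ha'; rewrite (Vf_even h) /adz /br.
  have lsym b c0 x y := @lie_antisym K g b c0 x y.
  by rewrite (bext_antisym lsym tpar_zpt (tpar_cst h)) scale1r.
- rewrite scale1r -[LHS]opprB (even_odd _ _ ha' ha) opprK.
  by rewrite (lie_antisym ha ha') scale1r Vf_opp opprK.
- by rewrite scale1r even_odd.
have half x y : homog G false x -> homog G false y ->
    dlift G false (Xf x) (Vf y) = br (cst y) (br (cst x) zpt).
  move=> hx hy; rewrite (Vf_even hy) /br.
  rewrite (dlift_bext _ (@lie_parity_preserving _ g) (Xf_superderivation hx) (tpar_cst hy)).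
  by rewrite (dlift_cst (Xf_superderivation hx) hy) linear0l add0r scale1r (dlift_Xf_zpt hx)
    (Vf_even hx).
rewrite scale1r; apply: etrans (congr2 (fun u v => u - v) (half _ _ ha ha') (half _ _ ha' ha)) _.
rewrite (Vf_even (lie_homog ha ha')).
have -> : br (cst a) (br (cst a') zpt) =
    br (cst (lie a a')) zpt + br (cst a') (br (cst a) zpt).
  rewrite -(br_cst _ ha'); apply: (bext_lie (W := g)) (tpar_cst ha) => [|b c0 x y w hx hy].
    exact: lie_parity_preserving.
  exact: lie_jacobi hx hy.
by rewrite opprD addrCA subrr addr0.
Qed.

Lemma dlift_zpt_inj b (D D' : {linear Lam -> Lam}) :
  dlift G b D zpt = dlift G b D' zpt -> forall i, D (x_ [set i]) = D' (x_ [set i]).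
Proof.
have cdD (E : {linear Lam -> Lam}) i :
    cd i (dlift G b E zpt) = (-1) ^+ b *: ((2%:R : K)^-1 *: E (x_ [set i])).
  rewrite dlift_zpt !linearZ (linear_sum (cd i)) (bigD1 i) //= cd_basis eqxx scale1r big1 ?addr0.
    by rewrite !scalerA mulrC.
  by move=> j nij; rewrite cd_basis eq_sym (negPf nij) scale0r.
move=> eD i; have := congr1 (cd i) eD; rewrite !cdD.
have /scalerI inj1 : (-1) ^+ b != 0 :> K by rewrite signr_eq0.
have /scalerI inj2 : (2%:R : K)^-1 != 0 by rewrite invr_eq0 half2.
by move/inj1/inj2.
Qed.

(** Both sides are superderivations of the same parity, hence determined by the x_i, and the value
    on z encodes all the x_i at once. *)
Lemma Xf_commutator b b' a a' f : homog G b a -> homog G b' a' ->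
  Xf a (Xf a' f) - (-1) ^+ (b && b') *: Xf a' (Xf a f) = - Xf (lie a a') f.
Proof.
move=> ha ha'; have [sa sa'] := (Xf_superderivation ha, Xf_superderivation ha').
pose s : K := (-1) ^+ (b && b').
pose D : {linear Lam -> Lam} := (Xf a \o Xf a') \- s \*: (Xf a' \o Xf a).
pose D' : {linear Lam -> Lam} := vecfield (fun i => - xif (lie a a') i).
have -> : - Xf (lie a a') f = D' f.
  by rewrite /D' /Xf /vecfield /= -sumrN; apply: eq_bigr => i _; rewrite mulNr.
rewrite -[LHS]/(D f); apply: (superderivation_eq (b := b (+) b')) => [||i].
- exact: supercommutator_superderivation sa sa'.
- apply: vecfield_superderivation => i; rewrite -scaleN1r; apply/dhomogZ/dhomog_xif.
  exact: lie_homog.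
apply: (dlift_zpt_inj (b := b (+) b')).
have -> : dlift G (b (+) b') D zpt =
    dlift G b (Xf a) (Vf a') - s *: dlift G b' (Xf a') (Vf a).
  rewrite -(dlift_Xf_zpt ha) -(dlift_Xf_zpt ha') !dlift_comp [b' (+) b]addbC.
  exact: dliftB.
rewrite (dlift_Vf_commutator ha ha') -(dlift_Xf_zpt (lie_homog ha ha')) !dlift_zpt.
rewrite -scalerN -scalerN -sumrN; do 2! congr (_ *: _); apply: eq_bigr => j _.
have eX : Xf (lie a a') (x_ [set j]) = xif (lie a a') j by apply: vecfield_gen.
by rewrite /D' /= eX vecfield_gen tensNr.
Qed.
End SymmetricSpace.

(** * Derivations and determinants *)

Section DeterminantDerivation.
(** Two rings are needed: the determinant is formed in a commutative ring, but an odd derivation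
    takes its elements out of that ring. *)
Variables (R : comPzRingType) (A : pzRingType) (iota : {rmorphism R -> A}).
Variable delta : {additive A -> A}.
Hypothesis iotaC : forall r m, iota r * m = m * iota r.
Hypothesis deltaM : forall r s,
  delta (iota (r * s)) = delta (iota r) * iota s + delta (iota s) * iota r.

Lemma derivation_prod (I : eqType) (s : seq I) (F : I -> R) : uniq s ->
  delta (iota (\prod_(i <- s) F i)) =
  \sum_(i <- s) delta (iota (F i)) * iota (\prod_(k <- s | i != k) F k).
Proof.
elim: s => [|x s IHs] /=.
  have := deltaM 1 1; rewrite mulr1 rmorph1 mulr1 => /esym/eqP.
  by rewrite !big_nil -subr_eq0 rmorph1 addrK => /eqP.
case/andP=> nxs /IHs {}IHs; rewrite !big_cons deltaM IHs eqxx /=; congr (_ + _).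
  congr (_ * iota _); rewrite big_seq [RHS]big_seq_cond; apply: eq_bigl => k.
  by rewrite andbC; case: eqVneq => // <-; rewrite (negPf nxs).
rewrite mulr_suml; apply: eq_big_seq => i si.
have nix : i != x by apply: contraNneq nxs => <-.
by rewrite big_cons nix mulrC rmorphM mulrA.
Qed.

(** Jacobi's formula: the permutations with s(i) = j, stripped of their factor in row i, sum to the
    cofactor. *)
Lemma derivation_det n (M : 'M[R]_n) :
  delta (iota (\det M)) = \sum_i \sum_j delta (iota (M i j)) * iota (cofactor M i j).
Proof.
have signE (b : bool) r : delta (iota ((-1) ^+ b * r)) = delta (iota r) * iota ((-1) ^+ b).
  by case: b; rewrite ?expr0 ?expr1 ?mulN1r ?mul1r ?rmorphN ?raddfN ?rmorph1 ?mulrN ?mulr1.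
transitivity (\sum_(s : 'S_n) \sum_i delta (iota (M i (s i))) *
    iota ((-1) ^+ s * \prod_(k | i != k) M k (s k))).
  rewrite /determinant rmorph_sum raddf_sum; apply: eq_bigr => s _.
  rewrite signE derivation_prod ?index_enum_uniq // mulr_suml; apply: eq_bigr => i _.
  by rewrite -mulrA -rmorphM mulrC.
rewrite exchange_big; apply: eq_bigr => i _ /=.
rewrite (partition_big (fun s : 'S_n => s i) xpredT) //=; apply: eq_bigr => j _.
rewrite expand_cofactor rmorph_sum mulr_sumr; apply: eq_bigr => s /eqP sij.
by rewrite sij.
Qed.

(* Liouville's formula *)
Lemma derivation_det_trace n (M : 'M[R]_n) (D N : 'I_n -> 'I_n -> A) :
  (forall k j, delta (iota (M k j)) + \sum_i iota (M k i) * D i j =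
               \sum_i N k i * iota (M i j)) ->
  delta (iota (\det M)) + (\sum_i D i i) * iota (\det M) = (\sum_i N i i) * iota (\det M).
Proof.
move=> eM; rewrite derivation_det.
have cofE i j : \sum_k iota (M i k) * iota (cofactor M j k) = (i == j)%:R * iota (\det M).
  have /matrixP/(_ i j) := mul_mx_adj M; rewrite !mxE => e.
  rewrite mulr_natl -raddfMn /= -e rmorph_sum; apply: eq_bigr => k _.
  by rewrite -rmorphM !mxE.
have cofE' i j : \sum_k iota (M k i) * iota (cofactor M k j) = (i == j)%:R * iota (\det M).
  have /matrixP/(_ j i) := mul_adj_mx M; rewrite !mxE eq_sym => e.
  rewrite mulr_natl -raddfMn /= -e rmorph_sum; apply: eq_bigr => k _.
  by rewrite -rmorphM !mxE mulrC.
(* The hypothesis is multiplied by the cofactors and summed over [k] and [j]; the orthogonality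
   relations for rows and for columns then produce the two traces. *)
transitivity (\sum_k \sum_j (\sum_i N k i * iota (M i j)) * iota (cofactor M k j)); last first.
  rewrite [RHS]mulr_suml; apply: eq_bigr => k _.
  transitivity (\sum_i N k i * ((i == k)%:R * iota (\det M))).
    under eq_bigr => j _ do rewrite mulr_suml.
    rewrite exchange_big; apply: eq_bigr => i _; rewrite -cofE mulr_sumr.
    by apply: eq_bigr => j _; rewrite mulrA.
  rewrite (bigD1 k) //= eqxx mul1r big1 ?addr0 // => i /negPf->.
  by rewrite mul0r mulr0.
under [RHS]eq_bigr => k _ do under eq_bigr => j _ do rewrite -eM mulrDl.
under [RHS]eq_bigr => k _ do rewrite big_split /=.
rewrite big_split /=; congr (_ + _).
transitivity (\sum_j \sum_i D i j * ((i == j)%:R * iota (\det M))).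
  rewrite mulr_suml; apply: eq_bigr => j _.
  rewrite (bigD1 j) //= eqxx mul1r big1 ?addr0 // => i /negPf->.
  by rewrite mul0r mulr0.
rewrite [RHS]exchange_big; apply: eq_bigr => j _ /=.
under [RHS]eq_bigr => k _ do rewrite mulr_suml.
rewrite [RHS]exchange_big; apply: eq_bigr => i _; rewrite -cofE' mulr_sumr.
by apply: eq_bigr => k _; rewrite [in RHS]iotaC mulrA.
Qed.

End DeterminantDerivation.

(** * The commutative ring of even Grassmann elements *)

Section EvenPart.
Variables (K : fieldType) (q : nat).
Local Notation Lam := (dsym K q).

Definition dsym_even : {pred Lam} := fun f => [forall A : {set 'I_q}, odd #|A| ==> (f A == 0)].

Lemma dsym_evenP f : reflect (dhomog false f) (f \in dsym_even).
Proof.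
apply: (iffP forallP) => hf A.
  by rewrite eqbF_neg negbK => oA; apply/eqP; have := hf A; rewrite oA.
by apply/implyP => oA; rewrite hf // oA.
Qed.

Lemma dsym_even_subring : subring_closed dsym_even.
Proof.
split=> [|f g /dsym_evenP hf /dsym_evenP hg|f g /dsym_evenP hf /dsym_evenP hg]; apply/dsym_evenP.
- exact: dhomog1.
- by rewrite -scaleN1r; apply/dhomogD/dhomogZ.
- exact: dhomogM hf hg.
Qed.

HB.instance Definition _ := GRing.isSubringClosed.Build Lam dsym_even dsym_even_subring.

Record even_part := EvenPart {even_val : Lam; _ : even_val \in dsym_even}.
HB.instance Definition _ := [isSub for even_val].
HB.instance Definition _ := [Choice of even_part by <:].
HB.instance Definition _ := [SubChoice_isSubNzRing of even_part by <:].

Lemma even_val_homog (r : even_part) : dhomog false (val r).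
Proof. by apply/dsym_evenP; case: r. Qed.

Lemma even_val_comm (r : even_part) f : val r * f = f * val r.
Proof.
rewrite [f]dsym_expand mulr_sumr mulr_suml; apply: eq_bigr => A _.
by rewrite -scalerAr -scalerAl (dsym_supercomm (even_val_homog r) (@dhomog_mon K q A)) scale1r.
Qed.

Lemma even_part_mulC : commutative (@GRing.mul even_part).
Proof. by move=> r s; apply: val_inj; rewrite !rmorphM even_val_comm. Qed.

HB.instance Definition _ := GRing.PzRing_hasCommutativeMul.Build even_part even_part_mulC.

End EvenPart.

(** * The invariant density *)

Section InvariantDensity.
Variables (K : fieldType) (charK0 : [pchar K] =i pred0) (g : lieSuperalgebra K).
Variables (q : nat) (e : q.-tuple g) (e_basis : basis_of (odd_part g) e).
Hypothesis str0 : forall a : g, homog (lie_gr g) false a -> str_odd e (lie a) = 0.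
Local Notation Lam := (dsym K q).
Local Notation x_ A := (dsym_mon K A).
Local Notation G := (lie_gr g).
Implicit Types (f h : Lam).

Definition aug f : K := f set0.

Lemma aug_zmod_morphism : zmod_morphism aug.
Proof. by move=> f h; rewrite /aug !ffunE. Qed.

Lemma aug_monoid_morphism : monoid_morphism aug.
Proof. by split=> [|f h]; rewrite /aug ?dsym_mul_set0 // -dsym_mon0 ffunE eqxx. Qed.

HB.instance Definition _ := GRing.isZmodMorphism.Build Lam K aug aug_zmod_morphism.
HB.instance Definition _ := GRing.isMonoidMorphism.Build Lam K aug aug_monoid_morphism.

Lemma fil_exp n f : fil 1 f -> fil n (f ^+ n).
Proof.
move=> hf; elim: n => [|n IHn]; first by move=> A.
by rewrite exprS -add1n; apply: fil_mul.
Qed.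

(** 1 - f is nilpotent. The explicit series also shows that the inverse of an even element is
    even. *)
Lemma dsym_invE f : aug f = 1 -> f^-1 = \sum_(k < q.+1) (1 - f) ^+ k /\ f \is a GRing.unit.
Proof.
move=> f0; set h := \sum_(k < _) _.
have fn : fil 1 (1 - f).
  move=> A; rewrite ltnS leqn0 cards_eq0 => /eqP->.
  by rewrite -[LHS]/(aug (1 - f)) rmorphB rmorph1 /= f0 subrr.
have n0 : (1 - f) ^+ q.+1 = 0.
  apply/ffunP=> A; rewrite (fil_exp (n := q.+1) fn) ?ffunE //.
  by rewrite ltnS -[X in (_ <= X)%N]card_ord max_card.
have fh : f * h = 1.
  have := subrX1 (1 - f) q.+1; rewrite n0 sub0r -/h addrAC subrr add0r mulNr.
  by move/oppr_inj.
have hf : h * f = 1.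
  rewrite -fh /h mulr_suml mulr_sumr; apply: eq_bigr => k _.
  have : GRing.comm f (1 - f) by apply: commrB; [apply: commr1 | apply: commr_refl].
  by move/(commrX k).
have uf : f \is a GRing.unit by apply/unitrP; exists h.
by split=> //; apply: (mulrI uf); rewrite fh divrr.
Qed.

Let M := Mx e.

Let dM : \det (odd_matrix e (sinhc_ad e)) = \det M.
Proof. by rewrite odd_matrix_sinhc. Qed.

Lemma even_entry i j : M i j \in @dsym_even K q.
Proof. by apply/dsym_evenP; apply: dhomog_Mx. Qed.

Let M' : 'M[even_part K q]_q := \matrix_(i, j) EvenPart (even_entry i j).
Let iota : {rmorphism even_part K q -> Lam} := val.

Let dM' : \det M = iota (\det M').
Proof.
rewrite -(det_map_mx iota); congr (\det _).
by apply/matrixP=> i j; rewrite [RHS]mxE [in RHS]mxE.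
Qed.

Let det_set0 : aug (\det M) = 1.
Proof.
rewrite -det_map_mx -[RHS](det1 K q); congr (\det _).
by apply/matrixP=> i j; rewrite mxE [RHS]mxE; apply: Mx_set0.
Qed.

Lemma J2E : J2 e = (\det M)^-1 /\ \det M \is a GRing.unit.
Proof. by rewrite /J2 /Ber_odd dM; have [_ ->] := dsym_invE det_set0. Qed.

Lemma dhomog_J2 : dhomog false (J2 e).
Proof.
rewrite J2E.1 (dsym_invE det_set0).1; apply/dsym_evenP; rewrite rpred_sum // => k _.
by rewrite rpredX // rpredB ?rpred1 // dM'; apply: valP.
Qed.

Lemma J2_set0 : aug (J2 e) = 1.
Proof.
by have := congr1 aug (mulrV J2E.2); rewrite rmorphM rmorph1 /= -J2E.1 det_set0 mul1r.
Qed.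

(** As [N] is traceless, Liouville's formula makes the logarithmic derivative of det M minus the
    divergence, up to (-1)^b; passing to the inverse changes the sign. *)
Lemma J2_divergence b a : homog G b a ->
  (-1) ^+ b *: Xf e a (J2 e) = J2 e * \sum_i pderiv i (xif e a i).
Proof.
move=> ha; have sX := Xf_superderivation e_basis ha.
pose delta : {additive Lam -> Lam} := ((-1) ^+ b \*: Xf e a).
have deltaM f h : dhomog false f -> delta (f * h) = delta f * h + f * delta h.
  move=> hf; rewrite /delta /= (sX.2 _ _ _ hf) andbF scale1r scalerDr.
  by rewrite scalerAl scalerAr.
have deltaM' r s : delta (iota (r * s)) = delta (iota r) * iota s + delta (iota s) * iota r.
  rewrite rmorphM deltaM; last exact: even_val_homog.
  by rewrite [iota r * delta _]even_val_comm.
have [N [trN jac]] := jacobian_matrix charK0 e_basis str0 ha.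
have jac' k j : delta (iota (M' k j)) + \sum_i iota (M' k i) * pderiv j (xif e a i)
    = \sum_i N k i * iota (M' i j).
  rewrite !mxE /=; have := jac k j; rewrite /delta /= => e1.
  under eq_bigr => i _ do rewrite mxE.
  under [RHS]eq_bigr => i _ do rewrite mxE.
  exact: e1.
have := derivation_det_trace (@even_val_comm K q) deltaM' jac'.
rewrite trN mul0r -dM' => /eqP; rewrite addr_eq0 => /eqP dd.
have [JE uM] := J2E; have : delta (\det M * J2 e) = 0.
  rewrite JE divrr // /delta /= (superderivation1 sX) ?scaler0 //.
rewrite deltaM; last by rewrite dM'; apply: even_val_homog.
rewrite dd mulNr addrC => /eqP; rewrite subr_eq0 => /eqP e2.
apply: (mulrI uM); rewrite -[_ *: _]/(delta (J2 e)) e2 JE.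
rewrite -mulrA divrr // mulr1 mulrA divrr ?mul1r //.
Qed.

(** Integration by parts for the Berezin integral, that is the coefficient at [setT]: a derivative
    has no top term. *)
Lemma top_mul_pderiv f i h b : dhomog b f ->
  (pderiv i f * h) setT = - ((-1) ^+ b * (f * pderiv i h) setT).
Proof.
move=> hf; have top0 (k : Lam) : pderiv i k setT = 0.
  by rewrite ffunE mul_sign_eq0 ?mul0r // disjoints1 inE.
have := top0 (f * h); rewrite (pderivM _ _ hf) ffunE => /eqP.
by rewrite addr_eq0 => /eqP->; rewrite [X in - X]ffunE.
Qed.

(** Integration by parts moves the derivatives onto J_2 X_a(x_i), and the sum of d/dx_i (J_2
    X_a(x_i)) vanishes by [J2_divergence]. *)
Lemma J2_invariant b a f : homog G b a -> (J2 e * Xf e a f) setT = 0.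
Proof.
move=> ha; have hJ := dhomog_J2; have hxi i := dhomog_xif e_basis i ha.
have e1 i : (J2 e * (xif e a i * pderiv i f)) setT =
    (-1) ^+ b * (pderiv i (J2 e * xif e a i) * f) setT.
  rewrite mulrA (top_mul_pderiv _ _ (dhomogM hJ (hxi i))) addFb mulrN mulrA -signr_addb.
  by case: (b); rewrite /= ?mulN1r ?opprK ?mul1r.
have sumE (F : 'I_q -> Lam) : (\sum_i F i) setT = \sum_i F i setT by rewrite sum_ffunE.
rewrite /Xf /vecfield mulr_sumr sumE (eq_bigr _ (fun i _ => e1 i)) -mulr_sumr.
rewrite -sumE -mulr_suml (_ : \sum_i _ = 0) ?mul0r ?ffunE ?mulr0 //.
under eq_bigr => i _ do rewrite (pderivM _ _ hJ) expr0 scale1r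
  (dsym_supercomm (dhomog_pderiv i hJ) (hxi i)) andTb.
rewrite big_split /= -scaler_sumr -mulr_sumr -(J2_divergence ha).
by rewrite signrN scaleNr addNr.
Qed.

End InvariantDensity.

(** * Antisymmetrized products *)

Section Antisymmetrization.
Variable R : pzRingType.

(** Letters are indexed by [nat], so that removing one of them is composition with [bump], without
    casts. *)
Definition alt n (r : nat -> R) := \sum_(s : 'S_n) (-1) ^+ s * \prod_(i < n) r (s i).

Lemma alt0 r : alt 0 r = 1.
Proof.
rewrite /alt (bigD1 1%g) //= [X in _ + X]big1 ?addr0 => [|s /eqP s1].
  by rewrite odd_perm1 big_ord0 mulr1.
by case: s1; apply/permP=> -[].
Qed.

Lemma eq_alt n r r' : (forall i, (i < n)%N -> r i = r' i) -> alt n r = alt n r'.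
Proof. by move=> er; apply: eq_bigr => s _; congr (_ * _); apply: eq_bigr => i _; apply: er. Qed.

(** The permutations sending 0 to k are the [lift_perm ord0 k s], whose signature is (-1)^k times
    that of s. *)
Lemma alt_recl n r :
  alt n.+1 r = \sum_(k < n.+1) (-1) ^+ k * (r k * alt n (fun j => r (bump k j))).
Proof.
rewrite /alt (partition_big (fun s : 'S_n.+1 => s ord0) xpredT) //=; apply: eq_bigr => k _.
rewrite (reindex (lift_perm ord0 k)) /=; last first.
  have fP (s : 'S_n.+1) m : exists m', s (lift ord0 m) == lift (s ord0) m'.
    have : s ord0 != s (lift ord0 m) by rewrite (inj_eq perm_inj) neq_lift.
    by case/unlift_some=> m' e _; exists m'; apply/eqP.
  pose f (s : 'S_n.+1) m := xchoose (fP s m).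
  have fE (s : 'S_n.+1) m : s (lift ord0 m) = lift (s ord0) (f s m).
    exact/eqP/(xchooseP (fP s m)).
  have f_inj s : injective (f s).
    by move=> m m' e; apply: (@lift_inj _ ord0); apply: (@perm_inj _ s); rewrite !fE e.
  exists (fun s => perm (f_inj s)) => [s _ | s /eqP sk]; apply/permP=> m.
    rewrite permE; have := fE (lift_perm ord0 k s) m.
    by rewrite lift_perm_lift lift_perm_id => /lift_inj.
  case: (unliftP ord0 m) => [m'|] ->; last by rewrite lift_perm_id.
  by rewrite lift_perm_lift permE fE sk.
rewrite mulr_sumr mulr_sumr; apply: eq_big => [s|s _]; first by rewrite lift_perm_id eqxx.
rewrite odd_lift_perm big_ord_recl lift_perm_id /= signr_addb signr_odd.
have comm_sign (b : bool) x : x * (-1) ^+ b = (-1) ^+ b * x :> R.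
  by case: b; rewrite ?expr0 ?expr1 ?mulrN1 ?mulN1r ?mulr1 ?mul1r.
rewrite -mulrA; congr (_ * _); rewrite mulrA -(comm_sign s) -mulrA; congr (_ * (_ * _)).
by apply: eq_bigr => i _; rewrite lift_perm_lift.
Qed.

Lemma alt_rec n r : (0 < n)%N ->
  alt n r = \sum_(k < n) (-1) ^+ k * (r k * alt n.-1 (fun j => r (bump k j))).
Proof. by case: n => // n _; apply: alt_recl. Qed.

End Antisymmetrization.

Lemma nth_enum_bump (q : nat) (x0 : 'I_q) (A : {set 'I_q}) (k : 'I_#|A|) j :
  (j < #|A|.-1)%N -> nth x0 (enum A) (bump k j) = nth x0 (enum (A :\ enum_val k)) j.
Proof.
move=> ltj; have -> : enum (A :\ enum_val k) = rem (enum_val k) (enum A).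
  rewrite rem_filter ?enum_uniq // /enum_mem -!filter_predI.
  by apply: eq_filter => i; rewrite !inE.
rewrite (enum_val_nth x0); set s := enum A.
have us : uniq s by apply: enum_uniq.
have ltk : (k < size s)%N by rewrite -cardE.
have es : s = take k s ++ nth x0 s k :: drop k.+1 s by rewrite -drop_nth // cat_take_drop.
have -> : rem (nth x0 s k) s = take k s ++ drop k.+1 s.
  rewrite {2}es remE index_cat; have := us;
    rewrite {1}es cat_uniq /= negb_or => /and3P[_ /andP[nt _] _].
  rewrite (negPf nt) /= eqxx addn0 take_size_cat // -cat_rcons drop_size_cat //.
  by rewrite size_rcons.
rewrite {1}es !nth_cat size_take ltk /bump; case: (leqP k j) => lekj.
  by rewrite /= add1n ltnNge (leqW lekj) /= subSn.
by rewrite add0n lekj.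
Qed.

Lemma card_lt_enum_val (q : nat) (A : {set 'I_q}) (k : 'I_#|A|) :
  #|[set b in A | (b < enum_val k)%N]| = k.
Proof.
have sA : sorted ltn (map val (enum A)).
  apply: (subseq_sorted ltn_trans (s2 := map val (enum 'I_q))).
    have -> : enum A = filter (mem A) (enum 'I_q) by rewrite enumT.
    by apply: map_subseq; apply: filter_subseq.
  by rewrite val_enum_ord iota_ltn_sorted.
have ltk : (k < size (map val (enum A)))%N by rewrite size_map -cardE.
rewrite -[RHS](Order.POrderTheory.count_lt_nth 0%N sA ltk) count_map.
rewrite (enum_val_nth (enum_val k)) (nth_map (enum_val k)) -?cardE // -size_filter cardE;
  congr size.
by rewrite /enum_mem -filter_predI; apply: eq_filter => b; rewrite !inE andbC.
Qed.

(** Exactly [k] elements of [A] lie below [enum_val k], and each costs one sign on the way to the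
    front. *)
Lemma mon_sign_enum_val (K : fieldType) (q : nat) (A : {set 'I_q}) (k : 'I_#|A|) :
  mon_sign K [set enum_val k] (A :\ enum_val k) = (-1) ^+ k.
Proof.
rewrite /mon_sign big_set1 -(card_lt_enum_val k) -prodr_const.
rewrite (bigID (fun b : 'I_q => b < enum_val k)%N) /= [X in _ * X]big1 ?mulr1 => [|b /andP[]].
  apply: eq_big => b; rewrite !inE; first last.
    by case/andP=> /andP[/negPf nb _] ->; rewrite eq_sym nb.
  have [lt_ba|] := ltnP b (enum_val k); rewrite ?andbF // !andbT.
  by rewrite -val_eqE neq_ltn lt_ba.
by rewrite !inE => /andP[/negPf nb _] /negPf ->; rewrite eq_sym nb.
Qed.

(** * The exponential of the generic point *)

Section Exponential.
Variables (K : fieldType) (charK0 : [pchar K] =i pred0) (g : lieSuperalgebra K).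
Variables (q : nat) (e : q.-tuple g) (e_basis : basis_of (odd_part g) e).
Variable U : envelopingAlgebra g.
Local Notation Lam := (dsym K q).
Local Notation x_ A := (dsym_mon K A).
Local Notation T W := {ffun {set 'I_q} -> W}.
Local Notation G := (lie_gr g).
Local Notation GU := (salg_gr U).
Local Notation iota := (uea_in U).
Local Notation cst a := (tens (q := q) a 1).
Implicit Types (a x : g) (u v : U).

Definition umul x u : U := iota x * u.

Lemma umul_bilinear : bilinear_for
  (GRing.Scale.Law.clone _ _ *:%R _) (GRing.Scale.Law.clone _ _ *:%R _) umul.
Proof.
split=> [w|w] k u v /=; first by rewrite /umul linearP mulrDl scalerAl.
by rewrite /umul mulrDr scalerAr.
Qed.

HB.instance Definition _ := bilinear_isBilinear.Build K g U U _ _ umul umul_bilinear.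

Lemma umul_parity : parity_preserving G GU GU umul.
Proof.
by move=> b c x u hx hu; apply: salg_homogM hu; apply: (uea_morph U).1.
Qed.

Lemma umul_lie b c x y u : homog G b x -> homog G c y ->
  umul x (umul y u) = umul (lie x y) u + (-1) ^+ (b && c) *: umul y (umul x u).
Proof.
move=> hx hy; rewrite /umul ((uea_morph U).2 _ _ _ _ hx hy) mulrBl -scalerAl !mulrA.
by rewrite subrK.
Qed.

Lemma grparM u v : grpar GU (u * v) = grpar GU u * grpar GU v.
Proof.
have homM b c w w' : homog GU b w -> homog GU c w' -> grpar GU (w * w') = grpar GU w * grpar GU
  w'.
  move=> hw hw'; rewrite (grpar_homog (salg_homogM hw hw')) (grpar_homog hw) (grpar_homog hw').
  by rewrite -scalerAl -scalerAr scalerA -signr_addb.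
have homMr b w : homog GU b w -> grpar GU (w * v) = grpar GU w * grpar GU v.
  move=> hw; rewrite -[in LHS](gr_sum GU v) mulrDr linearD /=.
  by rewrite !(homM _ _ _ _ hw (homog_gr _ _ _)) -mulrDr -linearD gr_sum.
rewrite -[in LHS](gr_sum GU u) mulrDl linearD /=.
by rewrite !(homMr _ _ (homog_gr _ _ _)) -mulrDl -linearD gr_sum.
Qed.

Definition ub := bext (q := q) GU umul.
HB.instance Definition _ := Bilinear.on ub.

Definition ell := ub (zpt e).

Lemma ell_linear : linear ell.
Proof. by move=> k u v; rewrite /ell linearPr. Qed.

HB.instance Definition _ := GRing.isLinear.Build K (T U) (T U) _ ell ell_linear.

Lemma ell_ub (y : T g) (w : T U) : ell (ub y w) = ub (adz e y) w + ub y (ell w).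
Proof. exact: bext_lie umul_parity umul_lie _ _ _ (tpar_zpt e_basis). Qed.

Lemma fil_iter_ell n (w : T U) : fil n (iter n ell w).
Proof.
elim: n => [|n IHn] //=; rewrite -add1n; apply: fil_bext IHn; exact: fil_zpt.
Qed.

Lemma tpar_ell (w : T U) : tpar GU false w -> tpar GU false (ell w).
Proof. exact: (tpar_bext umul_parity (tpar_zpt e_basis)). Qed.

Lemma tpar_unit : tpar GU false (cst (1 : U)).
Proof. by rewrite -[false]/(false (+) false);
  apply: (tpar_tens (salg_homog1 U) (@dhomog1 K q)). Qed.

Lemma ell_coef (w : T U) A : tpar GU false w ->
  ell w A = (2%:R : K)^-1 *: \sum_(i in A) mon_sign K [set i] (A :\ i) *: (iota e`_i * w (A :\
    i)).
Proof.
move=> hw; rewrite /ell zptE /ub linearZl_LR linear_sumlz /= ffunE sum_ffunE; congr (_ *: _).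
rewrite [RHS]big_mkcond; apply: eq_bigr => i _.
rewrite {1}(tens_expand w) linear_sumr sum_ffunE /=.
have term B : bext GU umul (tens e`_i (x_ [set i])) (tens (w B) (x_ B)) A =
    if i |: B == A then mon_sign K [set i] B *: (iota e`_i * w B) else 0.
  rewrite bext_mon cards1 /= (grpar_homog (hw B)) dsym_monM !ffunE eq_sym.
  case: eqP => _; last by rewrite scaler0 scale0r.
  rewrite linearZr_LR /umul /= scalerA; congr (_ *: _).
  rewrite -[_ *: 1]/(_ * 1) mulr1 /mul_sign cards1 mul1n mulrAC signr_odd -expr2 sqrr_sign.
  by rewrite mul1r.
rewrite (eq_bigr _ (fun B _ => term B)); have [iA|iA] := boolP (i \in A); last first.
  by rewrite big1 // => B _; case: eqP => // eA; rewrite -eA !inE eqxx in iA.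
rewrite (bigD1 (A :\ i)) //= setD1K // eqxx big1 ?addr0 // => B nB; case: eqP => // eA.
have [iB|iB] := boolP (i \in B); last by rewrite -eA setU1K ?eqxx in nB.
have -> : mon_sign K [set i] B = 0; last by rewrite scale0r.
by rewrite /mon_sign big_set1 (bigD1 i) //= eqxx mul0r.
Qed.

Definition alt_set (A : {set 'I_q}) : U := #|A|`!%:R *: beta_mon U e A.

Definition odd_word (A : {set 'I_q}) : nat -> U := nth 0 [seq iota e`_i | i : 'I_q <- enum A].

Lemma odd_wordE (x0 : 'I_q) (A : {set 'I_q}) k : (k < #|A|)%N ->
  odd_word A k = iota e`_(nth x0 (enum A) k).
Proof. by move=> ltk; rewrite /odd_word (nth_map x0) -?cardE. Qed.

Lemma alt_setE (A : {set 'I_q}) : alt_set A = alt #|A| (odd_word A).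
Proof.
rewrite /alt_set /beta_mon scalerA mulfV ?factK_neq0 // scale1r.
apply: eq_bigr => s _; congr (_ * _); apply: eq_bigr => i _.
by rewrite (odd_wordE (enum_val (s i))) // -enum_val_nth.
Qed.

(** Expansion along the first letter. The signs are those of [ell_coef], so the powers of z satisfy
    the same recursion. *)
Lemma alt_set_rec (A : {set 'I_q}) : (0 < #|A|)%N ->
  alt_set A = \sum_(i in A) mon_sign K [set i] (A :\ i) *: (iota e`_i * alt_set (A :\ i)).
Proof.
move=> A0; rewrite big_enum_val alt_setE alt_rec //; apply: eq_bigr => k _.
rewrite mon_sign_enum_val alt_setE -signr_odd mulr_sign -[in RHS]signr_odd scaler_sign.
have -> : #|A :\ enum_val k| = #|A|.-1 by rewrite (cardsD1 (enum_val k) A) enum_valP.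
rewrite (odd_wordE (enum_val k)) // -enum_val_nth.
have -> // : alt #|A|.-1 (fun j => odd_word A (bump k j)) = alt #|A|.-1 (odd_word (A :\ enum_val
  k)).
apply: eq_alt => i lti; have lti' : (i < #|A :\ enum_val k|)%N.
  by move: lti; rewrite (cardsD1 (enum_val k) A) enum_valP.
rewrite !(odd_wordE (enum_val k)) ?nth_enum_bump //.
by apply: leq_ltn_trans (_ : i.+1 < _)%N; [rewrite /bump -[i.+1]add1n leq_add2r leq_b1 | rewrite
  -ltn_predRL].
Qed.

Lemma iter_ell_coef n (A : {set 'I_q}) :
  iter n ell (cst 1) A = if #|A| == n then (2%:R ^- n : K) *: alt_set A else 0.
Proof.
elim: n A => [|n IHn] A.
  rewrite ffunE cards_eq0 -dsym_mon0 ffunE; case: eqP => [->|_]; last by rewrite scale0r.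
  by rewrite expr0 invr1 alt_setE cards0 alt0.
have tn : tpar GU false (iter n ell (cst 1)).
  by elim: n {IHn} => [|n IHn]; [apply: tpar_unit | apply: tpar_ell].
rewrite /= ell_coef //; have [cA|nA] := eqVneq #|A| n.+1; last first.
  rewrite big1 ?scaler0 // => i iA; rewrite IHn.
  case: eqP => [ci|_]; last by rewrite mulr0 scaler0.
  by move: nA; rewrite (cardsD1 i A) iA ci eqxx.
rewrite alt_set_rec ?cA // !scaler_sumr; apply: eq_bigr => i iA.
rewrite IHn; have -> : #|A :\ i| == n by move: cA; rewrite (cardsD1 i A) iA add1n => -[->].
by rewrite -scalerAr !scalerA exprS invfM; congr (_ *: _); ring.
Qed.

Local Notation e2 := (expp (2 * q.+2) (2%:R : K)).
(* e^y, as ell is the multiplication by y / 2 *)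
Definition expy : T U := pact ell e2 (cst 1).

(** The anticommuting x_i antisymmetrize the powers of z by themselves: the coefficient of z^n at
    [A], for |A| = n, is n! beta(e_A) / 2^n, and the factor 2^n/n! of e^(2z) restores beta(e_A). *)
Lemma expyE (A : {set 'I_q}) : expy A = beta_mon U e A.
Proof.
rewrite /expy (@pactE _ _ ell (2 * q.+2)) ?size_poly // sum_ffunE.
have ltA : (#|A| < 2 * q.+2)%N.
  apply: leq_ltn_trans (max_card _) _; rewrite card_ord mul2n -addnn addSn ltnS.
  exact: leq_trans (leqnSn q) (leq_addr _ _).
rewrite (bigD1 (Ordinal ltA)) //= big1 ?addr0 => [|k nk]; last first.
  rewrite ffunE iter_ell_coef; case: eqP => [ek|_]; last by rewrite scaler0.
  by move: nk; rewrite -val_eqE /= -ek eqxx.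
rewrite ffunE iter_ell_coef eqxx coef_poly ltA /alt_set 2!scalerA.
rewrite -[RHS]scale1r; congr (_ *: _).
have := factK_neq0 charK0 #|A|; have : 2%:R ^+ #|A| != 0 :> K by rewrite expf_neq0 ?half2.
by move=> nz1 nz2; rewrite -mulrA mulrACA mulfV // mulVf // mulr1.
Qed.

(** Right multiplication by a constant, which has to pass x_A. *)
Definition rmulU (v : U) (w : T U) : T U := [ffun A => w A * iter #|A| (grpar GU) v].

Lemma rmulU_linear v : linear (rmulU v).
Proof. by move=> k w w'; apply/ffunP=> A; rewrite !ffunE mulrDl scalerAl. Qed.

HB.instance Definition _ v := GRing.isLinear.Build K (T U) (T U) _ (rmulU v) (rmulU_linear v).

Lemma ell_rmulU v w : rmulU v (ell w) = ell (rmulU v w).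
Proof.
have iterM n u u' : iter n (grpar GU) (u * u') = iter n (grpar GU) u * iter n (grpar GU) u'.
  by elim: n => //= n ->; rewrite grparM.
rewrite /ell /ub (tens_expand (zpt e)) !linear_sumlz linear_sum; apply: eq_bigr => A _ /=.
elim/(tens_ind q GU): w => [|w w' IH IH'|b u B hu]; first by rewrite !(linear0, linear0r).
  by rewrite !(linearD, linearDr) /= IH IH'.
have -> : rmulU v (tens u (x_ B)) = tens (u * iter #|B| (grpar GU) v) (x_ B).
  apply/ffunP=> D; rewrite !ffunE; case: eqP => [->|_]; last by rewrite !scale0r mul0r.
  by rewrite !scale1r.
rewrite !bext_mon; apply/ffunP=> D; rewrite [LHS]ffunE [X in X * _]ffunE [RHS]ffunE -scalerAl.
have [->|/dsym_monM_neq0 cD] := eqVneq ((x_ A * x_ B) D) 0; first by rewrite !scale0r.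
congr (_ *: _); rewrite /umul (iterM #|A| u) -iterD -cD.
exact: (esym (mulrA _ _ _)).
Qed.

Lemma ub_cst a u : ub (cst a) (cst u) = cst (iota a * u).
Proof. by rewrite /ub -dsym_mon0 bext_mon cards0 /= mulr1. Qed.

Lemma rmulU_cst v u : rmulU v (cst u) = cst (u * v).
Proof.
apply/ffunP=> A; rewrite -dsym_mon0 !ffunE; case: eqP => [->|_]; last by rewrite !scale0r mul0r.
by rewrite !scale1r cards0.
Qed.

Lemma rmulU_pact p v w : rmulU v (pact ell p w) = pact ell p (rmulU v w).
Proof. by apply: pact_commute; apply: ell_rmulU. Qed.

Lemma dlift_Xf_ell b a (w : T U) : homog G b a ->
  dlift GU b (Xf e a) (ell w) = ub (Vf e a) w + ell (dlift GU b (Xf e a) w).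
Proof.
move=> ha; have sX := Xf_superderivation e_basis ha.
rewrite /ell /ub (dlift_bext _ umul_parity sX (tpar_zpt e_basis)) andbF scale1r.
by rewrite (dlift_Xf_zpt charK0 e_basis ha).
Qed.

Lemma dlift_Xf_one b a : homog G b a -> dlift GU b (Xf e a) (cst 1) = 0.
Proof.
move=> ha; rewrite (dlift_tens _ (Xf e a) _ (salg_homog1 U)).
by rewrite (superderivation1 (Xf_superderivation e_basis ha)) tens0r scaler0.
Qed.

(** X_a and left multiplication by [a] have the same commutator with [ell]; on e^y they differ only
    through their values on 1, which are 0 and a. *)
Lemma dlift_expy_even a : homog G false a ->
  dlift GU false (Xf e a) expy = ub (cst a) expy - rmulU (iota a) expy.
Proof.
move=> ha; have [D DE] := ex_divided_diff e2.
pose d : {linear T U -> T U} := dlift GU false (Xf e a).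
have dell w : d (ell w) = ub (Vf e a) w + ell (d w) by apply: dlift_Xf_ell.
pose B : {bilinear T g -> T U -> T U} := ub.
pose d' : {linear T U -> T U} := B (cst a).
have d'ell w : d' (ell w) = ub (Vf e a) w + ell (d' w).
  rewrite (Vf_even e ha) /d' /=.
  by apply: (bext_lie umul_parity umul_lie); apply: tpar_cst.
rewrite -[LHS]/(d _) -[ub _ expy]/(d' _) /expy.
rewrite (pact_derivation ell_ub _ dell DE) (pact_derivation ell_ub _ d'ell DE).
have -> : d (cst 1) = 0 by apply: dlift_Xf_one.
have -> : d' (cst 1) = rmulU (iota a) (cst 1).
  by rewrite rmulU_cst /d' /= ub_cst mulr1 mul1r.
by rewrite linear0 addr0 rmulU_pact addrK.
Qed.

Lemma ub_low m (P : {poly {poly K}}) (u : T g) (w : T U) : low m P -> (q < m)%N ->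
  pact2 (adz e) ell ub u w P = 0.
Proof.
move=> lP lt_qm; apply: pact2_low lP => i j le_ij; apply: fil_ge => A ltA.
have hi : fil i (iter i (adz e) u) by rewrite -[i in fil i]addn0; apply: fil_iter_adz.
apply: (fil_bext GU _ hi (@fil_iter_ell j w)).
by rewrite (leq_trans ltA) // (leq_trans lt_qm).
Qed.

(** All terms are symbols on the pair (Q(ad z) a, 1): X_a e^y is the divided difference of e^(2x)
    times cosh Y, while right and left multiplication by [a] give e^(2(X+Y)) S(Y) and e^(2X) S(Y).
    They balance by [exp_identity]. *)
Lemma dlift_expy_odd a : homog G true a ->
  dlift GU true (Xf e a) expy = ub (cst a) expy + rmulU (iota a) expy.
Proof.
move=> ha; have [D DE] := ex_divided_diff e2.
pose d : {linear T U -> T U} := dlift GU true (Xf e a).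
have dell w : d (ell w) = ub (Vf e a) w + ell (d w) by apply: dlift_Xf_ell.
rewrite -[LHS]/(d _) {1}/expy (pact_derivation ell_ub _ dell DE).
have -> : d (cst 1) = 0 by apply: dlift_Xf_one.
rewrite linear0 addr0 (Vf_odd e ha) -pact2MC.
set a' := pact (adz e) (shc_inv K q) (cst a).
have eS : cst a = pact (adz e) (shc K q.+2) a' by rewrite /a' -pactM pact_shcK.
have -> : rmulU (iota a) expy = pact2 (adz e) ell ub a' (cst 1) (poly_XaY e2 * (shc K q.+2)%:P).
  by rewrite rmulU_pact rmulU_cst mul1r mulrC (pact2MXaY ell_ub) pact2C -eS /= ub_cst mulr1.
have -> : ub (cst a) expy = pact2 (adz e) ell ub a' (cst 1) (e2^:P * (shc K q.+2)%:P).
  by rewrite eS mulrC pact2M pact2C.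
apply: subr0_eq; rewrite -pact2D -pact2B; apply: ub_low (_ : low (2 * q.+1) _) _; last first.
  by rewrite mul2n -addnn addSn ltnS leq_addr.
apply: low_eq (exp_identity charK0 DE) _.
by rewrite mulrDl [e2^:P * _ + _]addrC.
Qed.

End Exponential.

(** * Twisted adjoint invariance *)

Section Invariance.
Variables (K : fieldType) (charK0 : [pchar K] =i pred0) (g : lieSuperalgebra K).
Variables (q : nat) (e : q.-tuple g) (e_basis : basis_of (odd_part g) e).
Hypothesis str0 : forall a : g, homog (lie_gr g) false a -> str_odd e (lie a) = 0.
Variable U : envelopingAlgebra g.
Local Notation Lam := (dsym K q).
Local Notation x_ A := (dsym_mon K A).
Local Notation G := (lie_gr g).
Local Notation GU := (salg_gr U).
Local Notation iota := (uea_in U).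
Implicit Types (a x : g) (u v : U).

Lemma beta_mon_homog (A : {set 'I_q}) : homog GU (odd #|A|) (beta_mon U e A).
Proof.
rewrite -(expyE charK0 e_basis U); suff : tpar GU false (expy e U) by apply.
apply: pact_stable => [||k v|k]; [exact: tpar0|exact: tparD|exact: tparZ|].
by elim: k => [|k IHk]; [apply: tpar_unit | apply: tpar_ell].
Qed.

Lemma sigma0 : @sigma K g 0 = 0. Proof. exact: (linear0 (grpar G)). Qed.

Lemma ad'_homog b c a u : homog G b a -> homog GU c u ->
  ad' a u = iota a * u - (-1) ^+ (b && c) *: (u * iota ((-1) ^+ b *: a)).
Proof.
move=> ha hu; rewrite /ad' (bigD1 b) //= [X in _ + X]big1 ?addr0 => [|b' /negPf nb]; last first.
  by rewrite big1 // => c' _; rewrite (gr_homog _ ha) eq_sym nb sigma0 !linear0 mul0r mulr0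
    scaler0 subr0.
rewrite (bigD1 c) //= [X in _ + X]big1 ?addr0 => [|c' /negPf nc]; last first.
  by rewrite -[X in GU c' X]hu gr_orth eq_sym eq_sym nc mulr0 mul0r scaler0 subr0.
by rewrite ha hu -(grpar_homog ha).
Qed.

Lemma ad'_beta_mon b a (A : {set 'I_q}) : homog G b a ->
  ad' a (beta_mon U e A) = dlift GU b (Xf e a) (expy e U) A.
Proof.
move=> ha; have hA := beta_mon_homog A; rewrite (ad'_homog ha hA).
have ubE : ub (tens a 1) (expy e U) A = iota a * expy e U A.
  rewrite [in LHS](tens_expand (expy e U)) /ub linear_sumr sum_ffunE /=.
  rewrite (bigD1 A) //= big1 ?addr0 => [|B nBA].
    by rewrite -dsym_mon0 bext_mon cards0 mul1r !ffunE eqxx scale1r.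
  by rewrite -dsym_mon0 bext_mon cards0 mul1r !ffunE eq_sym (negPf nBA) scale0r.
have hia : homog GU b (iota a) by apply: (uea_morph U).1.
have rmE : rmulU (iota a) (expy e U) A =
    (-1) ^+ (b && odd #|A|) *: (expy e U A * iota a).
  by rewrite ffunE (iter_grpar_homog _ hia) andbC scalerAr.
case: b ha hia rmE => ha _ rmE.
  rewrite (dlift_expy_odd charK0 e_basis U ha) ffunE ubE rmE (expyE charK0 e_basis U).
  by rewrite expr1 scaleN1r linearN mulrN scalerN opprK.
rewrite (dlift_expy_even charK0 e_basis U ha) ffunE ubE [(- rmulU _ _) A]ffunE rmE.
by rewrite (expyE charK0 e_basis U) !scale1r.
Qed.

(* beta (J2 d) for d = sym_mon setT *)
Definition Tdens : U := \sum_(A : {set 'I_q}) (J2 e * x_ A) setT *: beta_mon U e A.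

Lemma ad'_linear a : linear (ad' (U := U) a).
Proof.
move=> k u v; rewrite /ad' scaler_sumr -big_split; apply: eq_bigr => b _ /=.
rewrite scaler_sumr -big_split; apply: eq_bigr => c _ /=.
rewrite linearP mulrDr mulrDl -scalerAr -scalerAl scalerBr scalerDr opprD addrACA.
by rewrite !scalerA mulrC.
Qed.

HB.instance Definition _ a := GRing.isLinear.Build K U U _ (ad' (U := U) a) (ad'_linear a).

(** The action on the beta(e_A) is the transpose of X_a on the monomials; so each beta(e_B) appears,
    up to sign, with the Berezin integral of J_2 X_a(x_B) as coefficient. *)
Lemma ad'_Tdens_homog b a : homog G b a -> ad' a Tdens = 0.
Proof.
move=> ha; rewrite /Tdens linear_sum.
have coefE (A : {set 'I_q}) : ad' a ((J2 e * x_ A) setT *: beta_mon U e A) =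
    \sum_(B : {set 'I_q}) ((J2 e * x_ A) setT * Xf e a (x_ B) A) *: iter b (grpar GU) (expy e U
      B).
  rewrite linearZ /= (ad'_beta_mon _ ha) sum_ffunE scaler_sumr; apply: eq_bigr => B _.
  by rewrite [tens _ _ A]ffunE scalerA.
rewrite (eq_bigr _ (fun A _ => coefE A)) exchange_big big1 // => B _.
rewrite -scaler_suml [X in X *: _](_ : _ = (J2 e * Xf e a (x_ B)) setT).
  by rewrite (J2_invariant charK0 e_basis str0 _ ha) scale0r.
rewrite [in RHS](dsym_expand (Xf e a (x_ B))) mulr_sumr sum_ffunE; apply: eq_bigr => A _.
by rewrite -scalerAr [RHS]ffunE; apply: mulrC.
Qed.

Lemma ad'_Tdens a : ad' a Tdens = 0.
Proof.
have -> : ad' a Tdens = \sum_b ad' (G b a) Tdens.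
  rewrite {1}/ad'; apply: eq_bigr => b _; rewrite /ad' [RHS](bigD1 b) //=.
  rewrite [X in _ = _ + X]big1 ?addr0 => [|b' /negPf nb]; last first.
    rewrite big1 // => c _.
    by rewrite gr_orth nb sigma0 !linear0 mul0r mulr0 scaler0 subr0.
  by apply: eq_bigr => c _; rewrite !gr_orth eqxx.
by apply: big1 => b _; apply: (@ad'_Tdens_homog b); apply: homog_gr.
Qed.

(** The interior product and the dual product differ by the Koszul sign (-1)^(|A||B|), which is 1 on
    the support of the even J_2. *)
Lemma beta_interior_top (d : sym K q) : d = d setT *: sym_mon K setT ->
  beta U e (interior (J2 e) d) = d setT *: Tdens.
Proof.
move=> dE; rewrite /beta /Tdens scaler_sumr; apply: eq_bigr => A _; rewrite scalerA;
  congr (_ *: _).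
rewrite sum_ffunE.
have term (p : {set 'I_q} * {set 'I_q}) :
    ((J2 e p.1 * sym_cop d p) *: sym_mon K p.2) A =
    if p.2 == A then J2 e p.1 * (mon_sign K p.1 A * d (p.1 :|: A)) else 0.
  rewrite !ffunE eq_sym; case: eqP => [->|_]; last by rewrite scaler0.
  by rewrite -[_ *: _]/(_ * _) mulr1.
rewrite (eq_bigr _ (fun p _ => term p)) -(pair_bigA _ (fun B C => if C == A then J2 e B *
  (mon_sign K B A * d (B :|: A)) else 0)) /=.
rewrite {2}(dsym_expand (J2 e)) mulr_suml sum_ffunE mulr_sumr; apply: eq_bigr => B _.
rewrite (bigD1 A) //= eqxx big1 ?addr0 => [|C /negPf->] //.
rewrite -scalerAl dsym_monM !ffunE dE !ffunE eqxx.
have [oB|oB] := boolP (odd #|B|).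
  by rewrite (dhomog_J2 e_basis) ?oB // mul0r scale0r mulr0.
rewrite /mul_sign exprM -signr_odd (negPf oB) expr1n mul1r eq_sym.
rewrite -![_ *: _]/(_ * _) !mulr1; ring.
Qed.

End Invariance.

(** * A representation by vector fields *)

Section AltProduct.
Variable R : pzRingType.

Lemma alt_morph (R' : pzRingType) (phi : {rmorphism R -> R'}) n (r : nat -> R) :
  phi (alt n r) = alt n (phi \o r).
Proof.
rewrite rmorph_sum; apply: eq_bigr => s _.
by rewrite rmorphM rmorph_sign rmorph_prod.
Qed.

(** In the expansion along the first letter, [front] brings letter [k] back to its place; the sign
    (-1)^k appears twice, and n+1 equal terms remain. *)
Lemma alt_anticommuting n (r : nat -> R) : (forall i j, r i * r j = - (r j * r i)) ->
  alt n r = (n`!)%:R * \prod_(i < n) r i.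
Proof.
have front m (u : nat -> R) k : (forall i j, u i * u j = - (u j * u i)) -> (k <= m)%N ->
    u k * \prod_(j < m) u (bump k j) = (-1) ^+ k * \prod_(j < m.+1) u j.
  elim: m u k => [|m IHm] u [|k] // uC lekm.
    - by rewrite big_ord0 big_ord1 expr0 mul1r mulr1.
    - by rewrite [in RHS]big_ord_recl expr0 mul1r; congr (_ * _).
  rewrite big_ord_recl /= mulrA uC mulNr -mulrA.
  have -> : \prod_(i < m) u (bump k.+1 (bump 0 i)) = \prod_(i < m) (u \o succn) (bump k i).
    by apply: eq_bigr => i _; rewrite /= bumpS.
  rewrite -[u k.+1]/((u \o succn) k) IHm //; last by move=> i j; apply: uC.
  rewrite [in RHS]big_ord_recl exprS mulN1r mulNr; congr (- _).
  by rewrite [LHS]mulrA commr_sign -mulrA.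
elim: n r => [|n IHn] r rC; first by rewrite alt0 big_ord0 mulr1.
rewrite alt_recl.
have term (k : 'I_n.+1) : (-1) ^+ k * (r k * alt n (fun j => r (bump k j))) =
    n`!%:R * \prod_(i < n.+1) r i.
  rewrite IHn => [|i j]; last exact: rC.
  rewrite [r k * _]mulrA commr_nat -mulrA (front n r k rC) -1?ltnS //.
  by rewrite [LHS]mulrA commr_nat -mulrA [X in _ * X]mulrA -expr2 sqrr_sign mul1r.
rewrite (eq_bigr _ (fun k _ => term k)) sumr_const card_ord -[LHS]mulr_natl mulrA -natrM.
by rewrite factS.
Qed.

End AltProduct.

(** * The superalgebra of endomorphisms of the Grassmann algebra *)

Section Endomorphisms.
Variables (K : fieldType) (q : nat).
Local Notation Lam := (dsym K q).
Local Notation x_ A := (dsym_mon K A).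
Implicit Types (A : {set 'I_q}) (b c p : bool).

Definition dend : Type := 'End(Lam).
Implicit Types (f h : Lam) (u v : dend).

HB.instance Definition _ := GRing.Lmodule.copy dend 'End(Lam).

Fact dend_neq0 : (\1%VF : dend) != 0.
Proof.
by apply/eqP=> /lfunP/(_ 1)/eqP; rewrite lfunE zero_lfunE oner_eq0.
Qed.

HB.instance Definition _ := GRing.Zmodule_isNzRing.Build dend
  (@comp_lfunA _ _ _ _ _) (@comp_lfun1l _ _ _) (@comp_lfun1r _ _ _)
  (@comp_lfunDl _ _ _ _) (@comp_lfunDr _ _ _ _) dend_neq0.

HB.instance Definition _ := GRing.Lmodule_isLalgebra.Build K dend
  (fun k x y => comp_lfunZl k x y).

HB.instance Definition _ := GRing.Lalgebra_isAlgebra.Build K dend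
  (fun k x y => comp_lfunZr k x y).

Lemma dendM u v f : (u * v) f = u (v f).
Proof. exact: comp_lfunE. Qed.

Definition parity_part c f : Lam := [ffun A : {set 'I_q} => if odd #|A| == c then f A else 0].

Lemma parity_part_linear c : linear (parity_part c).
Proof.
by move=> k f h; apply/ffunP=> A; rewrite !ffunE; case: ifP; rewrite ?scaler0 ?addr0.
Qed.

HB.instance Definition _ c :=
  GRing.isLinear.Build K Lam Lam _ (parity_part c) (parity_part_linear c).

Lemma parity_part_homog c f : dhomog c (parity_part c f).
Proof. by move=> A /negPf nA; rewrite ffunE nA. Qed.

Lemma homog_parity_part c f : dhomog c f -> parity_part c f = f.
Proof. by move=> hf; apply/ffunP=> A; rewrite ffunE; case: eqP => // /eqP/hf. Qed.

Lemma parity_part_orth b c f : dhomog c f -> parity_part b f = if b == c then f else 0.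
Proof.
move=> hf; case: eqP => [->|/eqP nbc]; first exact: homog_parity_part.
by apply/ffunP=> A; rewrite !ffunE; case: eqP => // eb; rewrite hf // eb.
Qed.

Lemma parity_part_sum f : parity_part false f + parity_part true f = f.
Proof. by apply/ffunP=> A; rewrite !ffunE; case: odd; rewrite ?add0r ?addr0. Qed.

Definition dend_gr b (u : dend) : dend :=
  let p c : dend := linfun (parity_part c) in p b * u * p false + p (~~ b) * u * p true.

Lemma dend_grE b u f :
  dend_gr b u f = parity_part b (u (parity_part false f)) + parity_part (~~ b) (u (parity_part
    true f)).
Proof. by rewrite add_lfunE !dendM !lfunE. Qed.

Lemma dend_gr_linear b : linear (dend_gr b).
Proof.
move=> k u v; rewrite /dend_gr !mulrDr !mulrDl scalerDr addrACA.
by rewrite -!(scalerAl, scalerAr).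
Qed.

HB.instance Definition _ b := GRing.isLinear.Build K dend dend _ (dend_gr b) (dend_gr_linear b).

Lemma dend_gr_homog b c u f : dhomog c f -> dend_gr b u f = parity_part (b (+) c) (u f).
Proof.
move=> hf; rewrite dend_grE !(parity_part_orth _ hf).
by case: c {hf} => /=; rewrite !linear0 ?addr0 ?add0r ?addbT ?addbF.
Qed.

Lemma dend_eq u v : (forall c f, dhomog c f -> u f = v f) -> u = v.
Proof.
move=> uv; apply/lfunP=> f; rewrite -(parity_part_sum f) !linearD.
by congr (_ + _); apply: uv; apply: parity_part_homog.
Qed.

Fact dend_gr_orth b c u : dend_gr b (dend_gr c u) = if b == c then dend_gr c u else 0.
Proof.
apply: dend_eq => p f hf; rewrite !(dend_gr_homog _ _ hf) (parity_part_orth _ (@parity_part_homog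
  _ _)).
rewrite (inj_eq (@addIb p)); case: eqP => _; first by rewrite (dend_gr_homog _ _ hf).
by rewrite zero_lfunE.
Qed.

Fact dend_gr_sum u : dend_gr false u + dend_gr true u = u.
Proof.
apply: dend_eq => p f hf; rewrite add_lfunE !(dend_gr_homog _ _ hf).
have e := parity_part_sum (u f).
by case: (p) => /=; [apply: etrans (addrC _ _) e | apply: e].
Qed.

Definition dend_grading := Grading dend_gr_orth dend_gr_sum.

Lemma dend_homogP b u :
  homog dend_grading b u <-> forall p f, dhomog p f -> dhomog (b (+) p) (u f).
Proof.
split=> [hu p f hf|hu]; first by rewrite -hu /= (dend_gr_homog _ _ hf); apply: parity_part_homog.
apply: dend_eq => p f hf /=; rewrite (dend_gr_homog _ _ hf).
exact/homog_parity_part/hu.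
Qed.

Fact dend_homog1 : homog dend_grading false 1.
Proof. by apply/dend_homogP => p f hf; rewrite id_lfunE. Qed.

Fact dend_homogM b c u v : homog dend_grading b u -> homog dend_grading c v ->
  homog dend_grading (b (+) c) (u * v).
Proof.
move=> /dend_homogP hu /dend_homogP hv; apply/dend_homogP => p f hf.
by rewrite dendM -addbA; apply/hu/hv.
Qed.

Definition dend_superalgebra := Superalgebra dend_homog1 dend_homogM.

Section Evaluation.
Implicit Types (s t : dend_superalgebra).

Lemma sendP s t : (forall f, s f = t f) -> s = t.
Proof. by move=> st; apply/lfunP. Qed.

Lemma sendM s t f : (s * t) f = s (t f). Proof. exact: dendM. Qed.

Lemma send1 f : (1 : dend_superalgebra) f = f. Proof. exact: id_lfunE. Qed.

Lemma sendD s t f : (s + t) f = s f + t f. Proof. exact: add_lfunE. Qed.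

Lemma sendN s f : (- s) f = - s f. Proof. exact: opp_lfunE. Qed.

Lemma sendZ k s f : (k *: s) f = k *: s f. Proof. exact: scale_lfunE. Qed.

Lemma send0 f : (0 : dend_superalgebra) f = 0. Proof. exact: zero_lfunE. Qed.

Lemma send_sum I (r : seq I) (F : I -> dend_superalgebra) f :
  (\sum_(i <- r) F i) f = \sum_(i <- r) F i f.
Proof. exact: sum_lfunE. Qed.

End Evaluation.

End Endomorphisms.

(** * Leading terms of the vector fields *)

Section NonVanishing.
Variables (K : fieldType) (charK0 : [pchar K] =i pred0) (g : lieSuperalgebra K).
Variables (q : nat) (e : q.-tuple g) (e_basis : basis_of (odd_part g) e).
Local Notation Lam := (dsym K q).
Local Notation x_ A := (dsym_mon K A).
Local Notation G := (lie_gr g).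
Implicit Types (a x : g) (f h : Lam).

Lemma xif_linear i : linear ((xif e)^~ i).
Proof.
move=> k a a'; rewrite /xif !(linearP (G _)) !tensDl !tensZl !linearPl !linearP /=.
by rewrite addrACA [LHS]scalerDr -(scalerDr k) !scalerA [k * _]mulrC.
Qed.

Lemma Xf_linear f : linear ((Xf e)^~ f).
Proof.
move=> k a a'; rewrite /Xf /vecfield scaler_sumr -big_split; apply: eq_bigr => i _ /=.
by rewrite (xif_linear i) mulrDl scalerAl.
Qed.

Fact ex_Xend : {X : g -> dend_superalgebra K q | forall a f, X a f = - Xf e a f}.
Proof.
exists (fun a => linfun (-%R \o Xf e a)) => a f; exact: lfunE.
Qed.

(* Opaque, so that conversion never compares the underlying vector fields. *)
Definition Xend := sval ex_Xend.

Lemma XendE a f : Xend a f = - Xf e a f.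
Proof. exact: (svalP ex_Xend). Qed.

Lemma Xend_linear : linear Xend.
Proof.
move=> k a a'; apply: sendP => f; rewrite sendD sendZ !XendE.
by rewrite (Xf_linear f) opprD scalerN.
Qed.

HB.instance Definition _ := GRing.isLinear.Build K g (dend_superalgebra K q) _ Xend Xend_linear.

Lemma Xend_morphism : lie_morphism Xend.
Proof.
split=> [b a ha|b c x y hx hy].
  apply/dend_homogP => p f hf; rewrite XendE -scaleN1r; apply: dhomogZ.
  exact: (Xf_superderivation e_basis ha).1.
apply: sendP => f; rewrite sendD sendN sendZ !sendM !XendE.
have XN a h : Xf e a h = - Xf e a (- h) by rewrite linearN opprK.
apply: etrans (esym (Xf_commutator charK0 e_basis f hx hy)) _.
exact: (congr2 (fun u v => u - _ *: v) (XN _ _) (XN _ _)).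
Qed.

Lemma filD n f h : fil n f -> fil n h -> fil n (f + h).
Proof. by move=> hf hh A ltA; rewrite ffunE hf ?hh ?addr0. Qed.

Lemma filN n f : fil n f -> fil n (- f).
Proof. by move=> hf A ltA; rewrite ffunE hf ?oppr0. Qed.

Lemma filZ n k f : fil n f -> fil n (k *: f).
Proof. by move=> hf A ltA; rewrite ffunE hf ?scaler0. Qed.

Lemma filS n f : fil n.+1 f -> fil n f.
Proof. by move=> hf A ltA; apply/hf/ltnW. Qed.

Lemma fil_sum n I (s : seq I) (F : I -> Lam) :
  (forall i, fil n (F i)) -> fil n (\sum_(i <- s) F i).
Proof. by move=> hF A ltA; rewrite sum_ffunE big1 // => i _; apply: hF. Qed.

Lemma fil_pderiv n i f : fil n.+1 f -> fil n (pderiv i f).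
Proof.
by move=> hf A ltA; rewrite ffunE hf ?mulr0 // cardsU1; case: (i \in A); rewrite ?ltnS // ltnW.
Qed.

(** The series x coth x has constant term 1, so at the origin X_a for a = e_i is -2 d/dx_i: the 2
    and the sign are those of [xif]. *)
Lemma fil_xif (i j : 'I_q) : fil 1 (xif e e`_i j + 2%:R *: ((j == i)%:R *: 1)).
Proof.
have hi := e_odd e_basis i.
have -> : xif e e`_i j + 2%:R *: ((j == i)%:R *: 1) = - (2%:R *: cd e j (Vf e e`_i - tens e`_i
  1)).
  rewrite (xif_homog e _ hi) (linearB (cd e j)) /= (cd_basis e_basis) scalerBr opprB.
  by rewrite expr1 scaleN1r addrC.
apply/filN/filZ => A ltA; rewrite ffunE /Vf !(gr_homog _ hi) /= tens0l linear0l add0r.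
by rewrite (fil_pact_sub e _ (coef0_chQ K q)) // linear0.
Qed.

(** The remaining coefficients have positive degree, which compensates the degree lost by the
    derivative. *)
Lemma Xend_leading n (i : 'I_q) f : fil n f -> fil n (Xend e`_i f - 2%:R *: pderiv i f).
Proof.
case: n => [//|n] hf.
have -> : Xend e`_i f - 2%:R *: pderiv i f =
    - \sum_j (xif e e`_i j + 2%:R *: ((j == i)%:R *: 1)) * pderiv j f.
  rewrite XendE -opprD; congr (- _).
  under [RHS]eq_bigr do rewrite mulrDl.
  rewrite big_split /=; congr (_ + _); rewrite (bigD1 i) //= eqxx scale1r -scalerAl mul1r.
  by rewrite big1 ?addr0 // => j /negPf->; rewrite scale0r scaler0 mul0r.
apply/filN/fil_sum => j; rewrite -add1n.
by apply: fil_mul (fil_pderiv j hf); apply: fil_xif.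
Qed.

(* Indexed by nat, like the words of alt; zero beyond q. *)
Definition Dend k : dend_superalgebra K q :=
  if insub k is Some i then linfun (fun h => 2%:R *: pderiv (i : 'I_q) h) else 0.

Lemma DendE (i : 'I_q) f : Dend i f = 2%:R *: pderiv i f.
Proof.
pose D : {linear Lam -> Lam} := 2%:R \*: pderiv i.
by rewrite /Dend valK; apply: (lfunE D f).
Qed.

Lemma Dend_ge k : (q <= k)%N -> Dend k = 0.
Proof. by move=> leqk; rewrite /Dend insubF // ltnNge leqk. Qed.

Lemma fil_Dend n k f : fil n.+1 f -> fil n (Dend k f).
Proof.
move=> hf; have [ltkq|leqk] := ltnP k q; last by rewrite (Dend_ge leqk) send0 => A _;
  rewrite ffunE.
by rewrite (DendE (Ordinal ltkq)); apply/filZ/fil_pderiv.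
Qed.

Lemma fil_Xend_sub n k f : fil n f -> fil n (Xend e`_k f - Dend k f).
Proof.
move=> hf; have [ltkq|leqk] := ltnP k q.
  by rewrite (DendE (Ordinal ltkq)); apply: (Xend_leading (Ordinal ltkq) hf).
by rewrite (Dend_ge leqk) nth_default ?size_tuple // linear0 subrr => A _; rewrite ffunE.
Qed.

(** Each letter lowers the degree by at most one, and replacing it by its leading term causes an
    error one step higher in the filtration. *)
Lemma Xend_word n m (w : 'I_n -> nat) f : fil (n + m) f ->
  fil m ((\prod_i Xend e`_(w i)) f) /\
  fil m.+1 ((\prod_i Xend e`_(w i)) f - (\prod_i Dend (w i)) f).
Proof.
elim: n m w => [|n IHn] m w hf.
  by rewrite !big_ord0 subrr send1; split=> [|A _]; [apply: hf | rewrite ffunE].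
rewrite !big_ord_recl !sendM; set P := \prod_(i < n) _; set Q := \prod_(i < n) _.
have [hP hPQ] : fil m.+1 (P f) /\ fil m.+2 (P f - Q f) by apply: IHn; rewrite addnS.
have hX := fil_Xend_sub (w ord0) hP.
have hD : fil m (Dend (w ord0) (P f)) by apply: fil_Dend.
split; first by rewrite -(subrK (Dend (w ord0) (P f)) (Xend _ _)); apply: filD (filS hX) hD.
rewrite -(subrK (Dend (w ord0) (P f)) (Xend _ _)) -addrA -linearB; apply: filD hX _.
exact: fil_Dend.
Qed.

Lemma Xend_alt n m (w : nat -> nat) f : fil (n + m) f ->
  fil m ((alt n (fun k => Xend e`_(w k))) f) /\
  fil m.+1 ((alt n (fun k => Xend e`_(w k))) f - (alt n (Dend \o w)) f).
Proof.
move=> hf; rewrite /alt !send_sum -sumrB.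
have sgn (b : bool) (u : dend_superalgebra K q) : ((-1) ^+ b * u) f = (-1) ^+ b *: u f.
  by case: b; rewrite ?mulN1r ?mul1r ?sendN ?scaleN1r ?scale1r.
split; apply: fil_sum => s; rewrite !sgn -?scalerBr; apply: filZ.
  exact: (Xend_word (fun i => w (s i)) hf).1.
exact: (Xend_word (fun i => w (s i)) hf).2.
Qed.

Lemma DendC k l : Dend k * Dend l = - (Dend l * Dend k).
Proof.
have [ltk|lek] := ltnP k q; last by rewrite !(Dend_ge lek) mul0r mulr0 oppr0.
have [ltl|lel] := ltnP l q; last by rewrite !(Dend_ge lel) mul0r mulr0 oppr0.
pose i := Ordinal ltk; pose j := Ordinal ltl.
apply: sendP => f; rewrite sendN !sendM !(DendE i) !(DendE j) !linearZ /=.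
suff -> : pderiv i (pderiv j f) = - pderiv j (pderiv i f) by rewrite !scalerN.
elim/dsym_ind: f => [|f h IH IH'|c f IH||l' f IH]; rewrite ?pderiv1 ?linear0 ?oppr0 //.
- by rewrite !linearD /= IH IH'.
- by rewrite !linearZ /= IH scalerN.
rewrite !pderivX !(linearB (pderiv _)) /= !linearZ /= !pderivX IH mulrN !opprB.
by rewrite addrA.
Qed.

(** The last factor acts first and removes the largest index, so the monomial is stripped down to a
    constant. *)
Lemma prod_Dend m : (m <= q)%N -> exists2 c : K, c != 0 &
  (\prod_(k < m) Dend k) (x_ [set i : 'I_q | (i < m)%N]) = c *: 1.
Proof.
elim: m => [_|m IHm ltmq].
  exists 1; rewrite ?oner_eq0 // big_ord0 scale1r send1 -dsym_mon0; congr (x_ _).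
have [c c0 IH] := IHm (ltnW ltmq); pose i := Ordinal ltmq.
set S := [set _ | _]; have iS : i \in S by rewrite inE /= ltnSn.
exists (2%:R * mul_sign K [set i] (S :\ i) * c).
  rewrite mulf_neq0 // mulf_neq0 ?half2 //; apply/eqP=> ms0.
  have := @mul_sign_sqr K q [set i] (S :\ i); rewrite ms0 mul0r disjoints1 !inE eqxx.
  by move/(_ isT)/esym/eqP; rewrite oner_eq0.
have eS : S :\ i = [set k : 'I_q | (k < m)%N].
  by apply/setP=> k; rewrite !inE -val_eqE /= ltnS [RHS]ltn_neqAle.
rewrite -eS in IH; rewrite big_ord_recr sendM (DendE i) pderiv_mon iS scalerA linearZ /=.
by rewrite IH scalerA.
Qed.

End NonVanishing.

(** * Nonvanishing of the element *)

Section NonVanishingDensity.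
Variables (K : fieldType) (charK0 : [pchar K] =i pred0) (g : lieSuperalgebra K).
Variables (q : nat) (e : q.-tuple g) (e_basis : basis_of (odd_part g) e).
Variable U : envelopingAlgebra g.
Local Notation Lam := (dsym K q).
Local Notation x_ A := (dsym_mon K A).

Lemma fil_top : fil q (x_ [set: 'I_q]).
Proof.
move=> A ltA; rewrite ffunE; case: eqP => // eA.
by move: ltA; rewrite eA cardsT card_ord ltnn.
Qed.

Lemma dsym_mul_top (f : Lam) : (f * x_ setT) setT = aug f.
Proof.
rewrite {1}(dsym_expand f) mulr_suml sum_ffunE (bigD1 set0) //= big1 ?addr0 => [|A nA].
  by rewrite -scalerAl dsym_monM mul_sign0l set0U scale1r !ffunE eqxx; apply: mulr1.
rewrite -scalerAl dsym_monM mul_sign_eq0 ?scale0r ?scaler0 ?ffunE //.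
by rewrite -setI_eq0 setIT.
Qed.

(** Fewer than q operators, each lowering the degree by at most one, cannot bring the top monomial
    to degree 0; so only beta(e_A) with A = [setT] is seen, and its coefficient is the constant term
    1 of J_2. *)
Lemma Tdens_neq0 : Tdens e U != 0.
Proof.
have [phi [_ phiE _]] := uea_univ U (Xend_morphism charK0 e_basis).
pose w (A : {set 'I_q}) := nth q [seq val i | i <- enum A].
have phi_alt A : phi (alt_set e U A) = alt #|A| (fun k => Xend e e`_(w A k)).
  rewrite (alt_setE charK0) alt_morph; apply: eq_alt => k ltk /=.
  have x0 : 'I_q by apply: Ordinal (leq_trans ltk _); rewrite -[leqRHS]card_ord max_card.
  by rewrite (odd_wordE e U x0 ltk) phiE /w (nth_map x0) -?cardE.
pose ev u := phi u (x_ setT) set0.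
have ev_alt A : ev (alt_set e U A) = #|A|`!%:R * ev (beta_mon U e A).
  by rewrite /ev /alt_set linearZ sendZ ffunE.
have ev_lower A : A != setT -> ev (beta_mon U e A) = 0.
  move=> nA; have ltA : (#|A| < q)%N.
    by rewrite -[ltnRHS]card_ord -cardsT proper_card // properT.
  apply: (mulfI (factK_neq0 charK0 #|A|)); rewrite mulr0 -ev_alt /ev phi_alt.
  have filA : fil (#|A| + (q - #|A|)) (x_ [set: 'I_q]) by rewrite subnKC ?(ltnW ltA) //;
    apply: fil_top.
  have [h _] := Xend_alt e_basis (w A) filA.
  by rewrite h // cards0 subn_gt0.
have [c c0 cE] := prod_Dend charK0 (leqnn q).
have ev_top : ev (beta_mon U e setT) = c.
  apply: (mulfI (factK_neq0 charK0 q)); rewrite -{1}[q]card_ord -cardsT -ev_alt /ev phi_alt.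
  rewrite cardsT card_ord.
  have filT : fil (q + 0) (x_ [set: 'I_q]) by rewrite addn0; apply: fil_top.
  have [_ h] := Xend_alt e_basis (w setT) filT.
  have := h set0; rewrite cards0 => /(_ isT)/eqP;
    rewrite ffunE [X in _ + X]ffunE subr_eq0 => /eqP->.
  have -> : alt q (Dend K q \o w setT) = alt q (Dend K q).
    apply: eq_alt => k ltk; rewrite /= /w; congr (Dend K q _).
    have -> : enum [set: 'I_q] = enum 'I_q by apply: eq_enum => i; rewrite inE.
    by rewrite val_enum_ord nth_iota.
  (* The leading terms anticommute, so that the antisymmetrized product is q! times a single
     product, and the q! cancels that of [alt_set]. *)
  rewrite (alt_anticommuting _ (@DendC K q)).
  have eT : [set i : 'I_q | (i < q)%N] = setT by apply/setP=> i; rewrite !inE ltn_ord.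
  rewrite mulr_natl -scaler_nat sendZ -eT cE ffunE [X in _ *: X]ffunE -dsym_mon0 ffunE eqxx.
  by rewrite -![_ *: _]/(_ * _) mulr1.
have evE : ev (Tdens e U) = c.
  rewrite /ev /Tdens linear_sum send_sum sum_ffunE (bigD1 setT) //= big1 ?addr0 => [|A nA].
    rewrite linearZ sendZ ffunE -/(ev _) ev_top.
    by rewrite dsym_mul_top (J2_set0 e_basis) scale1r.
  by rewrite linearZ sendZ ffunE -/(ev _) ev_lower // scaler0.
apply/eqP=> T0; move/eqP: c0; apply; rewrite -evE T0 /ev linear0 send0 ffunE.
by [].
Qed.

Lemma sym_deg_top (d : sym K q) : d \in sym_deg K q q -> d = d setT *: sym_mon K setT.
Proof.
rewrite /sym_deg.
have -> : [seq sym_mon K A | A in [set A : {set 'I_q} | #|A| == q]] = [:: sym_mon K setT].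
  have -> : [set A : {set 'I_q} | #|A| == q] = [set setT].
    apply/setP=> A; rewrite !inE; apply/eqP/eqP => [cA|->]; last by rewrite cardsT card_ord.
    by apply/eqP; rewrite eqEcard subsetT cardsT card_ord cA leqnn.
  by rewrite /image_mem enum_set1.
rewrite span_seq1 => /vlineP[k ->].
by rewrite ffunE ffunE eqxx -[k *: _ in RHS]/(_ * _) mulr1.
Qed.

End NonVanishingDensity.

Theorem theorem0p1 (K : fieldType) (charK0 : [pchar K] =i pred0)
  (g : lieSuperalgebra K) (U : envelopingAlgebra g)
  (q : nat) (dim_q : \dim (odd_part g) = q)
  (e : q.-tuple g) (e_basis : basis_of (odd_part g) e)
  (str0 : forall a : g, homog (lie_gr g) false a -> str_odd e (lie a) = 0)
  (d : sym K q) (d_basis : basis_of (sym_deg K q q) [:: d]) :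
  Gorelik_element e (beta U e (interior (J2 e) d)).
Proof.
have dE : d = d setT *: sym_mon K setT.
  by apply/sym_deg_top/(basis_mem d_basis); rewrite mem_head.
have TE := beta_interior_top e_basis U dE.
split=> [||a]; last by rewrite TE linearZ /= (ad'_Tdens charK0 e_basis str0) scaler0.
  rewrite TE scaler_eq0 negb_or (Tdens_neq0 charK0 e_basis) andbT.
  apply/eqP=> d0; have := basis_not0 d_basis (mem_head d [::]).
  by rewrite dE d0 scale0r eqxx.
by exists (interior (J2 e) d).
Qed.
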